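(* Let $\varphi$ be a linear continuous map on $H$ such that $\varphi^*\varphi=\varphi\varphi^*=\mathrm{Id}_H$. Let $A$ be a linear, selfadjoint, nonnegative, trace class operator on $H$. For all $f\in S(Q_A)$, $$\forall t\ge0,\quad (H_tf)\circ\varphi=H_t(f\circ\varphi).$$
   Context: Wiener space. $H$ is a real, separable, infinite dimensional Hilbert space with scalar product $\langle\cdot,\cdot\rangle$ and norm $|\cdot|$; $B$ is the Banach space obtained by completing $H$ for a measurable norm (in the sense of Gross), and $H$ is identified with its dual, so that $B'\subset H\subset B$. For $h>0$, $\mu_{B,h}$ is the Gaussian probability measure of variance $h$ on the Borel $\sigma$-algebra of $B$: for $y_1,\dots,y_n\in B'$ orthonormal in $H$, the image of $\mu_{B,h}$ under $x\mapsto (y_1(x),\dots,y_n(x))$ is $(2\pi h)^{-n/2}e^{-|v|^2/(2h)}dv$ on $\mathbb R^n$. For $a\in H$, $\ell_a\in L^2(B,\mu_{B,h})$ is the image of $a$ under the continuous extension to $H$ of the map $B'\ni y\mapsto y(\cdot)$. For a finite dimensional subspace $E\subset H$ with orthonormal basis $(w_1,\dots,w_n)$, $\tilde\pi_E(x)=\sum_j\ell_{w_j}(x)w_j$ for $x\in B$. A Borel function $f$ on $H$ admits $\tilde f$ as a stochastic extension in $L^p(B,\mu_{B,h})$ if, for every increasing sequence $(E_n)$ of finite dimensional subspaces of $H$ with dense union, $f\circ\tilde\pi_{E_n}\in L^p(B,\mu_{B,h})$ and $f\circ\tilde\pi_{E_n}\to\tilde f$ in $L^p(B,\mu_{B,h})$.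 Symbol class. $Q_A(x)=\langle Ax,x\rangle$. $S(Q_A)$ is the class of all $f\in C^\infty(H)$ for which there is $C(f)>0$ with $|f(x)|\le C(f)$ for all $x\in H$ and $|(d^mf)(x)(U_1,\dots,U_m)|\le C(f)\prod_{j=1}^mQ_A(U_j)^{1/2}$ for all $m\in\mathbb N^*$, $x\in H$, $U_1,\dots,U_m\in H$. (If $f\in S(Q_A)$ then $f\circ\varphi\in S(Q_{\varphi^*A\varphi})$.) Heat operator. For $t>0$ and $f$ on $H$ admitting a stochastic extension $\tilde f$ in some $L^p(B,\mu_{B,t})$, $p\in[1,\infty[$ (this holds for $f$ in any class $S(Q_A)$), $(H_tf)(x)=\int_B\tilde f(x+y)\,d\mu_{B,t}(y)$ for $x\in H$. $H_0$ is the identity. *)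

(* Defs.v *)
From HB Require Import structures.
From mathcomp Require Import all_boot all_order all_algebra sesquilinear.
From mathcomp Require Import all_classical all_reals all_analysis.
From mathcomp Require Import complex.

Set Implicit Arguments.
Unset Strict Implicit.
Unset Printing Implicit Defensive.

Import Order.TTheory GRing.Theory Num.Theory.
Import numFieldNormedType.Exports.

Local Open Scope classical_set_scope.
Local Open Scope ring_scope.

Definition borel (T : ptopologicalType) := g_sigma_algebraType (@open T).

Section gaussian_on_tuples.
Context {R : realType}.
Let RB := measurableTypeR R.

Definition cons_pair n (p : n.-tuple RB * RB) : n.+1.-tuple RB :=
  [tuple of p.2 :: p.1].

Lemma measurable_cons_pair n : measurable_fun setT (@cons_pair n).
Proof. by apply: measurable_cons. Qed.

Fixpoint lebesgue_tuple n : {measure set (n.-tuple RB) -> \bar R} :=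
  match n with
  | 0 => dirac [tuple]
  | m.+1 => measure_function_pushforward__canonical__measure_function_Measure
              (lebesgue_tuple m \x (@lebesgue_measure R))%E
              (@measurable_cons_pair m)
  end.

Definition gaussian_density n (h : R) (v : n.-tuple RB) : R :=
  (2 * pi * h) `^ (- (n%:R / 2)) *
  expR (- (\sum_(i < n) tnth v i ^+ 2) / (2 * h)).

Definition gaussian n (h : R) (A : set (n.-tuple RB)) : \bar R :=
  (\int[lebesgue_tuple n]_(v in A) (gaussian_density h v)%:E)%E.

End gaussian_on_tuples.

Section hilbert.
Context {R : realType} {H : completeNormedModType R} (ip : {dot H for idfun}).

Definition span (w : seq H) : set H :=
  [set x | exists c : 'I_(size w) -> R, x = \sum_(i < size w) c i *: w`_i].

Definition separable := exists2 S : set H, countable S & dense S.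

Definition finite_dimensional := exists w : seq H, span w = setT.

Definition orthonormal_basis (w : seq H) (E : set H) :=
  orthonormal ip w /\ span w = E.

Definition hilbert_basis (e : nat -> H) :=
  (forall n, orthonormal ip (mkseq e n)) /\
  dense (\bigcup_n span (mkseq e n)).

Definition adjoint (T Ts : H -> H) := forall x y, ip (T x) y = ip x (Ts y).

Definition selfadjoint (T : H -> H) := adjoint T T.

Definition nonnegative (T : H -> H) := forall x, 0 <= ip (T x) x.

(* T = |A|, the nonnegative square root of A^* A *)
Definition modulus (A T : {linear H -> H}) :=
  [/\ continuous T, selfadjoint T, nonnegative T &
      forall x y, ip (T (T x)) y = ip (A x) (A y)].

Definition trace_class (A : {linear H -> H}) :=
  continuous A /\
  exists T : {linear H -> H}, modulus A T /\
  exists e : nat -> H, hilbert_basis e /\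
    cvgn (series (fun n => ip (T (e n)) (e n))).

End hilbert.

Arguments separable {R} H.
Arguments finite_dimensional {R} H.

Section symbols.
Context {R : realType} {H : completeNormedModType R}.

(* [dm g [:: U1; ...; Um] x] is (d^m g)(x)(U1, ..., Um). *)
Definition dm (g : H -> R) (U : seq H) : H -> R :=
  foldr (fun u k => 'D_u k) g U.

(* For every m, [x |-> dm g ^~ x] takes its values in the continuous m-linear
   forms and is Frechet differentiable for the norm of these forms, with
   derivative given by [dm g] on sequences of length m+1. *)
Definition smooth (g : H -> R) := forall m : nat,
  [/\ forall x (s1 s2 : seq H), (size s1 + size s2).+1 = m ->
        scalar (fun u => dm g (s1 ++ u :: s2) x),
      forall x, exists C : R, forall U : seq H, size U = m ->
        `|dm g U x| <= C * \prod_(u <- U) `|u| &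
      forall x (eps : R), 0 < eps -> exists2 delta : R, 0 < delta &
        forall h, `|h| < delta -> forall U : seq H, size U = m ->
          `|dm g U (x + h) - dm g U x - dm g (h :: U) x| <=
          eps * `|h| * \prod_(u <- U) `|u|].

Definition Re_fun T (f : T -> R[i]) : T -> R := fun x => complex.Re (f x).
Definition Im_fun T (f : T -> R[i]) : T -> R := fun x => complex.Im (f x).

Definition dmC (f : H -> R[i]) (U : seq H) (x : H) : R[i] :=
  (dm (Re_fun f) U x +i* dm (Im_fun f) U x)%C.

Definition symbol_class (ip : {dot H for idfun}) (A : H -> H)
    (f : H -> R[i]) :=
  smooth (Re_fun f) /\ smooth (Im_fun f) /\
  exists2 C : R, 0 < C &
    (forall x, Normc.normc (f x) <= C) /\
    (forall x (U : seq H), U != [::] ->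
       Normc.normc (dmC f U x) <= C * \prod_(u <- U) Num.sqrt (ip (A u) u)).

End symbols.

Section wiener_space.
Context {R : realType} {H B : completeNormedModType R}.
Variables (ip : {dot H for idfun}) (iota : {linear H -> B}).

(* Measurability in the sense of Gross: finite dimensional orthogonal
   projections are given by orthonormal families, and the canonical Gauss
   cylinder measure (variance 1) of {x | N (P x) > eps} is the Gaussian measure
   of the corresponding set of coordinates. *)
Definition measurable_norm (N : H -> R) :=
  [/\ forall x y, N (x + y) <= N x + N y,
      forall a x, N (a *: x) = `|a| * N x,
      forall x, N x = 0 -> x = 0 &
      forall eps : R, 0 < eps ->
        exists w0 : seq H, orthonormal ip w0 /\
        forall w : seq H, orthonormal ip w -> orthogonal ip w0 w ->
          (gaussian 1 [set v : (size w).-tuple (measurableTypeR R) |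
             (eps < N (\sum_(i < size w) tnth v i *: w`_i))%R] < eps%:E)%E].

Definition is_completion (N : H -> R) :=
  (forall x, `|iota x| = N x) /\ dense (range iota).

(* y is an element of B' and a is its image under B' -> H. *)
Definition dual_elt (a : H) (y : B -> R) :=
  [/\ scalar y, continuous (y : B -> R^o) & forall x, y (iota x) = ip a x].

Definition gaussian_measure (h : R) (mu : set (borel B) -> \bar R) :=
  forall n (a : n.-tuple H) (y : 'I_n -> borel B -> measurableTypeR R),
    orthonormal ip a -> (forall i, dual_elt (tnth a i) (y i)) ->
    forall A : set (n.-tuple (measurableTypeR R)), measurable A ->
      pushforward mu (fun x => [tuple y i x | i < n]) A = gaussian h A.

Variable mu : probability (borel B) R.

(* l represents in L^2(B, mu) the limit of b |-> y(.), for b in B' tending to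
   a in H. *)
Definition is_ell (a : H) (l : borel B -> R) :=
  l \in Lfun mu 2%:E /\
  forall eps : R, 0 < eps -> exists2 delta : R, 0 < delta &
    forall (b : H) (y : borel B -> R), dual_elt b y -> `|b - a| < delta ->
      ('N[mu]_2%:E[EFin \o (y \- l)%R] < eps%:E)%E.

Definition ell (a : H) : borel B -> R := xget (cst 0) [set l | is_ell a l].

Definition tilde_pi (w : seq H) (x : borel B) : H :=
  \sum_(a <- w) ell a x *: a.

Definition measurable_funC d (T : measurableType d) (g : T -> R[i]) :=
  measurable_fun setT (Re_fun g) /\ measurable_fun setT (Im_fun g).

Definition LnormC (p : R) (g : borel B -> R[i]) : \bar R :=
  'N[mu]_p%:E[EFin \o (fun x => Normc.normc (g x))]%E.

Definition in_LpC (p : R) (g : borel B -> R[i]) :=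
  measurable_funC g /\ (LnormC p g < +oo)%E.

Definition stochastic_extension (p : R) (f : H -> R[i])
    (ft : borel B -> R[i]) :=
  [/\ measurable_funC (f : borel H -> R[i]), in_LpC p ft &
    forall (E : nat -> set H) (w : nat -> seq H),
      (forall n, orthonormal_basis ip (w n) (E n)) ->
      (forall n, E n `<=` E n.+1) -> dense (\bigcup_n E n) ->
      (forall n, in_LpC p (f \o tilde_pi (w n))) /\
      LnormC p (fun x => f (tilde_pi (w n) x) - ft x) @[n --> \oo] --> 0%E].

(* The a.e. class of the extension does not depend on p; a representative is
   chosen (the zero function if there is no extension). *)
Definition tilde (f : H -> R[i]) : borel B -> R[i] :=
  xget (cst 0) [set ft | exists2 p : R, 1 <= p & stochastic_extension p f ft].

Definition integralC (g : borel B -> R[i]) : R[i] :=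
  ((\int[mu]_y Re_fun g y) +i* (\int[mu]_y Im_fun g y))%C.

End wiener_space.

Definition heat {R : realType} {H B : completeNormedModType R}
    (ip : {dot H for idfun}) (iota : {linear H -> B})
    (mu : R -> probability (borel B) R) (t : R) (f : H -> R[i]) : H -> R[i] :=
  if t == 0 then f
  else fun x =>
    integralC (mu t) (fun y : borel B => tilde ip iota (mu t) f (iota x + y)).

(* Main.v *)
(* The joint law of (ell a_1, ..., ell a_n) depends only on the inner
   products of the a_i, so it does not change when each a_i is replaced by
   phi a_i. Hence the L^1 distances between the functions
   f o phi o tilde_pi_{E_n} equal those between the f o tilde_pi_{phi E_n}, and
   f o phi has a stochastic extension as soon as f has one (and conversely, with
   the inverse of phi).

   As phi does not act on B, the two integrals cannot be compared by a change of
   variables. Write x = s u with |u| = 1. By the Cameron-Martin formula the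
   integral of f~(x + y) is that of f~ D_u with D_u = exp(s ell_u / t - s^2 / (2 t)),
   which is square integrable; as f is bounded, it is the limit of the integrals
   of f(tilde_pi_{E_n}) D_u. These involve finitely many ell's only, and the
   invariance of joint laws identifies the integrals for f, phi x and phi E_n with
   those for f o phi, x and E_n.

   The Cameron-Martin formula holds on cylinders by completing the square in the
   Gaussian density, and these determine a Borel measure because countably many
   elements of B' generate the Borel sigma-algebra of the separable space B. *)
Require Import Defs.
From HB Require Import structures.
From mathcomp Require Import all_boot all_order all_algebra sesquilinear.
From mathcomp Require Import all_classical all_reals all_analysis.
From mathcomp Require Import complex measurable_realfun ring lra.

Set Implicit Arguments.
Unset Strict Implicit.
Unset Printing Implicit Defensive.

Import Order.TTheory GRing.Theory Num.Theory.
Import numFieldNormedType.Exports.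

Local Open Scope classical_set_scope.
Local Open Scope ring_scope.

(** The Gaussian hypothesis speaks only of orthonormal families in the image of B', while [ell] is
    needed on all of H. This forces a chain of density arguments: Hahn-Banach gives functionals on
    B, Riesz turns them into elements of H, these are dense, and an orthonormal family of H is
    approximated by families in the image of B' that are exactly orthonormal. Riesz needs [iota] to
    be bounded, which has to be extracted from measurability of the norm in the sense of Gross. Null
    sets are the second difficulty. [ell] and [tilde] are representatives of classes, so identities
    between them hold almost everywhere, and a translation of B is not known in advance to preserve
    null sets. The Cameron-Martin formula is therefore proved first on cylinders given by elements
    of B', which are genuine functions on B. Finally, the extensions of f and of [f \o phi] may come
    with different exponents p; everything is brought back to L^1 convergence of real and imaginary
    parts. *)

Local Notation span := Defs.span.

(** * Hilbert space geometry *)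

Section inner_product.
Context {R : realType} {H : completeNormedModType R} (ip : {dot H for idfun}).
Implicit Types (x y z u : H) (a : R) (s w : seq H).

Lemma ipC x y : ip x y = ip y x.
Proof. by have := hermC ip x y; rewrite /= expr0 mul1r. Qed.

Lemma ipDl x y z : ip (x + y) z = ip x z + ip y z.
Proof. exact: linearDl. Qed.

Lemma ipDr x y z : ip x (y + z) = ip x y + ip x z.
Proof. by rewrite ipC ipDl !(ipC x). Qed.

Lemma ipZl a x y : ip (a *: x) y = a * ip x y.
Proof. exact: linearZl_LR. Qed.

Lemma ipZr a x y : ip x (a *: y) = a * ip x y.
Proof. by rewrite ipC ipZl ipC. Qed.

Lemma ipNl x y : ip (- x) y = - ip x y.
Proof. by rewrite -scaleN1r ipZl mulN1r. Qed.

Lemma ipNr x y : ip x (- y) = - ip x y.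
Proof. by rewrite ipC ipNl ipC. Qed.

Lemma ip0l x : ip 0 x = 0.
Proof. by rewrite -(scale0r x) ipZl mul0r. Qed.

Lemma ip0r x : ip x 0 = 0.
Proof. by rewrite ipC ip0l. Qed.

Lemma ip_suml (I : Type) (r : seq I) (F : I -> H) y :
  ip (\sum_(i <- r) F i) y = \sum_(i <- r) ip (F i) y.
Proof.
elim: r => [|i r ih]; first by rewrite !big_nil ip0l.
by rewrite !big_cons ipDl ih.
Qed.

Lemma ip_sumr (I : Type) (r : seq I) (F : I -> H) y :
  ip y (\sum_(i <- r) F i) = \sum_(i <- r) ip y (F i).
Proof. by rewrite ipC ip_suml; apply: eq_bigr => i _; rewrite ipC. Qed.

Lemma orthonormal_cons u w :
  orthonormal ip (u :: w) <->
  [/\ ip u u = 1, (forall v, v \in w -> ip u v = 0) & orthonormal ip w].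
Proof.
rewrite /orthonormal /= /ortho_rec /= andbT; split.
  move=> /andP[/andP[/eqP u1 w1] /andP[/allP uw ww]]; split => //.
    by move=> v /uw /eqP.
  by rewrite w1 ww.
move=> [-> uw /andP[w1 ww]]; rewrite eqxx w1 ww /= andbT.
by apply/allP => v /uw /= ->.
Qed.

Lemma orthonormal_nthP w : orthonormal ip w <->
  (forall i j, (i < size w)%N -> (j < size w)%N ->
     ip w`_i w`_j = (i == j)%:R).
Proof.
elim: w => [|u w ih]; first by split.
split.
  move=> /orthonormal_cons[u1 uw /ih ww] [|i] [|j] //= si sj.
  - by rewrite uw// mem_nth.
  - by rewrite ipC uw// mem_nth.
  - by rewrite ww.
move=> h; apply/orthonormal_cons; split.
- exact: (h 0%N 0%N).
- by move=> v /(nthP 0)[i si <-]; rewrite (h 0%N i.+1).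
- by apply/ih => i j si sj; rewrite (h i.+1 j.+1).
Qed.

Lemma spanP w x :
  span w x <-> exists c : nat -> R, x = \sum_(i < size w) c i *: w`_i.
Proof.
split=> [[c ->]|[c ->]]; last by exists (fun i => c i).
exists (fun n => if insub n is Some i then c i else 0).
by apply: eq_bigr => i _; rewrite valK.
Qed.

Lemma span_mem w x : x \in w -> span w x.
Proof.
move=> /(nthP 0)[i si <-]; apply/spanP; exists (fun j => (j == i)%:R).
rewrite (bigD1 (Ordinal si)) //= eqxx scale1r big1 ?addr0// => j ji.
by rewrite -val_eqE /= in ji; rewrite (negbTE ji) scale0r.
Qed.

Lemma span_lin w a x y : span w x -> span w y -> span w (a *: x + y).
Proof.
move=> [c ->] [d ->]; exists (fun i => a * c i + d i).
rewrite scaler_sumr -big_split /=; apply: eq_bigr => i _.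
by rewrite scalerA -scalerDl.
Qed.

Lemma span0 w : span w 0.
Proof. by exists (fun=> 0); rewrite big1// => i _; rewrite scale0r. Qed.

Lemma span_sum w (I : Type) (r : seq I) (F : I -> H) (c : I -> R) :
  (forall i, span w (F i)) -> span w (\sum_(i <- r) c i *: F i).
Proof.
move=> h; elim: r => [|i r ih]; first by rewrite big_nil; exact: span0.
by rewrite big_cons; apply: span_lin.
Qed.

Lemma span_subset w s : (forall x, x \in w -> span s x) -> span w `<=` span s.
Proof.
move=> h x [c ->]; apply: (@span_sum s 'I_(size w) _ (fun i => w`_i)) => i.
by apply: h; rewrite mem_nth.
Qed.

Lemma orthonormal_expansion w x : orthonormal ip w -> span w x ->
  x = \sum_(i < size w) ip x w`_i *: w`_i.
Proof.
move=> /orthonormal_nthP ow [c xE]; rewrite {1}xE; apply: eq_bigr => i _.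
congr (_ *: _); rewrite xE ip_suml (bigD1 i) //= ipZl ow // eqxx mulr1.
rewrite big1 ?addr0// => j ji; rewrite ipZl ow //.
by rewrite -val_eqE in ji; rewrite (negbTE ji) mulr0.
Qed.

End inner_product.

Section hilbert_geometry.
Context {R : realType} {H : completeNormedModType R} (ip : {dot H for idfun}).
Hypothesis ip_norm : forall x, ip x x = `|x| ^+ 2.
Implicit Types (x y z u : H) (a : R) (s w : seq H).

Lemma sqr_normD x y : `|x + y| ^+ 2 = `|x| ^+ 2 + 2 * ip x y + `|y| ^+ 2.
Proof. by rewrite -!ip_norm ipDl !ipDr (ipC ip y x); ring. Qed.

Lemma sqr_normB x y : `|x - y| ^+ 2 = `|x| ^+ 2 - 2 * ip x y + `|y| ^+ 2.
Proof. by rewrite sqr_normD ipNr normrN; ring. Qed.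

Lemma cauchy_schwarz x y : `|ip x y| <= `|x| * `|y|.
Proof.
have [->|y0] := eqVneq y 0; first by rewrite ip0r !normr0 mulr0.
have ny : 0 < `|y| by rewrite normr_gt0.
have ny2 : 0 < `|y| ^+ 2 by rewrite exprn_gt0.
rewrite -(@ler_pXn2r _ 2)// ?nnegrE ?mulr_ge0// real_normK ?num_real//.
have := sqr_ge0 (`| x - (ip x y / `|y| ^+ 2) *: y|).
rewrite sqr_normB ipZr normrZ exprMn real_normK ?num_real//.
set c := ip x y; set Y := `|y| ^+ 2 in ny2 *.
have -> : `|x| ^+ 2 - 2 * (c / Y * c) + (c / Y) ^+ 2 * Y =
  (`|x| ^+ 2 * Y - c ^+ 2) / Y by field; rewrite gt_eqF.
by rewrite ler_pdivlMr// mul0r subr_ge0 exprMn.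
Qed.

Lemma orthonormal_norm w u : orthonormal ip w -> u \in w -> `|u| = 1.
Proof.
move=> /andP[/allP w1 _] /w1 /= /eqP; rewrite ip_norm => u1.
by apply/eqP; rewrite -(@pexpr_eq1 _ _ 2)// u1.
Qed.

Definition normalize x : H := `|x|^-1 *: x.

Lemma ip_normalize x : x != 0 -> ip (normalize x) (normalize x) = 1.
Proof.
move=> x0; rewrite /normalize ipZl ipZr ip_norm.
by field; rewrite normr_eq0.
Qed.

Lemma normalizeK x : x = `|x| *: normalize x.
Proof.
have [->|x0] := eqVneq x 0; first by rewrite normr0 scale0r.
by rewrite /normalize scalerA divff ?scale1r// normr_eq0.
Qed.

Definition proj_off w x : H := x - \sum_(i < size w) ip x w`_i *: w`_i.

Lemma proj_off_orth w x v : orthonormal ip w -> v \in w ->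
  ip (proj_off w x) v = 0.
Proof.
move=> /orthonormal_nthP ow /(nthP 0)[i si <-].
rewrite /proj_off ipDl ipNl ip_suml (bigD1 (Ordinal si))//= ipZl ow// eqxx.
rewrite mulr1 big1 ?addr0 ?subrr// => j ji; rewrite ipZl ow//.
by rewrite -val_eqE /= in ji; rewrite (negbTE ji) mulr0.
Qed.

(** Induction on s with w generalised: a vector whose residue [proj_off w x] vanishes is dropped,
    otherwise the normalised residue is appended to w. Keeping w as a prefix of the result matters
    for the Cameron-Martin formula, where the direction of translation has to be the first basis
    vector. *)
Lemma gram_schmidt s w : orthonormal ip w ->
  exists r, orthonormal ip (w ++ r) /\ span (w ++ r) = span (w ++ s).
Proof.
elim: s w => [|x s ih] w ow; first by exists [::]; rewrite cats0.
have memw (l : seq H) v : v \in w -> span (w ++ l) v.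
  by move=> vw; apply: span_mem; rewrite mem_cat vw.
have [p0|p0] := eqVneq (proj_off w x) 0.
  have [r [or rE]] := ih _ ow; exists r; split => //; rewrite rE.
  apply/seteqP; split; apply: span_subset => v; rewrite mem_cat.
    move=> /orP[/memw//|vs].
    by apply: span_mem; rewrite mem_cat inE vs !orbT.
  move=> /orP[/memw//|]; rewrite inE => /orP[/eqP ->|vs].
    move/eqP: p0; rewrite subr_eq0 => /eqP ->.
    apply: (@span_sum _ _ _ 'I_(size w) _ (fun i => w`_i)) => i.
    by apply: memw; rewrite mem_nth.
  by apply: span_mem; rewrite mem_cat vs orbT.
set e := normalize (proj_off w x).
have oe : orthonormal ip (rcons w e).
  have we v : v \in w -> ip e v = 0.
    by move=> vw; rewrite /e /normalize ipZl proj_off_orth// mulr0.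
  apply/orthonormal_nthP => i j; rewrite size_rcons !ltnS => iw jw.
  rewrite !nth_rcons; move: iw jw.
  rewrite leq_eqVlt => /orP[/eqP ->|iw]; rewrite leq_eqVlt => /orP[/eqP ->|jw].
  - by rewrite ltnn eqxx ip_normalize// eqxx.
  - by rewrite ltnn eqxx jw we ?mem_nth// gtn_eqF.
  - by rewrite ltnn eqxx iw ipC we ?mem_nth// ltn_eqF.
  - by rewrite iw jw (orthonormal_nthP ip w).1.
have [r [or rE]] := ih _ oe.
exists (e :: r); rewrite -cat_rcons; split => //; rewrite rE.
have spw l : span (w ++ l) (\sum_(i < size w) ip x w`_i *: w`_i).
  apply: (@span_sum _ _ _ 'I_(size w) _ (fun i => w`_i)) => i.
  by apply: memw; rewrite mem_nth.
apply/seteqP; split; apply: span_subset => v.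
  rewrite mem_cat mem_rcons inE -orbA => /or3P[/eqP ->|/memw//|vs].
  - rewrite /e /normalize -[_ *: _]addr0; apply: span_lin; last exact: span0.
    rewrite /proj_off addrC -scaleN1r; apply: span_lin => //.
    by apply: span_mem; rewrite mem_cat inE eqxx orbT.
  - by apply: span_mem; rewrite mem_cat inE vs !orbT.
rewrite mem_cat inE => /or3P[|/eqP ->|vs].
- by rewrite cat_rcons; exact: memw.
- have -> : x = `|proj_off w x| *: e + \sum_(i < size w) ip x w`_i *: w`_i.
    by rewrite /e -normalizeK /proj_off subrK.
  apply: span_lin; last by rewrite cat_rcons.
  by apply: span_mem; rewrite mem_cat mem_rcons inE eqxx.
- by apply: span_mem; rewrite mem_cat vs orbT.
Qed.

End hilbert_geometry.

Section complete_normed.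
Context {R : realType}.

Lemma cauchy_seq_cvgn {V : completeNormedModType R} (u : nat -> V) :
  (forall e : R, 0 < e -> exists n0, forall n k, (n0 <= n)%N -> (n0 <= k)%N ->
     `|u n - u k| < e) -> cvgn u.
Proof.
move=> h; apply/cauchy_cvgP/cauchy_ballP => e e0.
have [n0 hn0] := h _ e0.
exists (u @` [set n | (n0 <= n)%N], u @` [set n | (n0 <= n)%N]).
  by split; exists n0 => // n /= hn; exists n.
move=> [_ _] /= [[n hn <-] [k hk <-]]; rewrite -ball_normE /=; exact: hn0.
Qed.

Lemma closureP {V : normedModType R} (S : set V) x : closure S x <->
  (forall e : R, 0 < e -> exists2 y, S y & `|x - y| < e).
Proof.
split=> [h e e0|h A /nbhs_ballP[e /= e0 eA]].
  have [y [Sy]] := h _ (nbhsx_ballx x e e0).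
  by rewrite -ball_normE /= => xy; exists y.
by have [y Sy xy] := h _ e0; exists y; split => //; apply: eA; rewrite -ball_normE.
Qed.

Lemma denseP {V : normedModType R} (S : set V) : dense S <->
  (forall x (e : R), 0 < e -> exists2 y, S y & `|x - y| < e).
Proof.
split=> [h x e e0|h A [x Ax] oA].
  have [||y [xy Sy]] := h (ball x e).
  - by exists x; exact: ballxx.
  - exact: ball_open.
  - by exists y => //; move: xy; rewrite -ball_normE.
have /nbhs_ballP[e /= e0 eA] := open_nbhs_nbhs (conj oA Ax).
have [y Sy xy] := h x e e0.
by exists y; split => //; apply: eA; rewrite -ball_normE.
Qed.

End complete_normed.

(** * Elements of minimal norm, Riesz representation and density *)

Section riesz.
Context {R : realType} {H : completeNormedModType R} (ip : {dot H for idfun}).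
Hypothesis ip_norm : forall x, ip x x = `|x| ^+ 2.

(** By the parallelogram identity, and because midpoints stay in C, any minimizing sequence is
    Cauchy. C is not assumed closed, hence a minimizer in the closure. *)
Lemma min_norm (C : set H) : C !=set0 ->
  (forall x y, C x -> C y -> C (2^-1 *: (x + y))) ->
  exists2 a, closure C a & forall c, C c -> `|a| <= `|c|.
Proof.
move=> [c0 Cc0] midC.
pose N2 := [set `|c| ^+ 2 | c in C].
have hN2 : has_inf N2.
  split; first by exists (`|c0| ^+ 2), c0.
  by exists 0 => _ [c _ <-]; rewrite sqr_ge0.
have infN2 c : C c -> inf N2 <= `|c| ^+ 2.
  by move=> Cc; apply: ge_inf; [exact: hN2.2|exists c].
have ex n : exists c, C c /\ `|c| ^+ 2 < inf N2 + n.+1%:R^-1.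
  have /(inf_adherent)/(_ hN2)[_ [c Cc <-] hc] : 0 < n.+1%:R^-1 :> R.
    by rewrite invr_gt0.
  by exists c.
have [u hu] := choice ex.
have du n k : `|u n - u k| ^+ 2 <= 2 * (n.+1%:R^-1 + k.+1%:R^-1).
  have := infN2 _ (midC _ _ (hu n).1 (hu k).1).
  rewrite normrZ exprMn ger0_norm ?invr_ge0// (sqr_normD ip_norm (u n) (u k)).
  rewrite (sqr_normB ip_norm (u n)).
  have := (hu n).2; have := (hu k).2.
  set a := `|u n| ^+ 2; set b := `|u k| ^+ 2; set c := ip _ _.
  have -> : (2^-1 : R) ^+ 2 = 4^-1 by rewrite exprVn -natrX.
  set i := inf N2; set d1 := _^-1; set d2 := _^-1.
  move=> h1 h2 h3; lra.
have cu : cvgn u.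
  apply: cauchy_seq_cvgn => e e0.
  have e2 : 0 < 4 / e ^+ 2 by rewrite divr_gt0// exprn_gt0.
  pose n0 := Num.truncn (4 / e ^+ 2); exists n0 => n k hn hk.
  rewrite -(@ltr_pXn2r _ 2)// ?nnegrE ?(ltW e0)//.
  apply: le_lt_trans (du n k) _.
  have h m : (n0 <= m)%N -> m.+1%:R^-1 < e ^+ 2 / 4.
    move=> hm; rewrite -[ltRHS]invrK ltf_pV2 ?posrE ?invr_gt0 ?divr_gt0 ?exprn_gt0//.
    rewrite invf_div; apply: lt_le_trans (truncnS_gt _) _.
    by rewrite ler_nat ltnS.
  have := h _ hn; have := h _ hk; set a := n.+1%:R^-1; set b := k.+1%:R^-1.
  set q := e ^+ 2; lra.
have /cvg_ex[l ul] := cu; exists l.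
  apply/closureP => e e0.
  have /cvgrPdist_lt/(_ _ e0)[n0 _ hn0] := ul.
  by exists (u n0); [exact: (hu n0).1|exact: (hn0 n0 (leqnn _))].
move=> c Cc; rewrite -(@ler_pXn2r _ 2)// ?nnegrE//.
have cu2 : (fun n => `|u n| ^+ 2) @ \oo --> `|l| ^+ 2.
  by apply: cvgM; exact: cvg_norm.
apply: le_trans (infN2 _ Cc).
have ci : (fun n => inf N2 + n.+1%:R^-1) @ \oo --> inf N2 + 0.
  by apply: cvgD; [exact: cvg_cst|exact: cvg_harmonic].
rewrite -[leRHS]addr0.
by apply: (ler_cvg_to cu2 ci); apply: nearW => n; apply/ltW/(hu n).2.
Qed.

(** Adding the multiple of x with coefficient - ip a x / |x|^2 lowers the squared norm of a by (ip a
    x)^2 / |x|^2, which minimality forces to be 0. *)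
Lemma min_norm_orth (D : set H) (a : H) : (forall s x, D x -> D (s *: x)) ->
  (forall x, D x -> `|a| <= `|a + x|) -> forall x, D x -> ip a x = 0.
Proof.
move=> DZ ha x Dx; apply/eqP/negPn/negP => ax0.
have x0 : 0 < `|x| ^+ 2.
  rewrite exprn_gt0// normr_gt0; apply: contraNneq ax0 => ->.
  by rewrite ip0r.
have := ha _ (DZ (- (ip a x / `|x| ^+ 2)) _ Dx).
rewrite -(@ler_pXn2r _ 2)// ?nnegrE// (sqr_normD ip_norm) ipZr normrZ exprMn.
rewrite real_normK ?num_real// sqrrN.
set X := `|x| ^+ 2 in x0 *; set c := ip a x in ax0 *.
have -> : `|a| ^+ 2 + 2 * (- (c / X) * c) + (c / X) ^+ 2 * X
  = `|a| ^+ 2 - c ^+ 2 / X by field; rewrite gt_eqF.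
rewrite lerBrDr gerDl leNgt => /negP; apply.
by rewrite divr_gt0// exprn_even_gt0.
Qed.

(** The vector of least norm on the affine hyperplane g = 1 is orthogonal to the kernel of g, and
    every x differs from [g x *: a] by an element of that kernel. *)
Lemma riesz (g : H -> R) : scalar g -> (exists K, forall x, `|g x| <= K * `|x|) ->
  exists a, forall x, g x = ip a x.
Proof.
move=> gl [K gK].
have gD x y : g (x + y) = g x + g y by rewrite -[x]scale1r gl scale1r mul1r.
have g0 : g 0 = 0 by apply: (addrI (g 0)); rewrite -gD !addr0.
have gZ s x : g (s *: x) = s * g x by rewrite -[s *: x]addr0 gl g0 addr0.
have [gn0|] := pselect (exists x, g x != 0); last first.
  move=> /forallNP h; exists 0 => x; rewrite ip0l.
  by have /negP := h x; rewrite negbK => /eqP.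
case: gn0 => x0 gx0.
have [||a Ca ha] := @min_norm [set x | g x = 1].
- by exists ((g x0)^-1 *: x0) => /=; rewrite gZ mulVf.
- by move=> x y /= gx gy; rewrite gZ gD gx gy; field.
(* [min_norm] only places a in the closure of the hyperplane; boundedness of g puts it on the
   hyperplane. *)
have ga : g a = 1.
  apply/eqP; rewrite eq_sym -subr_eq0 -normr_le0; apply/ler_addgt0Pr => e e0.
  have K0 : 0 < `|K| + 1 by rewrite ltr_wpDl.
  have /closureP/(_ (e / (`|K| + 1)))[|y /= gy ay] := Ca.
    by rewrite divr_gt0.
  rewrite -gy -[- g a]mulN1r -gZ -gD scaleN1r add0r.
  apply: le_trans (gK _) _; rewrite distrC.
  move: ay; rewrite ltr_pdivlMr// => /ltW; apply: le_trans.
  by rewrite mulrC ler_wpM2l// (le_trans (ler_norm K))// lerDl.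
have ak x : g x = 0 -> ip a x = 0.
  apply: (@min_norm_orth [set x | g x = 0]) => [s y /= gy|y /= gy].
    by rewrite gZ gy mulr0.
  by apply: ha; rewrite /= gD ga gy addr0.
have aa : ip a a != 0.
  apply: contra_eqN ga => /eqP; rewrite ip_norm => /eqP.
  by rewrite expf_eq0/= normr_eq0 => /eqP ->; rewrite g0 eq_sym oner_eq0.
exists ((ip a a)^-1 *: a) => x.
have := ak (x - g x *: a); rewrite gD -scaleNr gZ ga mulr1 subrr => /(_ erefl).
rewrite scaleNr ipDr ipNr ipZr => /eqP; rewrite subr_eq0 => /eqP xE.
by rewrite ipZl xE; field.
Qed.

(** The vector of least norm in the closure of z + D is orthogonal to D, hence 0; so z is a limit of
    elements of D. As the minimizer need not lie in z + D itself, its minimality is tested through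
    points z + y close to it. *)
Lemma dense_of_trivial_orth (D : set H) :
  D 0 -> (forall s x y, D x -> D y -> D (s *: x + y)) ->
  (forall a, (forall x, D x -> ip a x = 0) -> a = 0) -> dense D.
Proof.
move=> D0 Dl Dorth; apply/denseP => z e e0.
have DD x y : D x -> D y -> D (x + y).
  by move=> Dx Dy; rewrite -[x]scale1r; exact: Dl.
have DZ s x : D x -> D (s *: x).
  by move=> Dx; rewrite -[_ *: _]addr0; exact: Dl.
pose C := [set z + d | d in D].
have [||a Ca ha] := @min_norm C.
- by exists (z + 0), 0.
- move=> _ _ [x Dx <-] [y Dy <-]; exists (2^-1 *: (x + y)); first exact/DZ/DD.
  rewrite (addrACA z) [RHS]scalerDr; congr (_ + _).
  by rewrite -mulr2n -[z *+ 2]scaler_nat scalerA mulVf ?scale1r.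
suff a0 : a = 0.
  have /closureP/(_ _ e0)[_ [d Dd <-]] := Ca.
  rewrite a0 sub0r normrN => zd; exists (- d).
    by rewrite -scaleN1r; exact: DZ.
  by rewrite opprK.
apply: Dorth; apply: min_norm_orth => // x Dx.
apply/ler_addgt0Pr => d d0.
have /closureP/(_ _ d0)[_ [y Dy <-] ay] := Ca.
apply: (le_trans (ha (z + y + x) _)); first by exists (y + x); [exact: DD|rewrite addrA].
rewrite -(subrK (a + x) (z + y + x)) addrC.
apply: le_trans (ler_normD _ _) _; rewrite lerD2l.
by rewrite opprD addrACA subrr addr0 distrC ltW.
Qed.

(** Approximating each vector separately would destroy orthonormality, so Gram-Schmidt is redone
    inside D: approximate the tail first, then take c in D close to u, remove its components along
    the approximate tail and normalise. These components are small because u is orthogonal to w. *)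
Lemma orthonormal_approx (D : set H) : dense D ->
  (forall s x y, D x -> D y -> D (s *: x + y)) ->
  forall (w : seq H) (e : R), orthonormal ip w -> 0 < e ->
  exists b : seq H, [/\ size b = size w, orthonormal ip b,
    (forall x, x \in b -> D x) &
    forall i, (i < size w)%N -> `|b`_i - w`_i| < e].
Proof.
move=> /denseP Dd Dl; have D0 : D 0.
  have [y Dy _] := Dd 0 _ ltr01; rewrite -(addNr y) -scaleN1r; exact: Dl.
elim=> [|u w ih] e; first by move=> _ _; exists [::].
move=> ouw e0; have [u1 uw ow] := (orthonormal_cons _ _ _).1 ouw.
have nu : `|u| = 1 by exact: (orthonormal_norm ip_norm ouw (mem_head _ _)).
pose k : R := (size w)%:R + 1.
have k0 : 0 < k by rewrite ltr_wpDl.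
(* Removing at most 2 d along each of the [size w] vectors gives |p - u| <= d + 2 d (size w) <= 4 k
   d. The bound 1/2 makes p nonzero; the bound e / 3 leaves room for normalisation, which moves p by
   at most |p - u| again. *)
pose d := Num.min (2^-1) (e / 3) / (4 * k).
have me : 0 < Num.min (2^-1) (e / 3) by rewrite lt_min divr_gt0// invr_gt0 ltr0n.
have d0 : 0 < d by rewrite divr_gt0// mulr_gt0.
have [b [sb ob Db bw]] := ih (Num.min e d) ow ltac:(by rewrite lt_min e0 d0).
have [c Dc uc] := Dd u _ d0.
have nb i : (i < size w)%N -> `|b`_i| = 1.
  by rewrite -sb => si; apply: (orthonormal_norm ip_norm ob); rewrite mem_nth.
have cb i : (i < size w)%N -> `|ip c b`_i| <= 2 * d.
  move=> si; have -> : ip c b`_i = ip (c - u) b`_i + ip u (b`_i - w`_i).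
    by rewrite ipDl ipNl ipDr ipNr (uw w`_i) ?mem_nth// subr0 subrK.
  apply: le_trans (ler_normD _ _) _; rewrite mulrDl mul1r lerD//.
    apply: le_trans (cauchy_schwarz ip_norm _ _) _.
    by rewrite nb// mulr1 distrC ltW.
  apply: le_trans (cauchy_schwarz ip_norm _ _) _.
  rewrite nu mul1r ltW//; have := bw _ si.
  by rewrite lt_min => /andP[].
pose p := proj_off ip b c.
have Dp : D p.
  rewrite /p /proj_off addrC -scaleN1r; apply: (Dl _ _ _) => //.
  apply: (big_ind D) => // [x y Dx Dy|i _].
    by rewrite -[x]scale1r; exact: Dl.
  rewrite -[_ *: _]addr0; apply: (Dl _ _ _) => //.
  by apply: Db; rewrite mem_nth.
have pu : `|p - u| <= Num.min (2^-1) (e / 3).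
  have -> : p - u = (c - u) - \sum_(i < size b) ip c b`_i *: b`_i.
    by rewrite /p /proj_off addrAC.
  apply: le_trans (ler_normB _ _) _.
  have : `|c - u| <= d by rewrite distrC ltW.
  have : `|\sum_(i < size b) ip c b`_i *: b`_i| <= (size w)%:R * (2 * d).
    apply: le_trans (ler_norm_sum _ _ _) _.
    rewrite sb; apply: le_trans (_ : \sum_(i < size w) (2 * d) <= _).
      by apply: ler_sum => i _; rewrite normrZ nb// mulr1 cb.
    by rewrite sumr_const card_ord -[(2 * d) *+ size w]mulr_natl.
  have -> : Num.min (2^-1) (e / 3) = ((size w)%:R + 1) * d * 4.
    by rewrite /d -/k; field; rewrite gt_eqF.
  have : 0 <= (size w)%:R * d by rewrite mulr_ge0// ltW.
  move: (size w)%:R => s; nra.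
move: pu; rewrite le_min => /andP[pu2 pue].
have np : `|(`|p| - 1)| <= `|p - u| by rewrite -nu; exact: ler_dist_dist.
have p0 : p != 0.
  apply: contraTneq pu2 => ->; rewrite sub0r normrN nu -ltNge.
  by rewrite invf_lt1// ltr1n.
exists (normalize p :: b); split => //=.
- by rewrite sb.
- apply/orthonormal_cons; split => //.
  + exact: ip_normalize.
  + by move=> v vb; rewrite /normalize ipZl proj_off_orth// mulr0.
- move=> x; rewrite inE => /orP[/eqP ->|]; last exact: Db.
  by rewrite /normalize -[_ *: _]addr0; exact: Dl.
- move=> [_|i] /=; last by rewrite ltnS => /bw; rewrite lt_min => /andP[].
  have -> : normalize p - u = (normalize p - p) + (p - u) by rewrite addrA subrK.
  apply: le_lt_trans (ler_normD _ _) _.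
  have -> : `|normalize p - p| = `|(`|p| - 1)|.
    rewrite {2}(normalizeK p) -[X in X - _]scale1r -scalerBl normrZ.
    by rewrite /normalize normrZ normfV normr_id mulVf ?normr_eq0// mulr1 distrC.
  have : `|p - u| < e / 2 by apply: le_lt_trans pue _; rewrite ltr_pM2l// ltf_pV2 ?posrE ?ltr_nat.
  move: np; set x1 := `|_ - 1|; set x2 := `|p - u|; lra.
Qed.

End riesz.

(** * Hahn-Banach theorem *)

Section hahn_banach.
Context {R : realType} {V : lmodType R}.
Implicit Types (p q : V -> R) (x y z : V).

Definition sublinear p :=
  (forall x y, p (x + y) <= p x + p y) /\
  (forall (s : R) x, 0 <= s -> p (s *: x) = s * p x).

Lemma sublinear0 p : sublinear p -> p 0 = 0.
Proof. by move=> [_ pZ]; rewrite -(scale0r 0) pZ// mul0r. Qed.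

Lemma sublinearN p x : sublinear p -> - p (- x) <= p x.
Proof.
move=> psub; have := psub.1 x (- x); rewrite subrr (sublinear0 psub).
by rewrite -lerBlDr sub0r.
Qed.

(** For p sublinear, this is the greatest sublinear functional below p whose value at - z is at most
    - p z. *)
Definition sublinear_shift p z x : R :=
  inf [set p (x + s *: z) - s * p z | s in [set s : R | 0 <= s]].

Section shift.
Variables (p : V -> R) (z : V) (psub : sublinear p).

Let S x := [set p (x + s *: z) - s * p z | s in [set s : R | 0 <= s]].

Let S_lb x : lbound (S x) (- p (- x)).
Proof.
move=> _ [s /= s0 <-]; rewrite -psub.2// lerBrDr addrC lerBlDr.
by have := psub.1 (x + s *: z) (- x); rewrite addrAC subrr add0r.
Qed.

Let S_has_inf x : has_inf (S x).
Proof.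
split; last by exists (- p (- x)); exact: S_lb.
by exists (p (x + 0 *: z) - 0 * p z), 0 => /=.
Qed.

Lemma sublinear_shift_le x s : 0 <= s ->
  sublinear_shift p z x <= p (x + s *: z) - s * p z.
Proof. by move=> s0; apply: ge_inf; [exact: (S_has_inf x).2|exists s]. Qed.

Lemma sublinear_shift_le_id x : sublinear_shift p z x <= p x.
Proof.
by have := sublinear_shift_le x (lexx 0); rewrite scale0r mul0r addr0 subr0.
Qed.

Lemma sublinear_shift_opp : sublinear_shift p z (- z) <= - p z.
Proof.
have := sublinear_shift_le (- z) ler01.
by rewrite scale1r mul1r addNr (sublinear0 psub) sub0r.
Qed.

Lemma sublinear_shiftP : sublinear (sublinear_shift p z).
Proof.
split=> [x y|a x].
  apply/ler_addgt0Pr => e e0; have e2 : 0 < e / 2 by rewrite divr_gt0.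
  have [_ [s /= s0 <-] hs] := inf_adherent e2 (S_has_inf x).
  have [_ [r /= r0 <-] hr] := inf_adherent e2 (S_has_inf y).
  have := sublinear_shift_le (x + y) (addr_ge0 s0 r0).
  rewrite scalerDl addrACA.
  have := psub.1 (x + s *: z) (y + r *: z).
  move: hs hr; rewrite -/(sublinear_shift p z x) -/(sublinear_shift p z y).
  by move=> *; lra.
rewrite le_eqVlt => /orP[/eqP <-|a0].
  rewrite scale0r mul0r; apply/eqP; rewrite eq_le; apply/andP; split.
    by rewrite -(sublinear0 psub) sublinear_shift_le_id.
  apply: lb_le_inf; first exact: (S_has_inf 0).1.
  by move=> r /S_lb; rewrite oppr0 (sublinear0 psub) oppr0.
apply/eqP; rewrite eq_le; apply/andP; split.
  rewrite mulrC -ler_pdivrMr//; apply: lb_le_inf; first exact: (S_has_inf x).1.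
  move=> _ [s /= s0 <-]; rewrite ler_pdivrMr//.
  have := @sublinear_shift_le (a *: x) (a * s) (mulr_ge0 (ltW a0) s0).
  rewrite -scalerA -scalerDr psub.2 ?(ltW a0)//; move/le_trans; apply.
  by rewrite le_eqVlt; apply/orP; left; apply/eqP; ring.
apply: lb_le_inf; first exact: (S_has_inf _).1.
move=> _ [s /= s0 <-].
have := @sublinear_shift_le x (s / a) (divr_ge0 s0 (ltW a0)).
rewrite -(ler_pM2l a0) mulrBr -(psub.2 a) ?(ltW a0)// scalerDr scalerA.
have sE : a * (s / a) = s by field; rewrite gt_eqF.
by rewrite sE (mulrA a) sE.
Qed.

End shift.

(** Zorn's lemma for the reversed pointwise order. Every q below p satisfies q x >= - q (- x) >= - p
    (- x), so the infimum of a chain is finite at each point. *)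
Lemma minimal_sublinear p : sublinear p ->
  exists q, [/\ sublinear q, (forall x, q x <= p x) &
    forall r, sublinear r -> (forall x, r x <= q x) -> r = q].
Proof.
move=> psub.
pose T := {q : V -> R | sublinear q /\ forall x, q x <= p x}.
pose le (q r : T) := `[< forall x, sval r x <= sval q x >].
have [| | | |[q [qsub qp]] qmin] := @Zorn T le.
- by move=> q; apply/asboolP.
- move=> a b c /asboolP ab /asboolP bc; apply/asboolP => x.
  exact: le_trans (bc x) (ab x).
- move=> [a ha] [b hb] /asboolP/= ab /asboolP/= ba; apply: eq_exist.
  by apply/funext => x; apply/eqP; rewrite eq_le ab ba.
- move=> A Atot; have [[a0 Aa0]|A0] := pselect (A !=set0); last first.
    exists (exist _ p (conj psub (fun=> lexx _))) => s As.
    by exfalso; apply: A0; exists s.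
  pose S x := [set sval q x | q in A].
  have hS x : has_inf (S x).
    split; first by exists (sval a0 x), a0.
    exists (- p (- x)) => _ [q _ <-].
    apply: le_trans (sublinearN x (proj2_sig q).1).
    by rewrite lerN2 (proj2_sig q).2.
  have iS x (q : T) : A q -> inf (S x) <= sval q x.
    by move=> Aq; apply: ge_inf; [exact: (hS x).2|exists q].
  have isub : sublinear (fun x => inf (S x)).
    split=> [x y|s x s0].
      apply/ler_addgt0Pr => e e0; have e2 : 0 < e / 2 by rewrite divr_gt0.
      have [_ [a Aa <-] ha] := inf_adherent e2 (hS x).
      have [_ [b Ab <-] hb] := inf_adherent e2 (hS y).
      (* The near-minimizers at x and at y are comparable, and the smaller one serves at both
         points; this is where the chain condition gives subadditivity of the infimum. *)
      have [c Ac [ca cb]] : exists2 c, A c & sval c x <= sval a x /\ sval c y <= sval b y.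
        by have [/asboolP h|/asboolP h] := Atot _ _ Aa Ab; [exists b|exists a].
      have := (proj2_sig c).1.1 x y; have := iS (x + y) _ Ac.
      by move=> *; lra.
    have [->|s1] := eqVneq s 0.
      rewrite scale0r mul0r; apply/eqP; rewrite eq_le; apply/andP; split.
        by rewrite (le_trans (iS 0 _ Aa0))// (sublinear0 (proj2_sig a0).1).
      apply: lb_le_inf; first exact: (hS 0).1.
      by move=> _ [q _ <-]; rewrite (sublinear0 (proj2_sig q).1).
    have {s1}s0 : 0 < s by rewrite lt_def s1.
    apply/eqP; rewrite eq_le; apply/andP; split.
      rewrite mulrC -ler_pdivrMr//; apply: lb_le_inf; first exact: (hS x).1.
      move=> _ [q Aq <-]; rewrite ler_pdivrMr// mulrC -(proj2_sig q).1.2 ?(ltW s0)//.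
      exact: iS.
    apply: lb_le_inf; first exact: (hS _).1.
    move=> _ [q Aq <-]; rewrite (proj2_sig q).1.2 ?(ltW s0)// ler_pM2l//.
    exact: iS.
  have ip x : inf (S x) <= p x by rewrite (le_trans (iS x _ Aa0))// (proj2_sig a0).2.
  by exists (exist _ (fun x => inf (S x)) (conj isub ip) : T) => s As; apply/asboolP => x /=; exact: iS.
exists q; split => // r rsub rq.
have rp x : r x <= p x by exact: le_trans (rq x) (qp x).
have := qmin (exist _ r (conj rsub rp)) ltac:(by apply/asboolP).
by move=> /(congr1 sval).
Qed.

(* A minimal sublinear functional q is linear: q coincides with each of its
   shifts, so that q (- x) <= - q x. *)
Lemma hahn_banach p z : sublinear p ->
  exists g : V -> R, [/\ scalar g, (forall x, g x <= p x) & g z = p z].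
Proof.
move=> psub.
(* Starting below the shift of p at z, rather than below p, forces q (- z) <= - p z, hence q z = p z
   once q is odd. *)
have [q [qsub qp qmin]] := minimal_sublinear (sublinear_shiftP z psub).
have qN x : q (- x) = - q x.
  apply/eqP; rewrite eq_le; apply/andP; split; last first.
    by have := sublinearN (- x) qsub; rewrite opprK.
  have <- := qmin _ (sublinear_shiftP x qsub) (sublinear_shift_le_id x qsub).
  apply: le_trans (sublinear_shift_opp x qsub) _.
  by rewrite lerN2 sublinear_shift_le_id.
have qD x y : q (x + y) = q x + q y.
  apply/eqP; rewrite eq_le qsub.1 /=.
  by have := qsub.1 (x + y) (- y); rewrite addrK qN lerBrDr.
have qZ s x : q (s *: x) = s * q x.
  have [s0|s0] := leP 0 s; first exact: qsub.2.
  by apply: oppr_inj; rewrite -qN -scaleNr qsub.2 ?mulNr// oppr_ge0 ltW.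
exists q; split.
- by move=> s x y; rewrite qD qZ.
- by move=> x; rewrite (le_trans (qp x))// sublinear_shift_le_id.
- apply/eqP; rewrite eq_le (le_trans (qp z))/= ?sublinear_shift_le_id//.
  rewrite -lerN2 -qN; apply: le_trans (qp _) _; exact: sublinear_shift_opp.
Qed.

End hahn_banach.

(** * Gaussian integrals *)

Section density.
Context d (T : measurableType d) (R : realType).
Variables (m1 m2 : {measure set T -> \bar R}) (rho : T -> R).
Hypotheses (mrho : measurable_fun setT rho) (rho0 : forall x, 0 <= rho x).
Hypothesis m12 : forall A, measurable A ->
  m1 A = (\int[m2]_(x in A) (rho x)%:E)%E.

Import HBNNSimple.
Local Open Scope ereal_scope.

Let mErho : measurable_fun setT (EFin \o rho).
Proof. exact/measurable_EFinP. Qed.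

Lemma ge0_integral_density_nnsfun (g : {nnsfun T >-> R}) :
  \int[m1]_x (g x)%:E = \int[m2]_x ((g x)%:E * (rho x)%:E).
Proof.
rewrite integralT_nnsfun sintegralE.
have gE x : (g x)%:E * (rho x)%:E =
    \sum_(y \in range g) (y * \1_(g @^-1` [set y]) x)%:E * (rho x)%:E.
  rewrite -ge0_mule_fsuml; last by move=> y; exact: nnfun_muleindic_ge0.
  by rewrite fsumEFin// -fimfunE.
under [RHS]eq_integral do rewrite gE.
rewrite ge0_integral_fsum//; last 2 first.
- move=> y; apply: emeasurable_funM => //; apply/measurable_EFinP.
  exact: measurable_funM.
- by move=> y x _; apply: mule_ge0; [exact: nnfun_muleindic_ge0|rewrite lee_fin].
apply: eq_fsbigr => y /[!inE] -[t _ <-].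
under eq_integral do rewrite EFinM -muleA.
rewrite ge0_integralZl//; last 3 first.
- by apply: emeasurable_funM => //; apply/measurable_EFinP.
- by move=> x _; rewrite mule_ge0 ?lee_fin.
- by rewrite lee_fin.
congr (_ * _); rewrite m12// integral_mkcond.
by apply: eq_integral => x _; rewrite muleC epatch_indic.
Qed.

(** Monotone limit of the case of simple functions. The density relation is assumed set by set
    because [gaussian] is a bare set function, not a measure. *)
Lemma ge0_integral_density (f : T -> \bar R) : measurable_fun setT f ->
  (forall x, 0 <= f x) -> \int[m1]_x f x = \int[m2]_x (f x * (rho x)%:E).
Proof.
move=> mf f0; pose g := nnsfun_approx measurableT mf.
have gf x : (g n x)%:E @[n --> \oo] --> f x.
  exact: (cvg_nnsfun_approx measurableT mf).
have nd x : {homo (fun n => g n x) : m n / (m <= n)%N >-> (m <= n)%R}.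
  by move=> m n mn; exact/lefP/nd_nnsfun_approx.
transitivity (limn (fun n => \int[m1]_x (g n x)%:E)).
  rewrite -monotone_convergence//.
  - by apply: eq_integral => x _; apply/esym/cvg_lim => //; exact: gf.
  - by move=> n; exact/measurable_EFinP.
  - by move=> n x _; rewrite lee_fin.
  - by move=> x _ m n mn; rewrite lee_fin nd.
under eq_fun do rewrite ge0_integral_density_nnsfun.
rewrite -monotone_convergence//.
- apply: eq_integral => x _; apply/cvg_lim => //.
  by apply: cvgeZr => //; exact: gf.
- by move=> n; apply: emeasurable_funM => //; exact/measurable_EFinP.
- by move=> n x _; rewrite mule_ge0 ?lee_fin.
- by move=> x _ m n mn; rewrite lee_wpmul2r ?lee_fin ?nd.
Qed.

End density.

Section gaussian_shift.
Context {R : realType}.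
Let RB := measurableTypeR R.

Lemma measurable_addr (s : R) : measurable_fun [set: RB] (fun x : RB => x + s : RB).
Proof. by apply: measurable_funD. Qed.

Lemma lebesgue_measure_addr (s : R) (A : set RB) : measurable A ->
  lebesgue_measure ((fun x : RB => x + s : RB) @^-1` A) = lebesgue_measure A.
Proof.
move=> mA.
pose m := measure_function_pushforward__canonical__measure_function_Measure
  (@lebesgue_measure R) (measurable_addr s).
apply/esym/(@lebesgue_measure_unique _ m) => // _ [[a b] /= _ <-].
rewrite lebesgue_measure_itv/= /pushforward.
have -> : (fun x : RB => x + s : RB) @^-1` `]a, b] = `]a - s, b - s]%classic.
  by apply/seteqP; split => x /=; rewrite !in_itv/= ltrBlDr lerBrDr.
rewrite lebesgue_measure_itv/= !lte_fin ltrD2r.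
by case: ifPn => // _; rewrite -!EFinD; congr EFin; ring.
Qed.

(** In coordinates along an orthonormal family that begins with u, this is the translation by s
    u. *)
Definition shift_head n (s : R) (v : n.+1.-tuple RB) : n.+1.-tuple RB :=
  [tuple of (thead v + s : RB) :: behead v].

Lemma tnth_shift_head n s (v : n.+1.-tuple RB) i :
  tnth (shift_head s v) i = tnth v i + (if i == ord0 then s else 0).
Proof.
case: (unliftP ord0 i) => [j ->|->].
  rewrite tnthS (_ : lift ord0 j == ord0 = false) ?addr0; last exact/negbTE.
  by rewrite (tuple_eta v) tnthS; congr tnth; exact/val_inj.
by rewrite eqxx.
Qed.

Lemma measurable_shift_head n (s : R) : measurable_fun setT (@shift_head n s).
Proof.
apply/measurable_fun_tnthP => i.
rewrite (_ : _ \o _ = fun v : n.+1.-tuple RB =>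
  tnth v i + (if i == ord0 then s else 0) : RB); last first.
  by apply/funext => v /=; rewrite tnth_shift_head.
by apply: measurable_funD => //; exact: measurable_tnth.
Qed.

(** [cons_pair] puts the second component of the pair at the head, so the head is the variable of
    the sections in [product_measure1], and invariance of Lebesgue measure on the line applies to
    each section. *)
Lemma lebesgue_tuple_shift_head n (s : R) (A : set (n.+1.-tuple RB)) :
  measurable A ->
  lebesgue_tuple n.+1 (@shift_head n s @^-1` A) = lebesgue_tuple n.+1 A.
Proof.
move=> mA /=; rewrite /pushforward /product_measure1.
apply: eq_integral => x _ /=.
rewrite -[RHS](@lebesgue_measure_addr s).
  have E p : shift_head s (cons_pair p) = cons_pair (p.1, p.2 + s : RB).
    exact/val_inj.
  by congr (lebesgue_measure _); apply/seteqP; split => r;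
    rewrite /xsection /= !inE /= E.
apply: (@measurable_xsection _ _ _ _ (@cons_pair R n @^-1` A)).
rewrite -[_ @^-1` _]setTI; exact: measurable_cons_pair.
Qed.

Lemma measurable_gaussian_density n (h : R) :
  measurable_fun setT (@gaussian_density R n h).
Proof.
apply: measurable_funM => //; apply: measurableT_comp => //.
apply: measurable_funM => //; apply: measurableT_comp => //.
apply: measurable_sum => i; apply: measurable_funX; exact: measurable_tnth.
Qed.

Lemma gaussian_density_ge0 n (h : R) v : 0 <= @gaussian_density R n h v.
Proof. by rewrite mulr_ge0 ?powR_ge0 ?expR_ge0. Qed.

Lemma gaussian_density_shift_head n (h s : R) v : 0 < h ->
  @gaussian_density R n.+1 h (shift_head (- s) v) =
  expR (s * thead v / h - s ^+ 2 / (2 * h)) * gaussian_density h v.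
Proof.
move=> h0; rewrite /gaussian_density mulrCA; congr (_ * _); rewrite -expRD.
congr expR; rewrite !big_ord_recl tnth_shift_head eqxx.
under eq_bigr do rewrite tnth_shift_head eq_sym (negbTE (neq_lift _ _)) ?addr0.
by rewrite /thead; field; rewrite gt_eqF.
Qed.

Lemma ge0_integral_gaussian_shift n (h s : R)
    (nu : {measure set (n.+1.-tuple RB) -> \bar R})
    (Phi : n.+1.-tuple RB -> \bar R) :
  0 < h -> (forall A, measurable A -> nu A = gaussian h A) ->
  measurable_fun setT Phi -> (forall v, 0 <= Phi v)%E ->
  (\int[nu]_v Phi (shift_head s v) =
   \int[nu]_v (Phi v * (expR (s * thead v / h - s ^+ 2 / (2 * h)))%:E))%E.
Proof.
move=> h0 nuE mPhi Phi0; pose L := lebesgue_tuple (R := R) n.+1.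
pose rho := @gaussian_density R n.+1 h.
have mrho : measurable_fun setT rho by exact: measurable_gaussian_density.
have rho0 v : 0 <= rho v by exact: gaussian_density_ge0.
have nuL := ge0_integral_density (m1 := nu) (m2 := L) mrho rho0 nuE.
have mD : measurable_fun setT
    (fun v : n.+1.-tuple RB => expR (s * thead v / h - s ^+ 2 / (2 * h))).
  apply: measurableT_comp => //; apply: measurable_funB => //.
  apply: measurable_funM => //; apply: measurable_funM => //.
  exact: measurable_tnth.
rewrite nuL//; last by apply: measurableT_comp => //; exact: measurable_shift_head.
rewrite nuL//; last 2 first.
- by apply: emeasurable_funM => //; exact/measurable_EFinP.
- by move=> v; rewrite mule_ge0// lee_fin expR_ge0.
(* The density is evaluated at the point shifted back, so that the integrand becomes
   [G (shift_head s v)] and invariance of L removes the shift. *)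
pose G v := (Phi v * (rho (shift_head (- s) v))%:E)%E.
have mG : measurable_fun setT G.
  apply: emeasurable_funM => //; apply/measurable_EFinP.
  by apply: measurableT_comp => //; exact: measurable_shift_head.
have G0 v : (0 <= G v)%E by rewrite mule_ge0// lee_fin.
transitivity (\int[L]_v G (shift_head s v))%E.
  apply: eq_integral => v _; rewrite /G; congr (_ * (rho _)%:E)%E.
  by apply: eq_from_tnth => i; rewrite !tnth_shift_head; case: eqP => _; rewrite ?addrK ?addr0.
have := @ge0_integral_pushforward _ _ _ _ _ _ (measurable_shift_head s) L setT G
  measurableT mG (fun v _ => G0 v).
rewrite preimage_setT => <-.
transitivity (\int[L]_v G v)%E.
  apply: eq_measure_integral => [|mf A mA _].
    exact: measurable_shift_head.
  exact: (lebesgue_tuple_shift_head s mA).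
by apply: eq_integral => v _; rewrite /G /rho gaussian_density_shift_head// EFinM muleA.
Qed.

End gaussian_shift.

(** * The embedding of H into B and the dual of B *)

Section measurable_norm_bound.
Context {R : realType} {H : completeNormedModType R} (ip : {dot H for idfun}).
Hypothesis ip_norm : forall x, ip x x = `|x| ^+ 2.
Let RB := measurableTypeR R.

Lemma gaussian1_gt1_ge : exists2 d : R, 0 < d & forall A : set (1.-tuple RB),
  measurable A -> (forall v : 1.-tuple RB, 1 < tnth v ord0 -> A v) ->
  (d%:E <= gaussian 1 A)%E.
Proof.
pose c : R := (2 * pi * 1) `^ (- (1%:R / 2)).
have c0 : 0 < c by rewrite powR_gt0// mulr1 mulr_gt0// pi_gt0.
(* On the interval from 1 to 2, of length one, the density is at least c exp(- 2). *)
exists (c * expR (- 2)); first by rewrite mulr_gt0// expR_gt0.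
move=> A mA hA.
pose J := [set v : 1.-tuple RB | `]1, 2[%classic (tnth v ord0)].
have mJ : measurable J.
  rewrite -[J]setTI; apply: (@measurable_tnth _ RB 1 ord0 _ `]1, 2[%classic) => //.
have JA : J `<=` A by move=> v; rewrite /J/= in_itv/= => /andP[/hA].
have LJ : lebesgue_tuple 1 J = 1%E :> \bar R.
  rewrite /= /pushforward.
  have -> : @cons_pair R 0 @^-1` J = setT `*` (`]1, 2[%classic : set RB).
    by apply/seteqP; split => -[x r] //= [].
  rewrite product_measure1E//= lebesgue_measure_itv/= lte_fin ltr1n.
  by rewrite diracT mul1e -EFinD; congr EFin; lra.
have mg := @measurable_gaussian_density R 1 1.
apply: (@le_trans _ _ (\int[lebesgue_tuple 1]_(v in J) (gaussian_density 1 v)%:E)%E).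
  rewrite -[leLHS]mule1 -LJ -integral_cst//.
  apply: ge0_le_integral => //.
  - by move=> v _; rewrite lee_fin mulr_ge0 ?expR_ge0 ?ltW.
  - exact/measurable_EFinP/measurable_funTS.
  - move=> v; rewrite /J/= in_itv/= => /andP[v1 v2].
    rewrite lee_fin /gaussian_density -/c ler_wpM2l ?(ltW c0)// ler_expR.
    rewrite big_ord_recl big_ord0 addr0 mulNr lerN2 mulr1 ler_pdivrMr//.
    move: v1 v2; set x := tnth _ _; nra.
apply: ge0_subset_integral => //.
  exact/measurable_EFinP/measurable_funTS.
by move=> v _; rewrite lee_fin gaussian_density_ge0.
Qed.

(* A unit vector u orthogonal to w0 with N u > 1 would give {|v| N u > min 1 d}
   a Gaussian measure at least d, against the choice of w0. *)
Lemma measurable_norm_bound (N : H -> R) : measurable_norm ip N ->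
  exists K, forall x, N x <= K * `|x|.
Proof.
move=> [ND NZ N0 Ng].
have N00 : N 0 = 0 by rewrite -(scale0r 0) NZ normr0 mul0r.
have Nge0 x : 0 <= N x.
  have := ND x (- x); rewrite subrr N00 -scaleN1r NZ normrN normr1 mul1r.
  by rewrite -mulr2n pmulrn_lge0.
have Nsum (I : Type) (r : seq I) (F : I -> H) :
    N (\sum_(i <- r) F i) <= \sum_(i <- r) N (F i).
  elim: r => [|i r ih]; first by rewrite !big_nil N00.
  by rewrite !big_cons (le_trans (ND _ _))// lerD2l.
have [d d0 hd] := gaussian1_gt1_ge.
have e0 : 0 < Num.min 1 d by rewrite lt_min ltr01.
have [w0 [ow0 hw0]] := Ng _ e0.
have N1 u : ip u u = 1 -> (forall v, v \in w0 -> ip v u = 0) -> N u <= 1.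
  move=> uu w0u; rewrite leNgt; apply/negP => Nu.
  have ou : orthonormal ip [:: u] by rewrite /orthonormal/= uu eqxx.
  have o0u : orthogonal ip w0 [:: u].
    by apply/allP => v vw /=; rewrite andbT; exact/eqP/w0u.
  have := hw0 _ ou o0u; rewrite ltNge => /negP; apply.
  apply: le_trans (_ : d%:E <= _)%E; first by rewrite lee_fin ge_min lexx orbT.
  have E v : N (\sum_(i < 1) tnth v i *: [:: u]`_i) = `|tnth v ord0| * N u.
    by rewrite big_ord_recl big_ord0 addr0 NZ.
  have mf : measurable_fun setT (fun v : 1.-tuple RB => `|tnth v ord0| * N u).
    apply: measurable_funM => //; apply: measurableT_comp => //.
    exact: measurable_tnth.
  apply: hd => /=.
    have := mf measurableT _ (measurable_itv `]Num.min 1 d, +oo[).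
    rewrite setTI; congr measurable; apply/seteqP.
    by split=> v /=; rewrite in_itv/= andbT E.
  move=> v v1; rewrite /= E; apply: (@le_lt_trans _ _ 1).
    by rewrite ge_min lexx.
  apply: (@lt_le_trans _ _ `|tnth v ord0|).
    exact: lt_le_trans v1 (ler_norm _).
  by rewrite ler_peMr// ltW.
pose S := \sum_(i < size w0) N w0`_i.
have ge0S : 0 <= S by rewrite sumr_ge0.
have nw i : (i < size w0)%N -> `|w0`_i| = 1.
  by move=> iw; apply: (orthonormal_norm ip_norm ow0); rewrite mem_nth.
(* S accounts for the component of x along w0. On the orthogonal component N is at most the norm,
   which the triangle inequality bounds by (1 + size w0) |x|. *)
exists (S + (1 + (size w0)%:R)) => x.
have -> : x = \sum_(i < size w0) ip x w0`_i *: w0`_i + proj_off ip w0 x.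
  by rewrite /proj_off addrC subrK.
set x' := _ + proj_off _ _ _.
have x'E : x' = x by rewrite /x' /proj_off addrC subrK.
rewrite x'E; apply: le_trans (_ : N x' <= _); first by rewrite x'E.
apply: le_trans (ND _ _) _; rewrite mulrDl lerD//.
  apply: le_trans (Nsum _ _ _) _; rewrite /S mulr_suml ler_sum// => i _.
  rewrite NZ mulrC ler_wpM2l//.
  by rewrite (le_trans (cauchy_schwarz ip_norm _ _))// nw// mulr1.
have [->|p0] := eqVneq (proj_off ip w0 x) 0.
  by rewrite N00 mulr_ge0// addr_ge0.
rewrite (normalizeK (proj_off ip w0 x)) NZ normr_id.
apply: (@le_trans _ _ (`|proj_off ip w0 x| * 1)).
  rewrite ler_wpM2l// N1 ?(ip_normalize ip_norm)// => v vw.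
  by rewrite /normalize ipZr ipC proj_off_orth// mulr0.
rewrite mulr1 mulrDl mul1r; apply: le_trans (ler_normB _ _) _; rewrite lerD2l.
apply: le_trans (ler_norm_sum _ _ _) _.
apply: le_trans (_ : \sum_(i < size w0) `|x| <= _).
  apply: ler_sum => i _; rewrite normrZ nw// mulr1.
  by rewrite (le_trans (cauchy_schwarz ip_norm _ _))// nw// mulr1.
by rewrite sumr_const card_ord -[`|x| *+ _]mulr_natl.
Qed.

End measurable_norm_bound.

(** * Measurability for the Borel sigma-algebra of a separable space *)

Section borel.
Context {R : realType}.

Lemma separable_dense_seq {V : completeNormedModType R} : separable V ->
  exists s : nat -> V, forall x (e : R), 0 < e -> exists n, `|x - s n| < e.
Proof.
move=> [S /pcard_surjP[s sS] /denseP dS]; exists s => x e e0.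
by have [y Sy xy] := dS x e e0; have [n _ sny] := sS y Sy; exists n; rewrite sny.
Qed.

(** By separability an open set is the union of the balls that it contains among those with center
    [s n] and radius 1 / (k + 1); these are countably many, and their preimages are sublevel sets of
    the functions |F x - c|. *)
Lemma measurable_fun_borel_norm d (T : measurableType d)
    (V : completeNormedModType R) (F : T -> V) : separable V ->
  (forall c, measurable_fun setT (fun x => `|F x - c|)) ->
  measurable_fun setT (F : T -> borel V).
Proof.
move=> /separable_dense_seq[s ds] mF.
apply: (@measurability _ _ T (borel V) setT F (@open V) erefl) => _ [A oA <-]; rewrite setTI.
pose r k : R := k.+1%:R^-1.
have r0 k : 0 < r k by rewrite invr_gt0.
pose J n k := if `[< ball (s n) (r k) `<=` A >]
  then F @^-1` ball (s n) (r k) else set0.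
suff -> : F @^-1` A = \bigcup_n \bigcup_k J n k.
  apply: bigcupT_measurable => n; apply: bigcupT_measurable => k.
  rewrite /J; case: ifP => // _.
  have := mF (s n) measurableT _ (measurable_itv `]-oo, r k[).
  rewrite setTI; congr measurable; apply/seteqP.
  by split=> x; rewrite -ball_normE /= in_itv/= distrC.
apply/seteqP; split => x /=; last first.
  move=> [n _ [k _]]; rewrite /J; case: ifPn => // /asboolP h; exact: h.
move=> Ax; have /nbhs_ballP[e /= e0 eA] := open_nbhs_nbhs (conj oA Ax).
have [k _ hk] : exists2 k, True & r k < e / 2.
  exists (Num.truncn (e / 2)^-1) => //.
  rewrite /r -[ltRHS]invrK ltf_pV2 ?posrE ?invr_gt0 ?divr_gt0//.
  exact: truncnS_gt.
have [n xn] := ds (F x) _ (r0 k).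
exists n => //; exists k => //; rewrite /J; case: ifPn => [_|/asboolPn[]].
  by rewrite /= -ball_normE /= distrC.
move=> y; rewrite -ball_normE /= => yn; apply: eA; rewrite -ball_normE /=.
rewrite -(subrK (s n) (F x)) -addrA; apply: le_lt_trans (ler_normD _ _) _.
by rewrite (splitr e) ltrD// ?(lt_trans xn)// (lt_trans yn).
Qed.

Lemma continuous_measurable_borel (T U : ptopologicalType) (g : T -> U) :
  continuous g -> measurable_fun setT (g : borel T -> borel U).
Proof.
move=> cg; apply: (@measurability _ _ (borel T) (borel U) setT g (@open U) erefl) => _ [A oA <-]; rewrite setTI.
by apply: sub_sigma_algebra; apply: open_comp.
Qed.

Lemma continuous_measurable_real (T : ptopologicalType) (g : T -> R) :
  continuous (g : T -> R^o) ->
  measurable_fun setT (g : borel T -> measurableTypeR R).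
Proof.
move=> cg; apply: (measurability (@RGenOInfty.G R)).
  exact: RGenOInfty.measurableE.
move=> _ [_ [x ->] <-]; rewrite setTI.
apply: sub_sigma_algebra; apply: (@open_comp _ _ (g : T -> R^o)) => //.
Qed.

(** The squared distance to c is a polynomial in the [g i], with inner products as coefficients, so
    the preceding criterion reduces everything to real functions. *)
Lemma measurable_sum_scale d (T : measurableType d)
    (V : completeNormedModType R) (ip : {dot V for idfun})
    (ip_norm : forall x, ip x x = `|x| ^+ 2) n (g : 'I_n -> T -> R)
    (a : 'I_n -> V) : separable V -> (forall i, measurable_fun setT (g i)) ->
  measurable_fun setT ((fun x => \sum_(i < n) g i x *: a i) : T -> borel V).
Proof.
move=> sV mg; apply: measurable_fun_borel_norm => // c.
have -> : (fun x => `|\sum_(i < n) g i x *: a i - c|) = (fun x =>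
   Num.sqrt (\sum_(i < n) \sum_(j < n) g i x * g j x * ip (a i) (a j)
     - 2 * (\sum_(i < n) g i x * ip (a i) c) + ip c c)).
  apply/funext => x; rewrite -[LHS]ger0_norm// -sqrtr_sqr; congr Num.sqrt.
  rewrite (sqr_normB ip_norm) -!ip_norm; congr (_ - 2 * _ + _).
    rewrite ip_suml; apply: eq_bigr => i _.
    by rewrite ip_sumr; apply: eq_bigr => j _; rewrite ipZl ipZr mulrA.
  by rewrite ip_suml; apply: eq_bigr => i _; rewrite ipZl.
have msqrt : measurable_fun setT (Num.sqrt : R -> R).
  apply: continuous_measurable_fun; exact: sqrt_continuous.
pose Q x := \sum_(i < n) \sum_(j < n) g i x * g j x * ip (a i) (a j)
     - 2 * (\sum_(i < n) g i x * ip (a i) c) + ip c c.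
suff mQ : measurable_fun setT Q by exact: (measurableT_comp msqrt mQ).
apply: measurable_funD => //; apply: measurable_funB.
  apply: measurable_sum => i; apply: measurable_sum => j.
  by apply: measurable_funM => //; exact: measurable_funM.
apply: measurable_funM => //; apply: measurable_sum => i.
exact: measurable_funM.
Qed.

End borel.

(** * Elements of B' as elements of H *)

Section dual.
Context {R : realType} {H B : completeNormedModType R}.
Variables (ip : {dot H for idfun}) (iota : {linear H -> B}) (K : R).
Hypothesis ip_norm : forall x, ip x x = `|x| ^+ 2.
Hypothesis iota_bounded : forall x, `|iota x| <= K * `|x|.
Hypothesis iota_dense : dense (range iota).
Hypothesis iota_inj : forall x, iota x = 0 -> x = 0.

Lemma scalarD (V : lmodType R) (g : V -> R) x y :
  scalar g -> g (x + y) = g x + g y.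
Proof. by move=> gl; rewrite -[x]scale1r gl scale1r mul1r. Qed.

Lemma scalar0 (V : lmodType R) (g : V -> R) : scalar g -> g 0 = 0.
Proof. by move=> gl; apply: (addrI (g 0)); rewrite -scalarD// !addr0. Qed.

Lemma scalarZ (V : lmodType R) (g : V -> R) s x :
  scalar g -> g (s *: x) = s * g x.
Proof. by move=> gl; rewrite -[s *: x]addr0 gl scalar0// addr0. Qed.

Lemma scalarN (V : lmodType R) (g : V -> R) x : scalar g -> g (- x) = - g x.
Proof. by move=> gl; rewrite -scaleN1r scalarZ// mulN1r. Qed.

Lemma bounded_scalar_continuous (V : normedModType R) (g : V -> R) C :
  scalar g -> (forall x, `|g x| <= C * `|x|) -> continuous (g : V -> R^o).
Proof.
move=> gl gC x; apply/cvgrPdist_lt => e e0.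
have C0 : 0 < `|C| + 1 by rewrite ltr_wpDl.
near=> y; rewrite -scalarN// -scalarD//.
apply: le_lt_trans (gC _) _.
apply: (@le_lt_trans _ _ ((`|C| + 1) * `|x - y|)).
  by rewrite ler_wpM2r// (le_trans (ler_norm C))// lerDl.
rewrite mulrC -ltr_pdivlMr//.
near: y; apply: cvgr_dist_lt => //; first exact: divr_gt0.
Unshelve. all: by end_near. Qed.

(** Hahn-Banach for the norm of B gives y; [y \o iota] is bounded because [iota] is, and Riesz gives
    a. *)
Lemma dual_elt_norming (z : B) : exists a y,
  [/\ dual_elt ip iota a y, (forall x, `|y x| <= `|x|) & y z = `|z|].
Proof.
have nsub : sublinear (fun x : B => `|x|).
  by split=> [x y|s x s0]; [exact: ler_normD|rewrite normrZ ger0_norm].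
have [y [yl yle yz]] := hahn_banach z nsub.
have yn x : `|y x| <= `|x|.
  rewrite ler_norml yle andbT lerNl -scalarN//.
  by rewrite (le_trans (yle _))// normrN.
have [||a ya] := @riesz _ _ _ ip_norm (y \o iota).
- by move=> s u v /=; rewrite linearP yl.
- by exists K => x /=; rewrite (le_trans (yn _)).
exists a, y; split => //; split => //.
by apply: (@bounded_scalar_continuous _ _ 1) => // x; rewrite mul1r.
Qed.

Lemma dual_elt_lin s a b y z : dual_elt ip iota a y -> dual_elt ip iota b z ->
  dual_elt ip iota (s *: a + b) (fun x => s * y x + z x).
Proof.
move=> [yl yc ya] [zl zc zb]; split.
- by move=> c u v; rewrite yl zl; ring.
- move=> x; apply: (@cvgD _ R^o); last exact: zc.
  by apply: cvgM; [exact: cvg_cst|exact: yc].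
- by move=> x; rewrite ya zb ipDl ipZl.
Qed.

Lemma dual_elt0 : dual_elt ip iota 0 (fun=> 0).
Proof.
split; first by move=> s u v; rewrite mulr0 addr0.
  by move=> x; exact: cvg_cst.
by move=> x; rewrite ip0l.
Qed.

Lemma dual_elt_inj a y z : dual_elt ip iota a y -> dual_elt ip iota a z -> y = z.
Proof.
move=> ya za; have [_ uc u0] := dual_elt_lin (-1) ya za.
apply/funext => x; apply/eqP; rewrite eq_sym -subr_eq0 addrC -[- y x]mulN1r.
apply/negP => ux.
pose u t := -1 * y t + z t.
have e0 : 0 < `|u x| by rewrite normr_gt0; apply/negP.
have /cvgrPdist_lt/(_ _ e0) := uc x.
move=> /nbhs_ballP[d /= d0 hd].
have /denseP/(_ x d d0)[_ [h _ <-] xh] := iota_dense.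
have := hd (iota h); rewrite -ball_normE /= u0 => /(_ xh).
rewrite scaleN1r addNr ip0l subr0 /u => /(le_lt_trans (lexx _)).
by rewrite ltxx.
Qed.

(* If a is orthogonal to the image of B', all of B' vanishes at iota a. *)
Lemma dual_elt_dense : dense [set a | exists y, dual_elt ip iota a y].
Proof.
apply: (dense_of_trivial_orth ip_norm).
- by exists (fun=> 0); exact: dual_elt0.
- by move=> s a b [y ya] [z zb]; eexists; exact: dual_elt_lin ya zb.
move=> a ha; have [b [y [yb _ yz]]] := dual_elt_norming (iota a).
apply: iota_inj; apply/eqP; rewrite -normr_le0 -yz.
have [_ _ ->] := yb; rewrite ipC ha//; by exists y.
Qed.

Lemma measurable_dual_elt a y : dual_elt ip iota a y ->
  measurable_fun setT (y : borel B -> measurableTypeR R).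
Proof. by move=> [_ yc _]; exact: continuous_measurable_real. Qed.

Lemma separable_completion : separable H -> separable B.
Proof.
move=> [S cS /denseP dS]; exists (iota @` S); first exact: sub_countable (card_image_le _ _) cS.
apply/denseP => x e e0; have e2 : 0 < e / 2 by rewrite divr_gt0.
have /denseP/(_ x _ e2)[_ [h _ <-] xh] := iota_dense.
have K0 : 0 < `|K| + 1 by rewrite ltr_wpDl.
have [s Ss hs] := dS h _ (divr_gt0 e2 K0).
exists (iota s); first by exists s.
rewrite -(subrK (iota h) x) -addrA; apply: le_lt_trans (ler_normD _ _) _.
rewrite (splitr e) ltrD// -linearB; apply: le_lt_trans (iota_bounded _) _.
move: hs; rewrite ltr_pdivlMr//; apply: le_lt_trans.
by rewrite mulrC ler_wpM2l// (le_trans (ler_norm K))// lerDl.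
Qed.

(** Take [y n] norming the n-th point of a dense sequence: the norm of B is then the supremum of
    countably many functionals. An arbitrary source T is allowed so that the result applies to the
    identity from the sigma-algebra generated by cylinders. *)
Lemma borel_dual_elt : separable H ->
  exists (a : nat -> H) (y : nat -> B -> R),
    (forall n, dual_elt ip iota (a n) (y n)) /\
    forall d (T : measurableType d) (F : T -> B),
      (forall n, measurable_fun setT (fun t => y n (F t))) ->
      measurable_fun setT (F : T -> borel B).
Proof.
move=> /separable_completion sB.
have [s ds] := separable_dense_seq sB.
have /choice[a /choice[y hy]] : forall n, exists a y,
    [/\ dual_elt ip iota a y, (forall x, `|y x| <= `|x|) & y (s n) = `|s n|].
  by move=> n; exact: dual_elt_norming.
exists a, y; split=> [n|d T F mF]; first by have [] := hy n.
apply: measurable_fun_borel_norm => // c.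
have yl n : scalar (y n) by have [[]] := hy n.
have -> : (fun x => `|F x - c|) = (fun x => sups (fun n => y n (F x) - y n c) 0).
  apply/funext => x; apply/eqP; rewrite eq_le; apply/andP; split; last first.
    apply: sup_le_ub; first by exists (y 0%N (F x) - y 0%N c), 0%N.
    move=> _ [n _ <-]; rewrite -scalarN// -scalarD//.
    by have [_ /(_ (F x - c)) + _] := hy n; exact/le_trans/ler_norm.
  apply/ler_addgt0Pr => e e0; have e2 : 0 < e / 2 by rewrite divr_gt0.
  (* With z = F x - c, one has |z| <= |s n| + |z - s n| and y n z >= |s n| - |z - s n|, whence the
     loss of twice e / 2. *)
  have [n hn] := ds (F x - c) _ e2.
  have yE : y n (F x) - y n c = y n (F x - c) by rewrite (scalarD _ _ (yl n)) (scalarN _ (yl n)).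
  apply: (@le_trans _ _ ((y n (F x) - y n c) + e)); last first.
    rewrite lerD2r; apply: ub_le_sup; last by exists n.
    exists `|F x - c| => _ [k _ <-]; rewrite -scalarN// -scalarD//.
    by have [_ /(_ (F x - c)) + _] := hy k; exact/le_trans/ler_norm.
  rewrite yE -[in leLHS](subrK (s n) (F x - c)).
  apply: le_trans (ler_normD _ _) _.
  have [_ yn yz] := hy n; rewrite -yz.
  have := yn (F x - c - s n); rewrite (scalarD _ _ (yl n)) (scalarN (s n) (yl n)).
  rewrite distrC => /(le_trans (ler_norm _)).
  move: hn; set p := y n (s n); set q := y n _; set r := `| _ |.
  by move=> *; lra.
apply: measurable_fun_sups => [x _|n].
  exists `|F x - c| => _ [k _ <-]; rewrite -scalarN// -scalarD//.
  by have [_ /(_ (F x - c)) + _] := hy k; exact/le_trans/ler_norm.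
exact: measurable_funB.
Qed.

End dual.

(** * Convergence in L^1 *)

Section Lp.
Context d (T : measurableType d) (R : realType).
Variable P : probability T R.
Local Open Scope ereal_scope.

Lemma Lnorm1_le (f : T -> R) (p : R) : measurable_fun setT f -> (1 <= p)%R ->
  'N[P]_1[EFin \o f] <= 'N[P]_p%:E[EFin \o f].
Proof.
move=> mf; rewrite le_eqVlt => /predU1P[<-//|p1].
have p0 : (0 < p)%R by exact: lt_trans p1.
have q0 : (0 < (1 - p^-1)^-1)%R by rewrite invr_gt0 subr_gt0 invf_lt1.
have := @hoelder _ _ _ P f (cst 1%R) p (1 - p^-1)^-1 mf (measurable_cst _) p0 q0.
rewrite invrK subrKC => /(_ erefl); rewrite Lnorm_cst1.
rewrite [X in X `^ _](_ : _ = 1) ?poweR1r ?mule1; last exact: probability_setT.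
 apply: le_trans; rewrite le_eqVlt; apply/orP; left.
by apply/eqP; apply: eq_Lnorm => x /=; rewrite mulr1.
Qed.

Lemma Lnorm2_leP (f : T -> R) (c : R) : (0 <= c)%R ->
  'N[P]_2%:E[EFin \o f] <= c%:E <-> \int[P]_x ((f x ^+ 2)%:E) <= (c ^+ 2)%:E.
Proof.
move=> c0.
have fE x : `|(EFin \o f) x| `^ 2 = (f x ^+ 2)%:E.
  by rewrite /= powR_mulrn// real_normK// num_real.
have cE : c%:E `^ 2 = (c ^+ 2)%:E by rewrite /= powR_mulrn.
have N0 : 0 <= 'N[P]_2%:E[EFin \o f] by exact: Lnorm_ge0.
have cE' : c%:E = (c ^+ 2)%:E `^ 2^-1.
  by rewrite -cE -poweRrM mulfV// poweRe1// lee_fin.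
split=> [h|h].
  under eq_integral do rewrite -fE.
  rewrite -powR_Lnorm// -cE; apply: gt0_ler_poweR => //;
    by rewrite in_itv/= leey andbT// lee_fin.
rewrite [X in X <= _](_ : _ = (\int[P]_x ((f x ^+ 2)%:E)) `^ 2^-1); last first.
  by rewrite unlock; congr (_ `^ _); apply: eq_integral => x _; rewrite fE.
rewrite cE'; apply: gt0_ler_poweR => //.
  by rewrite in_itv/= leey andbT integral_ge0// => x _; rewrite lee_fin sqr_ge0.
by rewrite in_itv/= leey andbT lee_fin sqr_ge0.
Qed.

(** The bounds on the increments add up to at most 1, so the sum of their absolute values is
    integrable, hence finite almost everywhere, and the telescoping series converges there. *)
Lemma fast_cauchy_cvg_ae (f : nat -> T -> R) :
  (forall n, measurable_fun setT (f n)) ->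
  (forall n, 'N[P]_1[EFin \o (f n.+1 \- f n)%R] <= (1 / (2 ^ n.+1)%:R)%:E) ->
  exists2 g : T -> R, measurable_fun setT g &
    {ae P, forall x, (f ^~ x @ \oo --> g x)%classic}.
Proof.
move=> mf fN.
pose u n x := `|(f n.+1 x - f n x)|%R.
pose S x := \sum_(n <oo) (u n x)%:E.
have u0 n x : 0 <= (u n x)%:E by rewrite lee_fin /u normr_ge0.
have mu n : measurable_fun setT (fun x => (u n x)%:E).
  by apply/measurable_EFinP; apply: measurableT_comp => //; exact: measurable_funB.
have S0 x : 0 <= S x by exact: nneseries_ge0.
have mS : measurable_fun setT S by exact: ge0_emeasurable_sum.
have Soo : \int[P]_x S x < +oo.
  rewrite integral_nneseries//; apply: (@le_lt_trans _ _ 1%:E); last exact: ltry.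
  apply: le_trans (epsilon_trick0 xpredT ler01); apply: lee_nneseries => n _.
    by move=> *; apply: integral_ge0 => *; exact: u0.
  by move: (fN n); rewrite Lnorm1; apply: le_trans.
have iS : P.-integrable setT S.
  apply/integrableP; split => //.
  by under eq_integral => x _ do rewrite gee0_abs//.
(* The upper limit is defined and measurable everywhere, and is the limit wherever the latter
   exists. *)
pose g x := fine (limn_esup (fun n => (f n x)%:E)).
exists g.
  apply: measurableT_comp => //; apply: measurable_fun_limn_esup => n.
  exact/measurable_EFinP.
have := integrable_ae measurableT iS; apply: filterS => x /(_ I) Sx.
have cf : cvgn (f ^~ x).
  have : cvgn (series (fun n => f n.+1 x - f n x)%R).
    apply: normed_cvg; apply: nondecreasing_is_cvgn.
      by apply: nondecreasing_series => n _ _; exact: normr_ge0.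
    exists (fine (S x)) => _ [n _ <-]; rewrite -lee_fin fineK//.
    by rewrite /series/= -sumEFin; exact: nneseries_lim_ge.
  move=> /cvg_ex[l hl]; apply/cvg_ex; exists (l + f 0 x)%R.
  rewrite (_ : f ^~ x = fun n => (series (fun n => f n.+1 x - f n x) n + f 0 x)%R).
    by apply: cvgD => //; exact: cvg_cst.
  by apply/funext => n; rewrite /series/= telescope_sumr// subrK.
move: cf => /cvg_ex[l hl]; rewrite /g.
have /cvg_limn_einf_sup[_ ->] : (fun n => (f n x)%:E) @ \oo --> l%:E.
  exact/cvg_EFin/hl/nearW.
by [].
Qed.

(** Fatou's lemma in the form that carries distance bounds over to an almost everywhere limit: F is
    later the square, or the absolute value, of the difference with a fixed function. *)
Lemma fatou_limit (f : nat -> T -> R) (g : T -> R) (F : R -> T -> R) (c : \bar R) :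
  (forall n, measurable_fun setT (fun x => F (f n x) x)) ->
  measurable_fun setT (fun x => F (g x) x) ->
  (forall r x, (0 <= F r x)%R) -> (forall x, continuous (F ^~ x)) ->
  {ae P, forall x, (f ^~ x @ \oo --> g x)%classic} ->
  (forall n, \int[P]_x (F (f n x) x)%:E <= c) ->
  \int[P]_x (F (g x) x)%:E <= c.
Proof.
move=> mf mg F0 cF fg fc.
have := @fatou _ T R P setT measurableT (fun n x => (F (f n x) x)%:E).
move=> /(_ (fun n => (measurable_EFinP _ _).2 (mf n))).
move=> /(_ (fun n x _ => F0 _ _)) h.
apply: (@le_trans _ _ (limn_einf (fun n => \int[P]_x (F (f n x) x)%:E))).
  apply: le_trans h; rewrite le_eqVlt; apply/orP; left; apply/eqP.
  apply: ge0_ae_eq_integral => //.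
  - exact/measurable_EFinP.
  - rewrite (_ : (fun _ => _) = (fun x => - limn_esup (fun n => - (F (f n x) x)%:E))).
      apply: measurableT_comp => //; apply: measurable_fun_limn_esup => n.
      by apply: measurableT_comp => //; exact/measurable_EFinP.
    by [].
  - by move=> x _; rewrite lee_fin.
  - move=> x _; rewrite limn_einf_lim; apply: lime_ge; first exact: is_cvg_einfs.
    apply: nearW => n; apply: le_ereal_inf_tmp => _ [k _ <-].
    by rewrite lee_fin.
  - apply: filterS fg => x fx _.
    have /cvg_limn_einf_sup[-> _] // : (fun n => (F (f n x) x)%:E) @ \oo --> (F (g x) x)%:E.
    apply/cvg_EFin; first exact: nearW.
    exact: (@cvg_comp _ _ _ (f ^~ x) (F ^~ x) _ _ _ fx (cF x (g x))).
rewrite limn_einf_lim; apply: lime_le; first exact: is_cvg_einfs.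
apply: nearW => n; apply: le_trans (fc n).
by apply: ereal_inf_lbound; exists n => /=.
Qed.

End Lp.

(** * The functions ell *)

Section gaussian_law.
Context {R : realType}.
Let RB := measurableTypeR R.

Lemma measurable_mktuple d (T : measurableType d) n (y : 'I_n -> T -> RB) :
  (forall i, measurable_fun setT (y i)) ->
  measurable_fun setT (fun x => [tuple y i x | i < n]).
Proof.
move=> my; apply/measurable_fun_tnthP => i.
by rewrite (_ : _ \o _ = y i)//; apply/funext => x /=; rewrite tnth_mktuple.
Qed.

Context d (T : measurableType d) (P : {measure set T -> \bar R}).

Lemma ge0_integral_law d' (T' : measurableType d')
    (P' : {measure set T' -> \bar R}) n
    (X : T -> n.-tuple RB) (X' : T' -> n.-tuple RB) (Phi : n.-tuple RB -> \bar R) :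
  measurable_fun setT X -> measurable_fun setT X' ->
  (forall A, measurable A -> P (X @^-1` A) = P' (X' @^-1` A)) ->
  measurable_fun setT Phi -> (forall v, 0 <= Phi v)%E ->
  (\int[P]_x Phi (X x) = \int[P']_x Phi (X' x))%E.
Proof.
move=> mX mX' XX' mPhi Phi0.
have := @ge0_integral_pushforward _ _ _ _ _ X mX P setT Phi measurableT mPhi
  (fun v _ => Phi0 v).
have := @ge0_integral_pushforward _ _ _ _ _ X' mX' P' setT Phi measurableT mPhi
  (fun v _ => Phi0 v).
rewrite !preimage_setT => <- <-.
by apply: eq_measure_integral => A mA _; exact: XX'.
Qed.

Lemma ge0_integral_law_shift n (h s : R) (X : T -> n.+1.-tuple RB)
    (Phi : n.+1.-tuple RB -> \bar R) :
  0 < h -> measurable_fun setT X ->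
  (forall A, measurable A -> P (X @^-1` A) = gaussian h A) ->
  measurable_fun setT Phi -> (forall v, 0 <= Phi v)%E ->
  (\int[P]_x Phi (shift_head s (X x)) =
   \int[P]_x (Phi (X x) * (expR (s * thead (X x) / h - s ^+ 2 / (2 * h)))%:E))%E.
Proof.
move=> h0 mX lawX mPhi Phi0.
pose nu := measure_function_pushforward__canonical__measure_function_Measure P mX.
have := @ge0_integral_gaussian_shift R n h s nu Phi h0 lawX mPhi Phi0.
have mS := @measurable_shift_head R n s.
have -> := @ge0_integral_pushforward _ _ _ _ _ X mX P setT
  (fun v => Phi (shift_head s v)) measurableT
  (measurableT_comp mPhi mS) (fun v _ => Phi0 _).
pose D (v : n.+1.-tuple RB) := expR (s * thead v / h - s ^+ 2 / (2 * h)).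
have mD : measurable_fun setT D.
  apply: measurableT_comp => //; apply: measurable_funB => //.
  apply: measurable_funM => //; apply: measurable_funM => //.
  exact: measurable_tnth.
have := @ge0_integral_pushforward _ _ _ _ _ X mX P setT
  (fun v => (Phi v * (D v)%:E)%E) measurableT.
rewrite !preimage_setT => -> //.
  by apply: emeasurable_funM => //; exact/measurable_EFinP.
by move=> v _; rewrite mule_ge0// lee_fin expR_ge0.
Qed.

End gaussian_law.

(** Squaring 1 + x / 2 <= exp(x / 2) for x >= 0. It bounds second moments by exponential moments,
    which the Gaussian shift formula evaluates. *)
Lemma sqr_le_expR {R : realType} (x : R) : x ^+ 2 <= 4 * (expR x + expR (- x)).
Proof.
wlog x0 : x / 0 <= x.
  move=> h; have [/h//|x0] := leP 0 x.
  by rewrite -sqrrN -[x in expR x]opprK addrC h// oppr_ge0 ltW.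
have h : 1 + x / 2 <= expR (x / 2) by exact: expR_ge1Dx.
have e0 : 0 < expR (- x) by exact: expR_gt0.
have -> : expR x = expR (x / 2) ^+ 2.
  by rewrite expr2 -expRD -splitr.
nra.
Qed.

Section ell.
Context {R : realType} {H B : completeNormedModType R}.
Variables (ip : {dot H for idfun}) (iota : {linear H -> B}) (K : R).
Hypothesis ip_norm : forall x, ip x x = `|x| ^+ 2.
Hypothesis iota_bounded : forall x, `|iota x| <= K * `|x|.
Hypothesis iota_dense : dense (range iota).
Hypothesis iota_inj : forall x, iota x = 0 -> x = 0.
Variables (t : R) (t0 : 0 < t) (mu : probability (borel B) R).
Hypothesis mu_gaussian : gaussian_measure ip iota t mu.
Let RB := measurableTypeR R.
Local Open Scope ereal_scope.

(** No Gaussian integral is computed. For a normalised element z of B', the shift formula with Phi =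
    1 says that exp(s z / t - s^2 / (2 t)) has integral 1; taking s = t and s = - t and applying
    [sqr_le_expR] gives a second moment of at most 8 exp(t / 2). *)
Lemma dual_elt_Lnorm2 : exists2 C : R, (0 <= C)%R & forall b (y : borel B -> R),
  dual_elt ip iota b y -> 'N[mu]_2%:E[EFin \o y] <= (C * `|b|)%:E.
Proof.
pose E := (4 * expR (t / 2) *+ 2)%R.
have E0 : (0 <= E)%R by rewrite mulrn_wge0// mulr_ge0// expR_ge0.
exists (Num.sqrt E) => [|b y by_]; first exact: sqrtr_ge0.
have [b0|b0] := eqVneq b 0%R.
  rewrite b0 in by_ *; rewrite (dual_elt_inj iota_dense by_ (dual_elt0 ip iota)).
  by rewrite normr0 mulr0 (_ : EFin \o _ = cst 0)// Lnorm0.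
pose u := normalize b; pose z x := (`|b|^-1 * y x + 0)%R.
have uz : dual_elt ip iota u z.
  by rewrite /u /normalize -[(_ *: _)%R]addr0; exact: dual_elt_lin by_ (dual_elt0 _ _).
have yz x : y x = (`|b| * z x)%R.
  by rewrite /z addr0 mulrA divff ?mul1r// normr_eq0.
have my : measurable_fun setT (y : borel B -> RB) := measurable_dual_elt by_.
have mz : measurable_fun setT (z : borel B -> RB) := measurable_dual_elt uz.
pose X (x : borel B) : 1.-tuple RB := [tuple z x | i < 1].
have mX : measurable_fun setT X by exact: measurable_mktuple.
have lawX A : measurable A -> mu (X @^-1` A) = gaussian t A.
  move=> mA; apply: (@mu_gaussian 1%N [tuple u] (fun=> z) _ _ A mA).
    by rewrite /orthonormal /= (ip_normalize ip_norm b0) eqxx.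
  by move=> i; rewrite (tnth_nth 0%R) ord1.
have mE s : measurable_fun setT (fun x => (expR (s * z x / t - s ^+ 2 / (2 * t)))%:E).
  apply/measurable_EFinP; apply: measurableT_comp => //.
  apply: measurable_funB => //; apply: measurable_funM => //.
  exact: measurable_funM.
have expE s : \int[mu]_x (expR (s * z x / t - s ^+ 2 / (2 * t)))%:E = 1.
  have h := @ge0_integral_law_shift R _ _ mu 0 t s X (cst 1) t0 mX lawX
    (measurable_cst _) (fun=> lee01).
  transitivity (\int[mu]_x cst 1 (shift_head s (X x))).
    by rewrite h; apply: eq_integral => x _; rewrite /= mul1e /thead tnth_mktuple.
  by rewrite integral_cst// mul1e; exact: probability_setT.
apply/Lnorm2_leP; first by rewrite mulr_ge0// sqrtr_ge0.
rewrite exprMn sqr_sqrtr//.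
under eq_integral do rewrite yz exprMn mulrC EFinM.
have mz2 : measurable_fun setT (fun x => (z x ^+ 2)%:E).
  by apply/measurable_EFinP; exact: measurable_funX.
rewrite ge0_integralZr//; last by move=> x _; rewrite lee_fin sqr_ge0.
rewrite [leRHS]EFinM; apply: lee_wpmul2r; first by rewrite lee_fin sqr_ge0.
pose c := (4 * expR (t / 2))%R.
have c0 : 0 <= c%:E by rewrite lee_fin mulr_ge0 ?expR_ge0.
apply: (@le_trans _ _ (\int[mu]_x (c%:E *
   ((expR (t * z x / t - t ^+ 2 / (2 * t)))%:E +
    (expR ((- t) * z x / t - (- t) ^+ 2 / (2 * t)))%:E)))).
  apply: ge0_le_integral => //.
  - by move=> x _; rewrite lee_fin sqr_ge0.
  - by apply: measurable_funeM; exact: emeasurable_funD.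
  - move=> x _; rewrite -EFinD -EFinM lee_fin /c -(mulrA 4%R) mulrDr -!expRD.
    have -> : (t / 2 + (t * z x / t - t ^+ 2 / (2 * t)) = z x)%R.
      by field; rewrite gt_eqF.
    have -> : (t / 2 + (- t * z x / t - (- t) ^+ 2 / (2 * t)) = - z x)%R.
      by field; rewrite gt_eqF.
    exact: sqr_le_expR.
rewrite ge0_integralZl//; last 2 first.
- exact: emeasurable_funD.
- by move=> x _; rewrite adde_ge0// lee_fin expR_ge0.
rewrite ge0_integralD//.
by rewrite !expE -EFinD -EFinM lee_fin /E mulrDr mulr1 mulr2n.
Qed.

Let expn2 m : (1 / (2 ^ m.+1)%:R = 2^-1 / (2 ^ m)%:R :> R)%R.
Proof. by rewrite expnS natrM invfM mulrA mul1r. Qed.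

(** Elements [y n] of B' with images [b n] tending fast to a are Cauchy in L^2 by the preceding
    bound. Their almost everywhere limit l is an L^2 limit by Fatou, and any other z in B' with
    image close to a is compared with l through some [y n]. *)
Lemma is_ell_exists a : exists l, is_ell ip iota mu a l.
Proof.
have [C C0 hC] := dual_elt_Lnorm2.
have C1 : (0 < C + 1)%R by rewrite ltr_wpDl.
pose r (n : nat) : R := ((2 ^ n)%:R^-1)%R.
have r0 n : (0 < r n)%R by rewrite invr_gt0 ltr0n expn_gt0.
have rS n k : (n <= k)%N -> (r k <= r n)%R.
  by move=> nk; rewrite lef_pV2 ?posrE ?ltr0n ?expn_gt0// ler_nat leq_exp2l.
(* The distance from [y n] to a later [y k] is at most C (dl n + dl k) <= r n / 2, which is the rate
   1 / 2^(n+1) asked by [fast_cauchy_cvg_ae]. Using C + 1 avoids a division by zero. *)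
pose dl n : R := (r n / (4 * (C + 1)))%R.
have d0 n : (0 < dl n)%R by rewrite divr_gt0// mulr_gt0.
have Cd n : (C * dl n <= r n / 4)%R.
  rewrite /dl mulrA ler_pdivrMr ?mulr_gt0//.
  have -> : (r n / 4 * (4 * (C + 1)) = r n * (C + 1))%R by field.
  by rewrite mulrC ler_wpM2l ?(ltW (r0 n))// lerDl.
have /choice[b /choice[y hy]] : forall n, exists b y,
    dual_elt ip iota b (y : borel B -> R) /\ (`|a - b| < dl n)%R.
  move=> n.
  have /denseP/(_ a _ (d0 n))[b [y yb] ab] :=
    dual_elt_dense ip_norm iota_bounded iota_inj.
  by exists b, y.
have my n : measurable_fun setT (y n : borel B -> R).
  exact: (measurable_dual_elt (hy n).1).
have hCB c z c' z' : dual_elt ip iota c (z : borel B -> R) ->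
    dual_elt ip iota c' (z' : borel B -> R) ->
    'N[mu]_2%:E[EFin \o (z \- z')%R] <= (C * `|c - c'|)%:E.
  move=> cz cz'; have := hC _ _ (dual_elt_lin (-1) cz' cz).
  rewrite scaleN1r addrC; congr (_ <= _); apply: eq_Lnorm => x /=.
  by rewrite mulN1r addrC.
have yy n k : (n <= k)%N -> 'N[mu]_2%:E[EFin \o (y k \- y n)%R] <= (r n / 2)%:E.
  move=> nk; apply: le_trans (hCB _ _ _ _ (hy k).1 (hy n).1) _; rewrite lee_fin.
  have -> : (b k - b n = (a - b n) - (a - b k))%R by rewrite opprB [RHS]addrC addrA subrK.
  apply: (@le_trans _ _ (C * (dl n + dl k))%R).
    rewrite ler_wpM2l// (le_trans (ler_normB _ _))// lerD//; exact/ltW/(hy _).2.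
  have := Cd n; have := Cd k; have := rS _ _ nk; have := r0 k.
  by rewrite mulrDr; set u := (C * _)%R; set v := (C * _)%R; lra.
have [l ml yl] : exists2 g : borel B -> R, measurable_fun setT g &
    {ae mu, forall x, (y ^~ x @ \oo --> g x)%classic}.
  apply: fast_cauchy_cvg_ae => // n.
  apply: le_trans (Lnorm1_le _ _ (_ : 1 <= 2)%R) _ => //.
    exact: measurable_funB.
    by rewrite ler1n.
  apply: le_trans (yy n _ (leqnSn n)) _.
  by rewrite lee_fin expn2 mulrC.
have yl2 n : 'N[mu]_2%:E[EFin \o (l \- y n)%R] <= (r n / 2)%:E.
  have rn2 : (0 <= r n / 2)%R by rewrite divr_ge0// ltW.
  apply/Lnorm2_leP => //.
  apply: (@fatou_limit _ _ _ mu (fun k => y (k + n)%N) l (fun s x => (s - y n x) ^+ 2)%R).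
  - by move=> k; apply: measurable_funX; exact: measurable_funB.
  - by apply: measurable_funX; exact: measurable_funB.
  - by move=> s x; exact: sqr_ge0.
  - move=> x s; apply: (@continuous_comp _ _ _ (fun s : R => s - y n x)%R (fun s => s ^+ 2)%R).
      by apply: (@cvgD _ R^o); [exact: cvg_id|exact: cvg_cst].
    exact: sqr_continuous.
  - apply: filterS yl => x yx.
    by rewrite (cvg_shiftn n (y ^~ x)).
  - move=> k; apply/(Lnorm2_leP _ _ rn2)/yy; exact: leq_addl.
have N2D (f g : borel B -> R) : measurable_fun setT f -> measurable_fun setT g ->
    'N[mu]_2%:E[EFin \o (f \+ g)%R] <= 'N[mu]_2%:E[EFin \o f] + 'N[mu]_2%:E[EFin \o g].
  by move=> mf mg; apply: minkowski_EFin => //; rewrite ler1n.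
exists l; split.
  rewrite inE; apply/andP; split; rewrite inE//= /finite_norm.
  have lE : EFin \o l = EFin \o ((l \- y 0%N) \+ y 0%N)%R.
    by apply/funext => x /=; rewrite subrK.
  rewrite lE; apply: le_lt_trans (N2D _ _ _ _) _ => //; first exact: measurable_funB.
  apply: (@le_lt_trans _ _ ((r 0%N / 2)%:E + (C * `|b 0%N|)%:E)); last first.
    by rewrite -EFinD ltry.
  by apply: leeD => //; exact: hC (hy 0%N).1.
move=> e e0; pose dd := (e / (4 * (C + 1)))%R.
have dd0 : (0 < dd)%R by rewrite divr_gt0// mulr_gt0.
have Cdd : (C * dd <= e / 4)%R.
  rewrite /dd mulrA ler_pdivrMr ?mulr_gt0//.
  have -> : (e / 4 * (4 * (C + 1)) = e * (C + 1))%R by field.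
  by rewrite mulrC ler_wpM2l ?(ltW e0)// lerDl.
exists dd => // c z cz ca.
have [n rn] : exists n, (r n < e / 2)%R.
  exists (Num.truncn (e / 2)^-1).+1.
  rewrite /r -[ltRHS]invrK ltf_pV2 ?posrE ?invr_gt0 ?divr_gt0 ?ltr0n ?expn_gt0//.
  apply: lt_le_trans (truncnS_gt _) _.
  by rewrite ler_nat ltnW// ltn_expl.
have mz : measurable_fun setT (z : borel B -> R) := measurable_dual_elt cz.
have -> : EFin \o (z \- l)%R = EFin \o ((z \- y n) \+ (y n \- l))%R.
  by apply/funext => x /=; rewrite addrA subrK.
apply: le_lt_trans (N2D _ _ _ _) _; [exact: measurable_funB..|].
have -> : 'N[mu]_2%:E[EFin \o (y n \- l)%R] = 'N[mu]_2%:E[EFin \o (l \- y n)%R].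
  rewrite -oppe_Lnorm; apply: eq_Lnorm => x /=.
  by rewrite opprB.
apply: (@le_lt_trans _ _ ((C * (dd + dl n))%:E + (r n / 2)%:E)).
  apply: leeD => //; apply: le_trans (hCB _ _ _ _ cz (hy n).1) _.
  rewrite lee_fin ler_wpM2l//.
  have -> : (c - b n = (c - a) + (a - b n))%R by rewrite addrA subrK.
  by rewrite (le_trans (ler_normD _ _))// lerD// ltW// (hy n).2.
rewrite -EFinD lte_fin mulrDr.
have := Cd n; move: Cdd rn; set u := (C * _)%R; set v := (C * _)%R; set w := r n.
by move: e0 => *; lra.
Qed.

Lemma ellP a : is_ell ip iota mu a (ell ip iota mu a).
Proof. by have [l hl] := is_ell_exists a; exact: (xgetI (cst 0%R) hl). Qed.

Lemma measurable_ell a : measurable_fun setT (ell ip iota mu a : borel B -> R).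
Proof.
by have [+ _] := ellP a; rewrite inE => /andP[]; rewrite inE.
Qed.

Lemma ell_approx a (e : R) : (0 < e)%R -> exists2 dl : R, (0 < dl)%R &
  forall b (y : borel B -> R), dual_elt ip iota b y -> (`|b - a| < dl)%R ->
  'N[mu]_1[EFin \o (y \- ell ip iota mu a)%R] < e%:E.
Proof.
move=> e0; have [_ /(_ _ e0)[dl dl0 h]] := ellP a; exists dl => // b y by_ ba.
apply: le_lt_trans (Lnorm1_le _ _ (_ : 1 <= 2)%R) (h _ _ by_ ba); last by rewrite ler1n.
apply: measurable_funB; [exact: (measurable_dual_elt by_)|exact: measurable_ell].
Qed.

Lemma ae_eq_of_Lnorm1_lt (f g : borel B -> R) :
  measurable_fun setT f -> measurable_fun setT g ->
  (forall e : R, (0 < e)%R -> 'N[mu]_1[EFin \o (f \- g)%R] <= e%:E) ->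
  {ae mu, forall x, f x = g x}.
Proof.
move=> mf mg h.
have N0 : 'N[mu]_1[EFin \o (f \- g)%R] = 0.
  apply/eqP; rewrite eq_le Lnorm_ge0 andbT.
  by apply/lee_addgt0Pr => e e0; rewrite add0e h.
have mfg : measurable_fun setT (EFin \o (f \- g)%R).
  by apply/measurable_EFinP; exact: measurable_funB.
have := Lnorm_eq0_eq0 mfg lte01 N0; apply: filterS.
by move=> x /(_ I) /= [] /eqP; rewrite subr_eq0 => /eqP.
Qed.

Lemma ell_dual_elt b y : dual_elt ip iota b y ->
  {ae mu, forall x, ell ip iota mu b x = y x}.
Proof.
move=> by_; have my := measurable_dual_elt by_.
suff : {ae mu, forall x, (y : borel B -> R) x = ell ip iota mu b x}.
  by apply: filterS => x ->.
apply: ae_eq_of_Lnorm1_lt => // [|e e0]; first exact: measurable_ell.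
have [dl dl0 h] := ell_approx b e0.
have bb : (`|b - b| < dl)%R by rewrite subrr normr0.
exact/ltW/(h _ _ by_ bb).
Qed.

(** On B' linearity is exact, by [dual_elt_lin]; approximating a and b by images of elements of B'
    carries it over up to an arbitrarily small L^1 error. *)
Lemma ell_lin s a b : {ae mu, forall x, ell ip iota mu (s *: a + b)%R x =
  (s * ell ip iota mu a x + ell ip iota mu b x)%R}.
Proof.
apply: ae_eq_of_Lnorm1_lt => [||e e0]; first exact: measurable_ell.
  apply: measurable_funD; last exact: measurable_ell.
  by apply: measurable_funM => //; exact: measurable_ell.
(* The errors at c, a and b enter with weights 1, |s| and 1, and (|s| + 2) e / (3 k) <= e. *)
set c := (s *: a + b)%R; pose k := (`|s| + 1)%R.
have k0 : (0 < k)%R by rewrite ltr_wpDl.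
have e3 : (0 < e / (3 * k))%R by rewrite divr_gt0// mulr_gt0.
have [da da0 ha] := ell_approx a e3.
have [db db0 hb] := ell_approx b e3.
have [dc dc0 hc] := ell_approx c e3.
have m0 : (0 < Num.min (Num.min da db) (dc / (2 * k)))%R.
  by rewrite !lt_min da0 db0 divr_gt0// mulr_gt0.
have dD := dual_elt_dense ip_norm iota_bounded iota_inj.
have /denseP/(_ a _ m0)[a' [y ya] aa'] := dD.
have /denseP/(_ b _ m0)[b' [z zb] bb'] := dD.
move: aa' bb'; rewrite !lt_min => /andP[/andP[aa1 _] aa2] /andP[/andP[_ bb1] bb2].
have yz := dual_elt_lin s ya zb.
have {}ha := ha _ _ ya; rewrite distrC in aa1; have {aa1}ha := ha aa1.
have {}hb := hb _ _ zb; rewrite distrC in bb1; have {bb1}hb := hb bb1.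
have {}hc : 'N[mu]_1[EFin \o ((fun x => s * y x + z x) \- ell ip iota mu c)%R] < (e / (3 * k))%:E.
  apply: hc yz _; rewrite /c opprD addrACA -scalerBr.
  apply: le_lt_trans (ler_normD _ _) _; rewrite normrZ.
  move: aa2 bb2; rewrite !ltr_pdivlMr ?mulr_gt0// (distrC a) (distrC b) => aa2 bb2.
  move: aa2 bb2; rewrite /k; set p := `|a' - a|%R; set q := `|b' - b|%R.
  have : (0 <= p)%R by exact: normr_ge0.
  have : (0 <= q)%R by exact: normr_ge0.
  have : (0 <= `|s|)%R by exact: normr_ge0.
  by set u := `|s|%R => *; nra.
have my := measurable_dual_elt ya; have mz := measurable_dual_elt zb.
have ma := measurable_ell a; have mb := measurable_ell b; have mc := measurable_ell c.
have N1D (f g : borel B -> R) : measurable_fun setT f -> measurable_fun setT g ->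
    'N[mu]_1[EFin \o (f \+ g)%R] <= 'N[mu]_1[EFin \o f] + 'N[mu]_1[EFin \o g].
  by move=> mf mg; apply: minkowski_EFin.
rewrite (_ : EFin \o _ = EFin \o ((ell ip iota mu c \- (fun x => s * y x + z x)) \+
  ((fun x => s * (y x - ell ip iota mu a x)) \+ (z \- ell ip iota mu b)))%R); last first.
  by apply/funext => x /=; congr EFin; ring.
have myz : measurable_fun setT ((fun x => s * y x + z x)%R : borel B -> R).
  by apply: measurable_funD => //; exact: measurable_funM.
have mya : measurable_fun setT ((fun x => s * (y x - ell ip iota mu a x))%R : borel B -> R).
  by apply: measurable_funM => //; exact: measurable_funB.
have mzb : measurable_fun setT ((z \- ell ip iota mu b)%R : borel B -> R).
  exact: measurable_funB.
apply: le_trans (N1D _ _ _ _) _.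
- exact: measurable_funB.
- exact: measurable_funD.
apply: le_trans (leeD (lexx _) (N1D _ _ mya mzb)) _.
have -> : 'N[mu]_1[EFin \o (ell ip iota mu c \- (fun x => s * y x + z x))%R] =
    'N[mu]_1[EFin \o ((fun x => s * y x + z x) \- ell ip iota mu c)%R].
  by rewrite -oppe_Lnorm; apply: eq_Lnorm => x /=; rewrite opprB.
have -> : 'N[mu]_1[EFin \o (fun x => s * (y x - ell ip iota mu a x))%R] =
    `|s|%:E * 'N[mu]_1[EFin \o (y \- ell ip iota mu a)%R].
  rewrite !Lnorm1 -ge0_integralZl//.
  - by apply: eq_integral => x _ /=; rewrite normrM EFinM.
  - by apply/measurable_EFinP; apply: measurableT_comp => //; exact: measurable_funB.
apply: (@le_trans _ _ ((e / (3 * k))%:E + (`|s|%:E * (e / (3 * k))%:E + (e / (3 * k))%:E))).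
  apply: leeD; first exact: ltW.
  apply: leeD; last exact: ltW.
  by apply: lee_wpmul2l; [rewrite lee_fin|exact: ltW].
rewrite -EFinM -!EFinD lee_fin.
have kE : (e / (3 * k) * k = e / 3)%R by rewrite invfM mulrA divfK// gt_eqF.
have : (0 < e / (3 * k))%R by [].
move: kE; rewrite {2}/k; set w := (e / (3 * k))%R; set u := `|s|%R.
have : (0 <= u)%R by exact: normr_ge0.
by move=> *; nra.
Qed.

End ell.

(** * Laws of random tuples and their distribution functions *)

Section tuple_boxes.
Context {R : realType}.
Let RB := measurableTypeR R.

Definition box n (c : 'I_n -> R) : set (n.-tuple RB) :=
  [set v | forall i, tnth v i <= c i].

Lemma measurable_box n (c : 'I_n -> R) : measurable (box c).
Proof.
have -> : box c = \bigcap_(i in [set: 'I_n])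
    ((fun v : n.-tuple RB => tnth v i) @^-1` `]-oo, c i]%classic).
  apply/seteqP; split => v /=.
    by move=> h i _ /=; rewrite in_itv/=; exact: h.
  by move=> h i; have := h i I; rewrite /= in_itv/=.
apply: fin_bigcap_measurable => // i _; rewrite -[X in measurable X]setTI.
exact: measurable_tnth.
Qed.

Lemma boxI n (c c' : 'I_n -> R) :
  box c `&` box c' = box (fun i => Num.min (c i) (c' i)).
Proof.
apply/seteqP; split => v /=.
  by move=> [h h'] i; rewrite le_min h h'.
by move=> h; split => i; have := h i; rewrite le_min => /andP[].
Qed.

Lemma measurable_tuple_boxes n (A : set (n.-tuple RB)) : measurable A ->
  <<s [set box c | c in [set: 'I_n -> R]] >> A.
Proof.
pose G : set (set (n.-tuple RB)) := [set box c | c in [set: 'I_n -> R]].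
pose TG := g_sigma_algebraType G.
have mcoord i : measurable_fun setT ((fun v => tnth v i) : TG -> RB).
  apply: (measurability _ (RGenOInfty.measurableE R)).
  move=> _ [_ [r ->] <-]; rewrite setTI.
  (* A half-space in coordinate i is the increasing union of the boxes whose other bounds are k. *)
  have -> : (fun v : TG => tnth v i) @^-1` `]r, +oo[%classic =
      ~` (\bigcup_k box (fun j => if j == i then r else k%:R)).
    apply/seteqP; split => v /=.
      rewrite in_itv/= andbT => rv [k _ /(_ i)]; rewrite eqxx.
      by rewrite leNgt rv.
    move=> nv; rewrite in_itv/= andbT ltNge; apply/negP => vr; apply: nv.
    exists (Num.truncn (\sum_(j < n) `|tnth v j|)).+1 => // j.
    case: eqP => [->//|_].
    apply: le_trans (ltW (truncnS_gt _)).
    rewrite (bigD1 j)//= (le_trans (ler_norm _))// lerDl sumr_ge0//.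
  apply: measurableC; apply: bigcupT_measurable => k.
  by apply: sub_sigma_algebra; eexists; last reflexivity.
have mid : measurable_fun setT (id : TG -> n.-tuple RB).
  apply/measurable_fun_tnthP => i; exact: mcoord.
by move=> mA; have := mid measurableT _ mA; rewrite setTI.
Qed.

(** The hypotheses have the form that closeness in probability provides. Letting e and then dl tend
    to 0, right continuity of distribution functions gives equality on boxes, which are stable under
    intersection and generate the sigma-algebra. *)
Lemma law_unique d (T : measurableType d) (P : probability T R) n
    (X Y : T -> n.-tuple RB) :
  measurable_fun setT X -> measurable_fun setT Y ->
  (forall (c : 'I_n -> R) (dl e : R), 0 < dl -> 0 < e ->
    (P (X @^-1` box c) <= P (Y @^-1` box (fun i => (c i + dl)%R)) + e%:E)%E) ->
  (forall (c : 'I_n -> R) (dl e : R), 0 < dl -> 0 < e ->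
    (P (Y @^-1` box c) <= P (X @^-1` box (fun i => (c i + dl)%R)) + e%:E)%E) ->
  forall A, measurable A -> P (X @^-1` A) = P (Y @^-1` A).
Proof.
move=> mX mY XY YX A mA.
have le_box (Z Z' : T -> n.-tuple RB) : measurable_fun setT Z ->
    (forall (c : 'I_n -> R) (dl e : R), 0 < dl -> 0 < e ->
    (P (Z' @^-1` box c) <= P (Z @^-1` box (fun i => (c i + dl)%R)) + e%:E)%E) ->
    forall c, (P (Z' @^-1` box c) <= P (Z @^-1` box c))%E.
  move=> mZ h c.
  pose S k := Z @^-1` box (fun i => c i + k.+1%:R^-1).
  have mS k : measurable (S k).
    by rewrite -[S k]setTI; apply: mZ => //; exact: measurable_box.
  have SE : Z @^-1` box c = \bigcap_k S k.
    apply/seteqP; split => x /=.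
      by move=> hx k _ i; rewrite (le_trans (hx i))// lerDl.
    move=> hx i; apply/ler_addgt0Pr => e e0.
    have := hx (Num.truncn e^-1) I i; move/le_trans; apply; rewrite lerD2l.
    by rewrite -[leRHS]invrK lef_pV2 ?posrE ?invr_gt0// ltW// truncnS_gt.
  have cS : P (S k) @[k --> \oo] --> P (Z @^-1` box c).
    rewrite SE; apply: nonincreasing_cvg_mu => //.
    - by rewrite (le_lt_trans (probability_le1 _ _))// ltry.
    - exact: bigcapT_measurable.
    - apply/nonincreasing_seqP => k; apply/subsetPset => x hx i.
      rewrite (le_trans (hx i))// lerD2l lef_pV2 ?posrE//.
      by rewrite ler_nat.
  rewrite -(cvg_lim _ cS)//; apply: lime_ge; first by apply/cvg_ex; eexists; exact: cS.
  apply: nearW => k; apply/lee_addgt0Pr => e e0.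
  by apply: h => //; rewrite invr_gt0.
have eq_box c : P (X @^-1` box c) = P (Y @^-1` box c).
  by apply/eqP; rewrite eq_le !le_box.
pose m1 := measure_function_pushforward__canonical__measure_function_Measure P mX.
pose m2 := measure_function_pushforward__canonical__measure_function_Measure P mY.
apply: (@g_sigma_algebra_measure_unique _ R _ [set box c | c in [set: 'I_n -> R]]
  _ (fun k => box (fun=> k%:R)) _ _ m1 m2).
- by move=> _ [c _ <-]; exact: measurable_box.
- by move=> k; eexists; last reflexivity.
- apply/seteqP; split => // v _; exists (Num.truncn (\sum_(j < n) `|tnth v j|)).+1 => // j.
  apply: le_trans (ltW (truncnS_gt _)).
  by rewrite (bigD1 j)//= (le_trans (ler_norm _))// lerDl sumr_ge0.
- by move=> _ _ [c _ <-] [c' _ <-]; rewrite boxI; eexists; last reflexivity.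
- by move=> _ [c _ <-]; exact: eq_box.
- move=> k; rewrite /m1 /= /pushforward (le_lt_trans (probability_le1 _ _)) ?ltry//.
  by rewrite -[X in measurable X]setTI; apply: (mX measurableT); exact: measurable_box.
- exact: measurable_tuple_boxes.
Qed.

End tuple_boxes.

Section ell_law.
Context {R : realType} {H B : completeNormedModType R}.
Variables (ip : {dot H for idfun}) (iota : {linear H -> B}) (K : R).
Hypothesis ip_norm : forall x, ip x x = `|x| ^+ 2.
Hypothesis iota_bounded : forall x, `|iota x| <= K * `|x|.
Hypothesis iota_dense : dense (range iota).
Hypothesis iota_inj : forall x, iota x = 0 -> x = 0.
Variables (t : R) (t0 : 0 < t) (mu : probability (borel B) R).
Hypothesis mu_gaussian : gaussian_measure ip iota t mu.
Let RB := measurableTypeR R.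

Local Notation ell := (ell ip iota mu).

Let mell a : measurable_fun setT (ell a : borel B -> RB).
Proof.
exact: (measurable_ell ip_norm iota_bounded iota_dense iota_inj t0 mu_gaussian).
Qed.

Definition ell_tuple n (w : n.-tuple H) (x : borel B) : n.-tuple RB :=
  [tuple ell (tnth w i) x | i < n].

Lemma measurable_ell_tuple n (w : n.-tuple H) : measurable_fun setT (ell_tuple w).
Proof. by apply: measurable_mktuple => i; exact: mell. Qed.

Let markov1 (g : borel B -> R) (dl e : R) : measurable_fun setT g -> 0 < dl ->
  (forall x, 0 <= g x) -> (\int[mu]_x (g x)%:E <= (dl * e)%:E)%E ->
  (mu [set x | (dl <= g x)%R] <= e%:E)%E.
Proof.
move=> mg dl0 g0 h.
have := @le_integral_comp_abse _ _ _ mu setT measurableT (EFin \o g) dl id.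
move=> /(_ (@measurable_id _ _ _) (fun r r0 => r0)).
move=> /(_ (fun x y _ _ xy => xy)).
move=> /(_ ((measurable_EFinP _ _).2 mg) dl0).
rewrite setTI /=; under [X in (_ <= X)%E -> _]eq_integral do rewrite ger0_norm//.
move=> /le_trans/(_ h).
rewrite [X in (_ * mu X <= _)%E -> _](_ : _ = [set x | (dl <= g x)%R]); last first.
  by apply/seteqP; split => x /=; rewrite lee_fin ger0_norm.
by rewrite EFinM lee_pmul2l.
Qed.

(** Outside the event dl <= g, membership of X in the box forces Z into the enlarged box. *)
Let sub_cover n (Z X : borel B -> n.-tuple RB) (g : borel B -> R) c (dl e : R) :
  measurable_fun setT Z -> measurable_fun setT X -> measurable_fun setT g ->
  (forall x i, `|tnth (Z x) i - tnth (X x) i| <= g x) ->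
  (mu [set x | (dl <= g x)%R] <= e%:E)%E ->
  (mu (X @^-1` box c) <= mu (Z @^-1` box (fun i => (c i + dl)%R)) + e%:E)%E.
Proof.
move=> mZ mX mg hg he.
have mXc : measurable (X @^-1` box c).
  by rewrite -[X in measurable X]setTI; apply: (mX measurableT); exact: measurable_box.
have mZc : measurable (Z @^-1` box (fun i => (c i + dl)%R)).
  by rewrite -[X in measurable X]setTI; apply: (mZ measurableT); exact: measurable_box.
have mgd : measurable [set x | (dl <= g x)%R].
  have := mg measurableT _ (measurable_itv `[dl, +oo[); rewrite setTI.
  by congr measurable; apply/seteqP; split => x /=; rewrite in_itv/= andbT.
apply: (@le_trans _ _ (mu (Z @^-1` box (fun i => (c i + dl)%R) `|`
  [set x | (dl <= g x)%R]))).
  apply: le_measure; rewrite ?inE//; first exact: measurableU.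
  move=> x Xx; have [gx|gx] := leP dl (g x); [by right|left => i].
  have := hg x i; have := Xx i; rewrite ler_norml => h1 /andP[_ h2].
  by move: h1 h2 gx => *; lra.
by apply: le_trans (measureU2 _ _ _) _ => //; rewrite leeD2l.
Qed.

(** An orthonormal family in the image of B' close to w yields a tuple whose law is exactly Gaussian
    and which is close to [ell_tuple w] in L^1, hence in probability by Markov's inequality. *)
Lemma ell_law n (w : n.-tuple H) : orthonormal ip w ->
  forall A, measurable A -> mu (ell_tuple w @^-1` A) = gaussian t A.
Proof.
move=> ow.
pose D := [set a | exists y, dual_elt ip iota a y].
have Ddense : dense D by exact: (dual_elt_dense ip_norm iota_bounded iota_inj).
have Dlin s x y : D x -> D y -> D (s *: x + y).
  by move=> [f xf] [g yg]; eexists; exact: dual_elt_lin xf yg.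
have approx e : 0 < e -> exists (b : n.-tuple H) (y : 'I_n -> borel B -> RB),
    [/\ orthonormal ip b, (forall i, dual_elt ip iota (tnth b i) (y i)) &
        forall i, `|tnth b i - tnth w i| < e].
  move=> e0; have [b [sb ob Db bw]] := orthonormal_approx ip_norm Ddense Dlin ow e0.
  rewrite size_tuple in sb bw.
  pose b' : n.-tuple H := tcast sb (in_tuple b).
  have b'E : tval b' = b by rewrite val_tcast.
  have /choice[y hy] : forall i, exists y : borel B -> RB, dual_elt ip iota (tnth b' i) y.
    by move=> i; apply: Db; rewrite -b'E mem_tnth.
  exists b', y; split => //; first by rewrite b'E.
  by move=> i; rewrite !(tnth_nth 0) b'E; exact: bw.
have my (b : n.-tuple H) (y : 'I_n -> borel B -> RB) :
    (forall i, dual_elt ip iota (tnth b i) (y i)) ->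
    forall i, measurable_fun setT (y i).
  by move=> h i; exact: measurable_dual_elt (h i).
(* Y need not be close to w: it realises the Gaussian law as that of a random tuple, since
   [law_unique] compares two tuples. Each approximating tuple has the law of Y and is exchanged for
   it. *)
have [b [y [ob by_ _]]] := approx _ ltr01.
pose Y x := [tuple y i x | i < n].
have mY : measurable_fun setT Y by apply: measurable_mktuple; exact: my by_.
have close (dl e : R) : 0 < dl -> 0 < e -> exists z : 'I_n -> borel B -> RB,
    [/\ forall i, measurable_fun setT (z i),
        (forall A, measurable A -> mu ((fun x => [tuple z i x | i < n]) @^-1` A) = gaussian t A) &
        (mu [set x | (dl <= \sum_(i < n) `|z i x - ell (tnth w i) x|)%R] <= e%:E)%E].
  move=> dl0 e0.
  (* The n coordinates, each within dl e' in L^1, add up to at most dl e, as Markov's inequality at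
     level dl requires; n + 1 covers the empty tuple. *)
  pose e' : R := e / n.+1%:R.
  have e'0 : 0 < e' by rewrite divr_gt0.
  have /choice[r hr] : forall i, exists r : R, 0 < r /\
     forall b (y : borel B -> R), dual_elt ip iota b y -> `|b - tnth w i| < r ->
       ('N[mu]_1[EFin \o (y \- ell (tnth w i))%R] < (dl * e')%:E)%E.
    move=> i.
    have [r r0 h] := ell_approx ip_norm iota_bounded iota_dense iota_inj t0
      mu_gaussian (tnth w i) (mulr_gt0 dl0 e'0).
    by exists r.
  pose rm := \big[Num.min/1]_(i < n) r i.
  have rm0 : 0 < rm.
    apply: (big_ind (fun x => 0 < x)) => // [x z x0 z0|i _].
      by rewrite lt_min x0.
    exact: (hr i).1.
  have [c [z [oc cz cw]]] := approx _ rm0.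
  exists z; split; [exact: my cz| |].
    by move=> A mA; exact: (mu_gaussian oc cz mA).
  have md i : measurable_fun setT (fun x => `|z i x - ell (tnth w i) x|).
    by apply: measurableT_comp => //; apply: measurable_funB; [exact: my cz _|exact: mell].
  apply: markov1 => //; first exact: measurable_sum.
    by move=> x; rewrite sumr_ge0.
  under eq_integral do rewrite -sumEFin.
  rewrite ge0_integral_sum//; last first.
    by move=> i; exact/measurable_EFinP.
  apply: (@le_trans _ _ (\sum_(i < n) (dl * e')%:E)%E).
    apply: lee_sum => i _.
    have := (hr i).2 _ _ (cz i); rewrite Lnorm1 => h; apply/ltW/h.
    by apply: lt_le_trans (cw i) _; rewrite /rm bigmin_le.
  rewrite sumEFin lee_fin sumr_const card_ord -[_ *+ n]mulr_natl /e'.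
  rewrite mulrCA ler_pM2l// mulrCA ler_piMr ?(ltW e0)//.
  by rewrite ler_pdivrMr// mul1r ler_nat.
have le_term (z : 'I_n -> borel B -> RB) x i :
    `|z i x - ell (tnth w i) x| <= \sum_(j < n) `|z j x - ell (tnth w j) x|.
  by rewrite (bigD1 i)//= lerDl sumr_ge0.
have mg (z : 'I_n -> borel B -> RB) : (forall i, measurable_fun setT (z i)) ->
    measurable_fun setT (fun x => \sum_(j < n) `|z j x - ell (tnth w j) x|).
  move=> mz; apply: measurable_sum => i; apply: measurableT_comp => //.
  by apply: measurable_funB; [exact: mz|exact: mell].
have lawY A : measurable A -> mu (Y @^-1` A) = gaussian t A.
  by move=> mA; exact: (mu_gaussian ob by_ mA).
move=> A mA; rewrite -(lawY A mA).
apply: law_unique => //; first exact: measurable_ell_tuple.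
- move=> c dl e dl0 e0; have [z [mz lawz hz]] := close _ _ dl0 e0.
  pose Z x := [tuple z i x | i < n].
  have mZ : measurable_fun setT Z by exact: measurable_mktuple.
  have -> : mu (Y @^-1` box (fun i => c i + dl)) = mu (Z @^-1` box (fun i => c i + dl)).
    by rewrite lawY ?lawz//; exact: measurable_box.
  apply: sub_cover hz => //; first exact: measurable_ell_tuple.
    exact: mg.
  move=> x i; rewrite !tnth_mktuple; exact: le_term.
- move=> c dl e dl0 e0; have [z [mz lawz hz]] := close _ _ dl0 e0.
  pose Z x := [tuple z i x | i < n].
  have mZ : measurable_fun setT Z by exact: measurable_mktuple.
  have -> : mu (Y @^-1` box c) = mu (Z @^-1` box c).
    by rewrite lawY ?lawz//; exact: measurable_box.
  apply: sub_cover hz => //; first exact: measurable_ell_tuple.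
    exact: mg.
  move=> x i; rewrite !tnth_mktuple distrC; exact: le_term.
Qed.

End ell_law.

(** * Joint laws under linear isometries of H *)

Section ell_isometry.
Context {R : realType} {H B : completeNormedModType R}.
Variables (ip : {dot H for idfun}) (iota : {linear H -> B}) (K : R).
Hypothesis ip_norm : forall x, ip x x = `|x| ^+ 2.
Hypothesis iota_bounded : forall x, `|iota x| <= K * `|x|.
Hypothesis iota_dense : dense (range iota).
Hypothesis iota_inj : forall x, iota x = 0 -> x = 0.
Variables (t : R) (t0 : 0 < t) (mu : probability (borel B) R).
Hypothesis mu_gaussian : gaussian_measure ip iota t mu.
Let RB := measurableTypeR R.

Local Notation ell := (ell ip iota mu).
Local Notation ell_tuple := (ell_tuple ip iota mu).

Let mell a : measurable_fun setT (ell a : borel B -> RB).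
Proof.
exact: (measurable_ell ip_norm iota_bounded iota_dense iota_inj t0 mu_gaussian).
Qed.

Let mell_tuple n (w : n.-tuple H) : measurable_fun setT (ell_tuple w).
Proof.
exact: (measurable_ell_tuple ip_norm iota_bounded iota_dense iota_inj t0 mu_gaussian).
Qed.

Let ell_linP s a b : {ae mu, forall x, ell (s *: a + b) x = s * ell a x + ell b x}.
Proof.
exact: (ell_lin ip_norm iota_bounded iota_dense iota_inj t0 mu_gaussian).
Qed.

Lemma ell0 : {ae mu, forall x, ell 0 x = 0}.
Proof.
have := ell_linP (-1) 0 0; rewrite scaler0 addr0; apply: filterS => x ->.
by rewrite mulN1r addNr.
Qed.

Lemma ell_sum (I : Type) (r : seq I) (c : I -> R) (u : I -> H) :
  {ae mu, forall x, ell (\sum_(i <- r) c i *: u i) x =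
                    \sum_(i <- r) c i * ell (u i) x}.
Proof.
elim: r => [|i r ih].
  by rewrite big_nil; apply: filterS ell0 => x ->; rewrite big_nil.
rewrite big_cons.
apply: filterS2 ih (ell_linP (c i) (u i) (\sum_(i <- r) c i *: u i)) => x ihx ->.
by rewrite big_cons ihx.
Qed.

Lemma ell_expansion w a : orthonormal ip w -> span w a ->
  {ae mu, forall x, ell a x = \sum_(i < size w) ip a w`_i * ell w`_i x}.
Proof.
move=> ow aw.
have := ell_sum (index_enum 'I_(size w)) (fun i => ip a w`_i) (fun i => w`_i).
by apply: filterS => x; rewrite -(orthonormal_expansion ow aw).
Qed.

Lemma ae_eq_tuple n (X Y : borel B -> n.-tuple RB) :
  (forall i, {ae mu, forall x, tnth (X x) i = tnth (Y x) i}) ->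
  {ae mu, forall x, X x = Y x}.
Proof.
move=> h.
(* [ae_foralln] quantifies over natural numbers, so the ordinal i is tied to a number k. *)
have h' : {ae mu, forall x, forall k, forall i : 'I_n, i = k :> nat ->
    tnth (X x) i = tnth (Y x) i}.
  apply/ae_foralln => k; have [kn|nk] := ltnP k n; last first.
    by apply: nearW => x i ik; move: nk; rewrite -ik leqNgt ltn_ord.
  apply: filterS (h (Ordinal kn)) => x hx i ik.
  by have -> : i = Ordinal kn by exact/val_inj.
by apply: filterS h' => x hx; apply: eq_from_tnth => i; exact: (hx i).
Qed.

(** The linear map through which the tuple of the [ell (a i)] depends on the tuple of [ell] along r,
    for r orthonormal with span containing the [a i]. *)
Definition coordinates (r : seq H) n (a : 'I_n -> H) (v : (size r).-tuple RB) :
  n.-tuple RB := [tuple \sum_(j < size r) ip (a i) r`_j * tnth v j : RB | i < n].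

Lemma measurable_coordinates r n (a : 'I_n -> H) :
  measurable_fun setT (coordinates (r := r) a).
Proof.
apply: measurable_mktuple => i; apply: measurable_sum => j.
by apply: measurable_funM => //; exact: measurable_tnth.
Qed.

Lemma ell_coordinates (r : seq H) n (a : 'I_n -> H) : orthonormal ip r ->
  (forall i, span r (a i)) ->
  {ae mu, forall x, [tuple ell (a i) x | i < n] =
                    coordinates a (ell_tuple (in_tuple r) x)}.
Proof.
move=> or ar; apply: ae_eq_tuple => i.
apply: filterS (ell_expansion or (ar i)) => x hx; rewrite !tnth_mktuple hx.
by apply: eq_bigr => j _; rewrite tnth_mktuple (tnth_nth 0).
Qed.

Lemma orthonormal_span n (a : 'I_n -> H) :
  exists r, orthonormal ip r /\ forall i, span r (a i).
Proof.
have [//|r [or rE]] := gram_schmidt ip_norm (codom a) (w := [::]).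
exists r; split => // i; rewrite /= in rE; rewrite rE.
by apply: span_mem; exact: codom_f.
Qed.

Lemma ge0_integral_ell_coordinates (r : seq H) n (a : 'I_n -> H)
    (Phi : n.-tuple RB -> \bar R) :
  orthonormal ip r -> (forall i, span r (a i)) ->
  measurable_fun setT Phi -> (forall v, 0 <= Phi v)%E ->
  (\int[mu]_x Phi [tuple ell (a i) x | i < n] =
   \int[mu]_x Phi (coordinates a (ell_tuple (in_tuple r) x)))%E.
Proof.
move=> or ar mPhi Phi0; apply: ge0_ae_eq_integral => //.
- by apply: measurableT_comp => //; apply: measurable_mktuple => i; exact: mell.
- apply: measurableT_comp => //.
  exact: measurableT_comp (measurable_coordinates a) (mell_tuple _).
- by apply: filterS (ell_coordinates or ar) => x hx _; rewrite hx.
Qed.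

(** Both tuples are images, under one and the same matrix of inner products, of [ell] along the
    orthonormal families r and [map phi r], which have the same Gaussian law. *)
Lemma ge0_integral_ell_isometry (phi : {linear H -> H}) n (a : 'I_n -> H)
    (Phi : n.-tuple RB -> \bar R) :
  (forall x y, ip (phi x) (phi y) = ip x y) ->
  measurable_fun setT Phi -> (forall v, 0 <= Phi v)%E ->
  (\int[mu]_x Phi [tuple ell (a i) x | i < n] =
   \int[mu]_x Phi [tuple ell (phi (a i)) x | i < n])%E.
Proof.
move=> phi_ip mPhi Phi0; have [r [or ar]] := orthonormal_span a.
have opr : orthonormal ip (map phi r).
  apply/orthonormal_nthP => i j; rewrite size_map => ir jr.
  by rewrite !(nth_map 0)// phi_ip (orthonormal_nthP ip r).1.
have apr i : span (map phi r) (phi (a i)).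
  have [c ->] := ar i; rewrite linear_sum.
  under eq_bigr do rewrite linearZ.
  apply: (@span_sum _ _ _ 'I_(size r) _ (fun i => phi r`_i)) => j.
  by apply: span_mem; apply: map_f; rewrite mem_nth.
rewrite (ge0_integral_ell_coordinates or ar)//.
rewrite (ge0_integral_ell_coordinates opr apr)//.
(* The cast gives [map phi r] the type of r, so that one function Psi integrates both tuples. *)
pose s : (size r).-tuple H := tcast (size_map phi r) (in_tuple (map phi r)).
have sE : tval s = map phi r by rewrite val_tcast.
pose Psi v := Phi (coordinates (r := r) a v).
have mPsi : measurable_fun setT Psi.
  by apply: measurableT_comp => //; exact: measurable_coordinates.
transitivity (\int[mu]_x Psi (ell_tuple s x))%E.
  have lawE w : orthonormal ip (tval w) -> forall A, measurable A ->
      mu (@ell_tuple (size r) w @^-1` A) = gaussian t A.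
    move=> ow A; exact: (ell_law ip_norm iota_bounded iota_dense iota_inj t0 mu_gaussian).
  have lawrs A : measurable A ->
      mu (ell_tuple (in_tuple r) @^-1` A) = mu (ell_tuple s @^-1` A).
    by move=> mA; rewrite (lawE (in_tuple r))// (lawE s)// sE.
  exact: (@ge0_integral_law R _ _ mu _ _ mu _ (ell_tuple (in_tuple r)) (ell_tuple s)
    Psi (mell_tuple _) (mell_tuple _) lawrs mPsi (fun=> Phi0 _)).
apply: eq_integral => x _; rewrite /Psi; congr Phi.
apply: eq_from_tnth => i; rewrite !tnth_mktuple.
pose G k := ip (a i) r`_k * ell (map phi r)`_k x.
transitivity (\sum_(j < size r) G j).
  by apply: eq_bigr => j _; rewrite tnth_mktuple (tnth_nth 0) sE.
rewrite -[in LHS](size_map phi r); apply: eq_bigr => j _.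
rewrite tnth_mktuple (tnth_nth 0) /G (nth_map 0) ?phi_ip//.
by rewrite -(size_map phi r).
Qed.

End ell_isometry.

(** * Cameron-Martin formula *)

Section density_measure.
Context d (T : measurableType d) (R : realType).
Variables (m : {measure set T -> \bar R}) (rho : T -> R).
Hypotheses (mrho : measurable_fun setT rho) (rho0 : forall x, 0 <= rho x).
Local Open Scope ereal_scope.

Lemma density_measure_exists : exists m' : {measure set T -> \bar R},
  forall A, m' A = \int[m]_(x in A) (rho x)%:E.
Proof.
pose f A := \int[m]_(x in A) (rho x)%:E.
have f0 : f set0 = 0 by exact: integral_set0.
have fge0 A : 0 <= f A by apply: integral_ge0 => x _; rewrite lee_fin.
have fadd : semi_sigma_additive f.
  move=> F mF tF mUF; rewrite /f ge0_integral_bigcup//.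
  - apply: is_cvg_ereal_nneg_natsum_cond => n _ _; exact: fge0.
  - by apply/measurable_EFinP; exact: measurable_funTS.
  - by move=> x _; rewrite lee_fin.
pose mx := isMeasure.Build _ _ _ f f0 fge0 fadd.
pose m' : {measure set T -> \bar R} := HB.pack f mx.
by exists m'.
Qed.

End density_measure.

Section cameron_martin.
Context {R : realType} {H B : completeNormedModType R}.
Variables (ip : {dot H for idfun}) (iota : {linear H -> B}) (K : R).
Hypothesis ip_norm : forall x, ip x x = `|x| ^+ 2.
Hypothesis iota_bounded : forall x, `|iota x| <= K * `|x|.
Hypothesis iota_dense : dense (range iota).
Hypothesis iota_inj : forall x, iota x = 0 -> x = 0.
Variables (t : R) (t0 : 0 < t) (mu : probability (borel B) R).
Hypothesis mu_gaussian : gaussian_measure ip iota t mu.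
Hypothesis H_separable : separable H.
Let RB := measurableTypeR R.

Local Notation ell := (ell ip iota mu).
Local Notation ell_tuple := (ell_tuple ip iota mu).

Let mell a : measurable_fun setT (ell a : borel B -> RB).
Proof.
exact: (measurable_ell ip_norm iota_bounded iota_dense iota_inj t0 mu_gaussian).
Qed.

Let mell_tuple n (w : n.-tuple H) : measurable_fun setT (ell_tuple w).
Proof.
exact: (measurable_ell_tuple ip_norm iota_bounded iota_dense iota_inj t0 mu_gaussian).
Qed.

Definition cm_density u (s : R) (x : borel B) : R :=
  expR (s * ell u x / t - s ^+ 2 / (2 * t)).

Lemma measurable_cm_density u s : measurable_fun setT (cm_density u s).
Proof.
apply: measurableT_comp => //; apply: measurable_funB => //.
apply: measurable_funM => //; apply: measurable_funM => //; exact: mell.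
Qed.

Lemma cm_density_ge0 u s x : 0 <= cm_density u s x.
Proof. exact: expR_ge0. Qed.

Lemma measurable_translation (b : B) :
  measurable_fun setT ((fun z => b + z) : borel B -> borel B).
Proof.
apply: continuous_measurable_borel => z.
by apply: cvgD; [exact: cvg_cst|exact: cvg_id].
Qed.

(** Along an orthonormal family starting with u whose span contains the [a i], translation by
    [iota (s *: u)] changes only the coordinate of u, and the one-coordinate Gaussian shift
    applies. *)
Lemma cameron_martin_cylinder u s n (a : 'I_n -> H) (y : 'I_n -> B -> R)
    (C : set (n.-tuple RB)) :
  ip u u = 1 -> (forall i, dual_elt ip iota (a i) (y i)) -> measurable C ->
  (mu [set z | C [tuple (y i (iota (s *: u) + z)%R : RB) | i < n]] =
   \int[mu]_(z in [set z | C [tuple (y i z : RB) | i < n]]) (cm_density u s z)%:E)%E.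
Proof.
move=> u1 ay mC.
have ou : orthonormal ip [:: u] by rewrite /orthonormal /= u1 eqxx.
have [r [ow wE]] := gram_schmidt ip_norm (codom a) ou.
rewrite /= in ow wE; pose w := u :: r.
have aw i : span w (a i).
  by rewrite /w wE; apply: span_mem; rewrite inE codom_f orbT.
pose X (z : borel B) : (size r).+1.-tuple RB := ell_tuple (in_tuple w) z.
have mX : measurable_fun setT X by exact: mell_tuple.
have lawX A : measurable A -> mu (X @^-1` A) = gaussian t A.
  exact: (ell_law ip_norm iota_bounded iota_dense iota_inj t0 mu_gaussian).
pose co : (size r).+1.-tuple RB -> n.-tuple RB := coordinates ip (r := w) a.
have mco : measurable_fun setT co by exact: (measurable_coordinates ip (r := w) a).
have yX : {ae mu, forall z, [tuple (y i z : RB) | i < n] = co (X z)}.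
  have h1 : {ae mu, forall z, [tuple (ell (a i) z : RB) | i < n] = co (X z)}.
    exact: (ell_coordinates ip_norm iota_bounded iota_dense iota_inj t0 mu_gaussian).
  have h2 : {ae mu, forall z, [tuple (ell (a i) z : RB) | i < n] =
                              [tuple (y i z : RB) | i < n]}.
    apply: ae_eq_tuple => i.
    have := ell_dual_elt ip_norm iota_bounded iota_dense iota_inj t0 mu_gaussian (ay i).
    by apply: filterS => z hz; rewrite !tnth_mktuple.
  by apply: filterS2 h1 h2 => z <- <-.
(* The values at the translated point are deduced from the identity at z itself, since [y i] is
   linear at every point of B; no null set has to be translated. *)
have yshift z : [tuple (y i z : RB) | i < n] = co (X z) ->
    [tuple (y i (iota (s *: u) + z)%R : RB) | i < n] = co (shift_head s (X z)).
  move=> hz; apply: eq_from_tnth => i.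
  have := congr1 (fun v => tnth v i) hz; rewrite !tnth_mktuple => hi.
  have [yl _ yi] := ay i.
  rewrite (scalarD _ _ yl) yi hi ipZr.
  under [RHS]eq_bigr do rewrite tnth_shift_head mulrDr.
  rewrite big_split /= addrC; congr (_ + _).
  rewrite big_ord_recl/= big1 ?addr0 1?mulrC// => j _.
  by rewrite mulr0.
pose Phi (v : (size r).+1.-tuple RB) : \bar R := (\1_(co @^-1` C) v)%:E.
have mcoC : measurable (co @^-1` C) by rewrite -[co @^-1` C]setTI; exact: mco.
have mPhi : measurable_fun setT Phi.
  by apply/measurable_EFinP; exact: measurable_indic.
have Phi0 v : (0 <= Phi v)%E by rewrite lee_fin.
have my i : measurable_fun setT (y i : borel B -> RB) := measurable_dual_elt (ay i).
have mYC : measurable [set z : borel B | C [tuple (y i z : RB) | i < n]].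
  have mY : measurable_fun setT (fun z : borel B => [tuple (y i z : RB) | i < n]).
    by apply: measurable_mktuple => i; exact: my.
  by have := mY measurableT _ mC; rewrite setTI.
have mYCs : measurable [set z : borel B | C [tuple (y i (iota (s *: u) + z)%R : RB) | i < n]].
  have mT := measurable_translation (iota (s *: u)).
  by have := mT measurableT _ mYC; rewrite setTI.
have mD := measurable_cm_density u s.
transitivity (\int[mu]_z Phi (shift_head s (X z)))%E.
  rewrite -[LHS]mul1e -integral_cst// integral_mkcond.
  apply: ge0_ae_eq_integral => //.
  - by apply/(measurable_restrictT _ _).1.
  - by apply: measurableT_comp => //; apply: measurableT_comp => //; exact: measurable_shift_head.
  - by move=> x _; rewrite patchE; case: ifP.
  - apply: (@filterS _ _ (ae_filter_ringOfSetsType mu) _ _ _ yX) => z hz _.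
    rewrite patchE /Phi indicE.
    have := yshift z hz => E.
    by case: ifPn; rewrite ?inE ?notin_setE /= E => h;
      [rewrite mem_set|rewrite memNset].
rewrite (ge0_integral_law_shift _ t0 mX lawX mPhi Phi0) [RHS]integral_mkcond.
have theadE z : thead (X z) = ell u z by rewrite /thead tnth_mktuple (tnth_nth 0).
under eq_integral do rewrite theadE -/(cm_density u s _).
apply: ge0_ae_eq_integral => //.
- by apply: emeasurable_funM; [exact: measurableT_comp|exact/measurable_EFinP].
- by apply/(measurable_restrictT _ _).1 => //; apply/measurable_EFinP/measurable_funTS.
- by move=> z _; rewrite mule_ge0// lee_fin expR_ge0.
- by move=> z _; rewrite patchE; case: ifP => // _; rewrite lee_fin cm_density_ge0.
apply: (@filterS _ _ (ae_filter_ringOfSetsType mu) _ _ _ yX) => z hz _.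
rewrite patchE /Phi indicE.
by case: ifPn; rewrite ?inE ?notin_setE /= hz => h;
  [rewrite mem_set// mul1e|rewrite memNset// mul0e].
Qed.

(** The image of mu under translation and the measure with density [cm_density] agree on the
    cylinders [cyl n A], which are stable under intersection and generate the Borel
    sigma-algebra. *)
Lemma cameron_martin u s (F : borel B -> \bar R) : ip u u = 1 ->
  measurable_fun setT F -> (forall x, 0 <= F x)%E ->
  (\int[mu]_z F ((iota (s *: u) + z)%R : borel B) =
   \int[mu]_z (F z * (cm_density u s z)%:E))%E.
Proof.
move=> u1 mF F0.
have [a [y [ay hy]]] :=
  borel_dual_elt ip_norm iota_bounded iota_dense H_separable.
have mT := measurable_translation (iota (s *: u)).
have mD := measurable_cm_density u s.
pose m1 := measure_function_pushforward__canonical__measure_function_Measure mu mT.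
have [m2 m2E] := density_measure_exists mu mD (cm_density_ge0 u s).
pose cyl n (A : nat -> set RB) := [set z : borel B | forall k, (k < n)%N -> A k (y k z)].
pose G : set (set (borel B)) := [set E | exists n (A : nat -> set RB),
  (forall k, measurable (A k)) /\ E = cyl n A].
pose rect n (A : nat -> set RB) : set (n.-tuple RB) :=
  [set v | forall i : 'I_n, A i (tnth v i)].
have mrect n A : (forall k, measurable (A k)) -> measurable (rect n A).
  move=> mA; have -> : rect n A = \bigcap_(i in [set: 'I_n])
      ((fun v : n.-tuple RB => tnth v i) @^-1` A i).
    by apply/seteqP; split => v /= h i; [move=> _; exact: h|exact: h].
  apply: fin_bigcap_measurable => // i _; rewrite -[X in measurable X]setTI.
  exact: measurable_tnth.
have cylE n A : cyl n A = [set z | rect n A [tuple (y i z : RB) | i < n]].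
  apply/seteqP; split => z /= h.
    by move=> i; rewrite tnth_mktuple; exact: h.
  by move=> k kn; have := h (Ordinal kn); rewrite tnth_mktuple.
have my k : measurable_fun setT (y k : borel B -> RB) := measurable_dual_elt (ay k).
have GT : G setT.
  exists 0%N, (fun=> setT); split => [k|]; first exact: measurableT.
  by apply/seteqP; split.
have mG : G `<=` measurable.
  move=> _ [n [A [mA ->]]]; rewrite cylE.
  have mY : measurable_fun setT (fun z : borel B => [tuple (y i z : RB) | i < n]).
    by apply: measurable_mktuple => i; exact: my.
  by have := mY measurableT _ (mrect n A mA); rewrite setTI.
have m12 E : measurable E -> m1 E = m2 E.
  move=> mE.
  apply: (@g_sigma_algebra_measure_unique _ R _ G mG (fun=> setT) _ _ m1 m2).
  - by move=> _.
  - by apply/seteqP; split => // z _; exists 0%N.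
  - move=> _ _ [n [A [mA ->]]] [n' [A' [mA' ->]]].
    exists (maxn n n'), (fun k => (if (k < n)%N then A k else setT) `&`
                               (if (k < n')%N then A' k else setT)); split.
      by move=> k; apply: measurableI; case: ifP.
    apply/seteqP; split => z /=.
      by move=> [h h'] k _; split; case: ifP => // kn; [exact: h|exact: h'].
    by move=> h; split => k kn; have := h k;
      rewrite leq_max kn ?orbT => /(_ isT) [].
  - move=> _ [n [A [mA ->]]]; rewrite m2E cylE.
    rewrite -(cameron_martin_cylinder (a := fun i : 'I_n => a i)
      (y := fun i : 'I_n => y i) s u1 (fun i => ay i) (mrect n A mA)).
    by rewrite /m1 /= /pushforward.
  - move=> k; rewrite /m1 /= /pushforward preimage_setT.
    by rewrite (le_lt_trans (probability_le1 _ _))// ltry.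
  - pose TG := g_sigma_algebraType G.
    (* Each [y n] is measurable for the sigma-algebra of cylinders, so the identity into B is; thus
       every Borel set is generated by cylinders. *)
    have mid : measurable_fun setT (id : TG -> borel B).
      apply: hy => n; move=> _ A mA; rewrite setTI; apply: sub_sigma_algebra.
      exists n.+1, (fun k => if k == n then A else setT); split.
        by move=> k; case: ifP.
      apply/seteqP; split => z /=.
        by move=> Az k _; case: eqP => // ->.
      by move=> /(_ n (leqnn _)); rewrite eqxx.
    by have := mid measurableT _ mE; rewrite setTI.
have -> : (\int[mu]_z F ((iota (s *: u) + z)%R : borel B) = \int[m1]_z F z)%E.
  have := @ge0_integral_pushforward _ _ _ _ _ _ mT mu setT F measurableT mF
    (fun v _ => F0 v).
  by rewrite preimage_setT => <-.
rewrite (eq_measure_integral m2); last by move=> E mE _; exact: m12.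
exact: (ge0_integral_density mD (cm_density_ge0 u s) (fun A _ => m2E A) mF F0).
Qed.

End cameron_martin.

(** * Stochastic extensions *)

Section L1_limit_weight.
Context d (T : measurableType d) (R : realType) (P : probability T R).
Variables (q : nat -> T -> R) (g D : T -> R) (C : R).
Hypotheses (mq : forall n, measurable_fun setT (q n)) (mg : measurable_fun setT g).
Hypotheses (mD : measurable_fun setT D) (D0 : forall x, 0 <= D x).
Hypothesis qC : forall n x, `|q n x| <= C.
Hypothesis D2 : (\int[P]_x (D x ^+ 2)%:E < +oo)%E.
Hypothesis qg : forall e : R, 0 < e -> exists n0, forall n, (n0 <= n)%N ->
  (\int[P]_x `|q n x - g x|%:E <= e%:E)%E.

Let mqg n : measurable_fun setT (fun x => `|q n x - g x|).
Proof. by apply: measurableT_comp => //; exact: measurable_funB. Qed.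

(** The excess of |g| over C is at most |q n - g| pointwise, so its integral is 0. *)
Lemma L1_limit_bounded : {ae P, forall x, `|g x| <= C}.
Proof.
pose h x := Num.max (`|g x| - C) 0.
have mh : measurable_fun setT (EFin \o h).
  apply/measurable_EFinP; apply: measurable_maxr => //; apply: measurable_funB => //.
  exact: measurableT_comp.
have h0 : (\int[P]_x `|(EFin \o h) x|)%E = 0%E.
  apply/eqP; rewrite eq_le integral_ge0 ?andbT//.
  apply/lee_addgt0Pr => e e0; rewrite add0e.
  have [n hn] := qg e0; apply: le_trans (hn n (leqnn n)).
  apply: ge0_le_integral => //.
  - exact: measurableT_comp.
  - exact/measurable_EFinP.
  - move=> x _; rewrite /= lee_fin /h ger0_norm ?le_max ?lexx ?orbT//.
    rewrite ge_max normr_ge0 andbT.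
    have := ler_normD (q n x) (g x - q n x); rewrite addrC subrK distrC.
    by have := qC n x; lra.
have := (ae_eq_integral_abs P measurableT mh).1 h0.
apply: filterS => x /(_ I) /= [hx].
by rewrite -subr_le0 -hx /h le_max lexx.
Qed.

Let iD2 : P.-integrable setT (fun x => (D x ^+ 2)%:E).
Proof.
apply/integrableP; split; first by apply/measurable_EFinP; exact: measurable_funX.
by under eq_integral do rewrite gee0_abs ?lee_fin ?sqr_ge0//.
Qed.

Let i1 : P.-integrable setT (cst 1%E : T -> \bar R).
Proof. exact: finite_measure_integrable_cst. Qed.

Let iD : P.-integrable setT (EFin \o D).
Proof.
have iS := integrableD measurableT i1 iD2.
apply: le_integrable iS => //; first exact/measurable_EFinP.
move=> x _; rewrite /= -?EFinD lee_fin !ger0_norm//; last first.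
  by rewrite addr_ge0// sqr_ge0.
by have := sqr_ge0 (D x - 1); rewrite sqrrB1 => ?; have := D0 x; nra.
Qed.

Lemma integrable_bounded_weight (f : T -> R) : measurable_fun setT f ->
  {ae P, forall x, `|f x| <= C} -> P.-integrable setT (EFin \o (fun x => f x * D x)).
Proof.
move=> mf fC.
have mfD : measurable_fun setT (fun x => f x * D x) by exact: measurable_funM.
apply/integrableP; split; first exact/measurable_EFinP.
have iCD : P.-integrable setT (EFin \o (fun x => `|C| * D x)).
  by apply: eq_integrable (integrableZl measurableT `|C| iD).
have /integrableP[mCD] := iCD; apply: le_lt_trans.
apply: ae_ge0_le_integral => //.
- by apply: measurableT_comp => //; exact/measurable_EFinP.
- exact: measurableT_comp.
- apply: filterS fC => x fx _; rewrite /= lee_fin !normrM ler_wpM2r//.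
  by rewrite normr_id (le_trans fx)// ler_norm.
Qed.

(** As D is unbounded, L^1 convergence of q must be combined with the common bound C: |q n - g| D <=
    (C / k) |q n - g| + (k / 2) D^2, where k is fixed before n. *)
Lemma L1_limit_weight e : 0 < e -> exists n0, forall n, (n0 <= n)%N ->
  `|\int[P]_x (q n x * D x) - \int[P]_x (g x * D x)| <= e.
Proof.
move=> e0.
have igD := integrable_bounded_weight mg L1_limit_bounded.
have iqD n : P.-integrable setT (EFin \o (fun x => q n x * D x)).
  by apply: integrable_bounded_weight => //; exact/nearW.
have C0 : 0 <= C by rewrite (le_trans _ (qC 0 point)).
pose M := fine (\int[P]_x (D x ^+ 2)%:E).
have M0 : 0 <= M by apply: fine_ge0; apply: integral_ge0 => x _; rewrite lee_fin sqr_ge0.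
have ME : (\int[P]_x (D x ^+ 2)%:E)%E = M%:E.
  by rewrite fineK// ge0_fin_numE// integral_ge0// => x _; rewrite lee_fin sqr_ge0.
(* This k makes the term in D^2 contribute at most e / 2; the L^1 precision e k / (2 (C + 1)) below
   does the same for the other term. *)
pose k := e / (M + 1); have k0 : 0 < k by rewrite divr_gt0// ltr_wpDl.
have kM : k * M <= e.
  by rewrite /k mulrAC ler_pdivrMr ?ltr_wpDl// ler_wpM2l ?(ltW e0)// lerDl.
have C1 : 0 < C + 1 by rewrite ltr_wpDl.
have j0 : 0 < e * k / (2 * (C + 1)).
  by apply: divr_gt0; apply: mulr_gt0.
have [n0 hn0] := qg j0; exists n0 => n /hn0 hn.
rewrite -RintegralB//.
have idiff : P.-integrable setT (EFin \o (fun x => q n x * D x - g x * D x)).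
  apply: eq_integrable (integrableB measurableT (iqD n) igD) => //.
rewrite -lee_fin EFin_normr_Rintegral//.
apply: le_trans (le_abse_integral _ measurableT _) _.
  exact: measurable_int idiff.
pose a := C / k.
apply: (@le_trans _ _ (\int[P]_x (a%:E * `|q n x - g x|%:E + (k / 2)%:E * (D x ^+ 2)%:E))%E).
  apply: ae_ge0_le_integral => //.
  - by apply: measurableT_comp => //; exact: measurable_int idiff.
  - move=> x _; rewrite adde_ge0// mule_ge0// lee_fin ?sqr_ge0//.
      by rewrite divr_ge0// ltW.
    by rewrite divr_ge0// ltW.
  - apply: emeasurable_funD; apply: measurable_funeM; apply/measurable_EFinP => //.
    exact: measurable_funX.
  - apply: filterS L1_limit_bounded => x gx _.
    rewrite /= -mulrBl normrM (ger0_norm (D0 x)) -!EFinM -EFinD lee_fin.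
    have G0 : 0 <= `|q n x - g x| by [].
    have GC : `|q n x - g x| <= 2 * C.
      by rewrite (le_trans (ler_normB _ _))// mulrDl mul1r lerD.
    (* AM-GM: G D <= G^2 / (2 k) + k D^2 / 2, and G <= 2 C *)
    rewrite /a; move: G0 GC; set G := `|_|; set dx := D x => G0 GC.
    have : 0 <= (G - k * dx) ^+ 2 / (2 * k).
      by rewrite divr_ge0 ?sqr_ge0// mulr_ge0// ltW.
    have -> : (G - k * dx) ^+ 2 / (2 * k) = G * G / (2 * k) - G * dx + k / 2 * dx ^+ 2.
      by field; rewrite gt_eqF.
    have : G * G / (2 * k) <= C / k * G.
      rewrite ler_pdivrMr; last exact: mulr_gt0.
      have -> : C / k * G * (2 * k) = 2 * C * G by field; rewrite gt_eqF.
      by rewrite ler_wpM2r.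
    set p1 := G * G / (2 * k); set p2 := C / k * G; set p3 := k / 2 * dx ^+ 2.
    set p4 := G * dx; move=> h1 h2; lra.
rewrite ge0_integralD//; last 4 first.
- by move=> x _; rewrite mule_ge0// lee_fin divr_ge0// ltW.
- by apply: measurable_funeM; exact/measurable_EFinP.
- by move=> x _; rewrite mule_ge0// lee_fin ?sqr_ge0// divr_ge0// ltW.
- by apply: measurable_funeM; apply/measurable_EFinP; exact: measurable_funX.
rewrite ge0_integralZl//; last 2 first.
- exact/measurable_EFinP.
- by rewrite lee_fin divr_ge0// ltW.
rewrite ge0_integralZl//; last 3 first.
- by apply/measurable_EFinP; exact: measurable_funX.
- by move=> x _; rewrite lee_fin sqr_ge0.
- by rewrite lee_fin divr_ge0// ltW.
rewrite ME -EFinM.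
apply: (@le_trans _ _ (a%:E * (e * k / (2 * (C + 1)))%:E + (k / 2 * M)%:E)%E).
  by rewrite leeD2r// lee_wpmul2l// lee_fin divr_ge0// ltW.
rewrite -EFinM -EFinD lee_fin.
have -> : a * (e * k / (2 * (C + 1))) = e / 2 * (C / (C + 1)).
  by rewrite /a; field; rewrite !gt_eqF// ltr_wpDl.
have : e / 2 * (C / (C + 1)) <= e / 2.
  by rewrite ler_piMr ?divr_ge0 ?(ltW e0)// ler_pdivrMr ?ltr_wpDl// mul1r lerDl.
by move: kM; lra.
Qed.

End L1_limit_weight.

(** * Extensions of real functions and their transfer by isometries *)

Section real_extension.
Context {R : realType} {H B : completeNormedModType R}.
Variables (ip : {dot H for idfun}) (iota : {linear H -> B}) (K : R).
Hypothesis ip_norm : forall x, ip x x = `|x| ^+ 2.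
Hypothesis iota_bounded : forall x, `|iota x| <= K * `|x|.
Hypothesis iota_dense : dense (range iota).
Hypothesis iota_inj : forall x, iota x = 0 -> x = 0.
Variables (t : R) (t0 : 0 < t) (mu : probability (borel B) R).
Hypothesis mu_gaussian : gaussian_measure ip iota t mu.
Hypothesis H_separable : separable H.
Let RB := measurableTypeR R.

Local Notation ell := (ell ip iota mu).
Local Notation tilde_pi := (tilde_pi ip iota mu).
Local Notation cm_density := (cm_density ip iota t mu).

Let mell a : measurable_fun setT (ell a : borel B -> RB).
Proof.
exact: (measurable_ell ip_norm iota_bounded iota_dense iota_inj t0 mu_gaussian).
Qed.

Lemma tilde_piE w x : tilde_pi w x = \sum_(i < size w) ell w`_i x *: w`_i.
Proof. by rewrite /tilde_pi (big_nth 0) big_mkord. Qed.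

Lemma measurable_tilde_pi w : measurable_fun setT (tilde_pi w : borel B -> borel H).
Proof.
rewrite (_ : tilde_pi w = fun x => \sum_(i < size w) ell w`_i x *: w`_i); last first.
  by apply/funext => x; exact: tilde_piE.
by apply: (measurable_sum_scale ip_norm _ H_separable) => i; exact: mell.
Qed.

(* The entries of v beyond its end are read as 0. *)
Definition nth_comb (k : nat) (b : seq H) n (v : n.-tuple RB) : H :=
  \sum_(i < size b) (nth 0 v (k + i) : R) *: b`_i.

Lemma measurable_nth_comb k b n :
  measurable_fun setT (@nth_comb k b n : _ -> borel H).
Proof.
apply: (measurable_sum_scale ip_norm _ H_separable) => i.
have [kn|nk] := ltnP (k + i) n.
  rewrite (_ : (fun _ => _) = fun v : n.-tuple RB => tnth v (Ordinal kn)).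
    exact: measurable_tnth.
  by apply/funext => v; rewrite (tnth_nth 0).
rewrite (_ : (fun _ => _) = cst (0 : RB)); first exact: measurable_cst.
by apply/funext => v; rewrite nth_default// size_tuple.
Qed.

Lemma integral_ell_isometry (phi : {linear H -> H}) (s : seq H)
    (Phi : (size s).-tuple RB -> \bar R) :
  (forall x y, ip (phi x) (phi y) = ip x y) -> measurable_fun setT Phi ->
  (\int[mu]_x Phi [tuple (ell s`_i x : RB) | i < size s] =
   \int[mu]_x Phi [tuple (ell (phi s`_i) x : RB) | i < size s])%E.
Proof.
move=> phi_ip mPhi.
have h (Psi : (size s).-tuple RB -> \bar R) : measurable_fun setT Psi ->
    (forall v, 0 <= Psi v)%E ->
    (\int[mu]_x Psi [tuple (ell s`_i x : RB) | i < size s] =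
     \int[mu]_x Psi [tuple (ell (phi s`_i) x : RB) | i < size s])%E.
  move=> mPsi Psi0.
  exact: (ge0_integral_ell_isometry ip_norm iota_bounded iota_dense iota_inj t0
    mu_gaussian (fun i : 'I_(size s) => s`_i) phi_ip mPsi Psi0).
have mp : measurable_fun setT (Phi^\+)%E by exact: measurable_funepos.
have mn : measurable_fun setT (Phi^\-)%E by exact: measurable_funeneg.
have hp := h _ mp (fun v => funepos_ge0 Phi v).
have hn := h _ mn (fun v => funeneg_ge0 Phi v).
rewrite integralE [RHS]integralE; congr (_ - _)%E.
  by apply: (eq_trans _ (eq_trans hp _)); apply: eq_integral => x _; rewrite !funeposE.
by apply: (eq_trans _ (eq_trans hn _)); apply: eq_integral => x _; rewrite !funenegE.
Qed.

Section isometry.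
Variable phi : {linear H -> H}.
Hypothesis phi_ip : forall x y, ip (phi x) (phi y) = ip x y.

Lemma phi_tilde_pi (s w : seq H) k x :
  (forall i, (i < size w)%N -> s`_(k + i) = w`_i /\ (k + i < size s)%N) ->
  phi (tilde_pi w x) =
  nth_comb k (map phi w) [tuple (ell s`_i x : RB) | i < size s].
Proof.
move=> sw; rewrite tilde_piE /nth_comb linear_sum size_map.
apply: eq_bigr => i _; have [swi ki] := sw i (ltn_ord i).
rewrite linearZ (nth_map 0)//; congr (_ *: _).
by rewrite (nth_mktuple _ _ (Ordinal ki)) /= swi.
Qed.

Lemma tilde_pi_map_phi (s w : seq H) k x :
  (forall i, (i < size w)%N -> s`_(k + i) = w`_i /\ (k + i < size s)%N) ->
  tilde_pi (map phi w) x =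
  nth_comb k (map phi w) [tuple (ell (phi s`_i) x : RB) | i < size s].
Proof.
move=> sw; rewrite tilde_piE /nth_comb.
apply: eq_bigr => i _; have iw : (i < size w)%N by rewrite -(size_map phi w).
have [swi ki] := sw i iw.
by rewrite (nth_mktuple _ _ (Ordinal ki)) /= swi (nth_map 0).
Qed.

Lemma L1_dist_isometry (q : H -> R) (w1 w2 : seq H) :
  measurable_fun setT (q : borel H -> R) ->
  (\int[mu]_x `|q (phi (tilde_pi w1 x)) - q (phi (tilde_pi w2 x))|%:E =
   \int[mu]_x `|q (tilde_pi (map phi w1) x) - q (tilde_pi (map phi w2) x)|%:E)%E.
Proof.
(* Concatenation makes both projections functions of a single tuple of [ell], read from offsets 0
   and [size w1]; only joint laws are invariant. *)
move=> mq; pose s := w1 ++ w2.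
have s1 i : (i < size w1)%N -> s`_(0 + i) = w1`_i /\ (0 + i < size s)%N.
  move=> iw; rewrite add0n /s nth_cat iw size_cat; split=> //.
  by rewrite (leq_trans iw)// leq_addr.
have s2 i : (i < size w2)%N ->
    s`_(size w1 + i) = w2`_i /\ (size w1 + i < size s)%N.
  move=> iw; rewrite /s nth_cat size_cat ltn_add2l; split=> //.
  by rewrite ltnNge leq_addr/= addKn.
pose Phi (v : (size s).-tuple RB) : \bar R :=
  (`|q (nth_comb 0 (map phi w1) v) - q (nth_comb (size w1) (map phi w2) v)|)%:E.
have mPhi : measurable_fun setT Phi.
  apply/measurable_EFinP; apply: measurableT_comp => //.
  apply: measurable_funB; apply: measurableT_comp mq _; exact: measurable_nth_comb.
have := integral_ell_isometry phi_ip mPhi.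
under eq_integral do rewrite /Phi -(phi_tilde_pi _ s1) -(phi_tilde_pi _ s2).
by under [in RHS]eq_integral do
  rewrite /Phi -(tilde_pi_map_phi _ s1) -(tilde_pi_map_phi _ s2).
Qed.

Lemma weighted_isometry (q : H -> R) u s0 (w : seq H) :
  measurable_fun setT (q : borel H -> R) ->
  (\int[mu]_x (q (phi (tilde_pi w x)) * cm_density u s0 x)%:E =
   \int[mu]_x (q (tilde_pi (map phi w) x) * cm_density (phi u) s0 x)%:E)%E.
Proof.
(* The density reads entry 0, the projection reads from offset 1. *)
move=> mq; pose s := u :: w.
have s1 i : (i < size w)%N -> s`_(1 + i) = w`_i /\ (1 + i < size s)%N by [].
pose Phi (v : (size s).-tuple RB) : \bar R :=
  (q (nth_comb 1 (map phi w) v) *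
   expR (s0 * tnth v ord0 / t - s0 ^+ 2 / (2 * t)))%:E.
have mPhi : measurable_fun setT Phi.
  apply/measurable_EFinP; apply: measurable_funM.
    by apply: measurableT_comp mq _; exact: measurable_nth_comb.
  apply: measurableT_comp => //; apply: measurable_funB => //.
  apply: measurable_funM => //; apply: measurable_funM => //.
  exact: measurable_tnth.
have := integral_ell_isometry phi_ip mPhi.
under eq_integral do rewrite /Phi -(phi_tilde_pi _ s1) tnth_mktuple.
by under [in RHS]eq_integral do rewrite /Phi -(tilde_pi_map_phi _ s1) tnth_mktuple.
Qed.

End isometry.

Definition basis_sequence (E : nat -> set H) (w : nat -> seq H) :=
  [/\ forall n, orthonormal_basis ip (w n) (E n),
      forall n, E n `<=` E n.+1 & dense (\bigcup_n E n)].

(* Stochastic extension in L^1 of a real function, without the integrability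
   of q \o tilde_pi (w n) and of qt. *)
Definition real_extension (q : H -> R) (qt : borel B -> R) :=
  [/\ measurable_fun setT (q : borel H -> R), measurable_fun setT qt &
  forall E w, basis_sequence E w -> forall e : R, 0 < e ->
    exists n0, forall n, (n0 <= n)%N ->
    (\int[mu]_x `|q (tilde_pi (w n) x) - qt x|%:E <= e%:E)%E].

(** Spans of the initial segments of a dense sequence. Only these spans increase; the orthonormal
    bases are chosen independently of each other. *)
Lemma basis_sequence_exists : exists E w, basis_sequence E w.
Proof.
have [s ds] := separable_dense_seq H_separable.
have /choice[w hw] : forall n, exists w, orthonormal ip w /\ span w = span (mkseq s n).
  by move=> n; have [//|r] := gram_schmidt ip_norm (mkseq s n) (w := [::]); exists r.
exists (fun n => span (mkseq s n)), w; split.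
- exact: hw.
- move=> n; apply: span_subset => x /mapP[k]; rewrite mem_iota => /andP[_ kn] ->.
  by apply: span_mem; apply: map_f; rewrite mem_iota/= ltnS ltnW.
- apply/denseP => x e e0; have [n xn] := ds x _ e0.
  exists (s n) => //; exists n.+1 => //; apply: span_mem; apply: map_f.
  by rewrite mem_iota/= add0n.
Qed.

Lemma basis_sequence_isometry (phi phis : {linear H -> H}) E w :
  (forall x y, ip (phi x) (phi y) = ip x y) -> (forall x, phi (phis x) = x) ->
  basis_sequence E w -> basis_sequence (fun n => phi @` E n) (fun n => map phi (w n)).
Proof.
move=> phi_ip phiphis [bE incE /denseP dE].
have phi_norm x : `|phi x| = `|x|.
  by apply/eqP; rewrite -(@eqrXn2 _ 2)// -!ip_norm phi_ip.
split.
- move=> n; have [ow wE] := bE n; split.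
    apply/orthonormal_nthP => i j; rewrite size_map => ir jr.
    by rewrite !(nth_map 0)// phi_ip (orthonormal_nthP ip (w n)).1.
  rewrite -wE; apply/seteqP; split => x.
    move=> /spanP[c ->]; exists (\sum_(i < size (w n)) c i *: (w n)`_i).
      by exists c.
    rewrite linear_sum size_map; apply: eq_bigr => i _.
    by rewrite linearZ (nth_map 0).
  move=> [y [c ->] <-]; rewrite linear_sum.
  under eq_bigr do rewrite linearZ.
  apply: (@span_sum _ _ _ 'I_(size (w n)) _ (fun i => phi (w n)`_i)) => j.
  by apply: span_mem; apply: map_f; rewrite mem_nth.
- by move=> n _ [x /incE Ex <-]; exists x.
- apply/denseP => x e e0; have [y [n _ Ey] xy] := dE (phis x) _ e0.
  exists (phi y); first by exists n => //; exists y.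
  by rewrite -{1}(phiphis x) -linearB phi_norm.
Qed.

Section transfer.
Variables phi phis : {linear H -> H}.
Hypothesis phi_ip : forall x y, ip (phi x) (phi y) = ip x y.
Hypothesis phi_continuous : continuous phi.
Hypothesis phiphis : forall x, phi (phis x) = x.

(** The limit is built along one basis sequence w'. That it serves every other w follows by
    comparing projections along w and w': the isometry turns their distance into one between
    projections along [map phi], both close to qt. *)
Lemma real_extension_isometry (q : H -> R) (qt : borel B -> R) :
  real_extension q qt -> exists gt, real_extension (q \o phi) gt.
Proof.
move=> [mq mqt ext].
have mphi : measurable_fun setT (phi : borel H -> borel H).
  exact: continuous_measurable_borel.
have mqphi : measurable_fun setT (q \o phi : borel H -> R).
  exact: measurableT_comp mq mphi.
have mqpi w : measurable_fun setT (fun x => q (tilde_pi w x)).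
  exact: measurableT_comp mq (measurable_tilde_pi w).
have mqphipi w : measurable_fun setT (fun x => q (phi (tilde_pi w x))).
  exact: measurableT_comp mqphi (measurable_tilde_pi w).
have triangle (a b c : borel B -> R) : measurable_fun setT a ->
    measurable_fun setT b -> measurable_fun setT c ->
    (\int[mu]_x `|a x - c x|%:E <=
     \int[mu]_x `|a x - b x|%:E + \int[mu]_x `|c x - b x|%:E)%E.
  move=> ma mb mc; rewrite -ge0_integralD//; last 2 first.
  - by apply/measurable_EFinP; apply: measurableT_comp => //; exact: measurable_funB.
  - by apply/measurable_EFinP; apply: measurableT_comp => //; exact: measurable_funB.
  apply: ge0_le_integral => //.
  - by apply/measurable_EFinP; apply: measurableT_comp => //; exact: measurable_funB.
  - by apply: emeasurable_funD; apply/measurable_EFinP; apply: measurableT_comp => //;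
      exact: measurable_funB.
  - move=> x _; rewrite -EFinD lee_fin (distrC (c x)).
    by rewrite -{1}(subrK (b x) (a x)) -addrA ler_normD.
have [E' [w' bE']] := basis_sequence_exists.
have bphi E w (b : basis_sequence E w) := basis_sequence_isometry phi_ip phiphis b.
(* Two members of the subsequence differ by the sum of two such errors, and twice 1 / 2^(k+2) is the
   rate of [fast_cauchy_cvg_ae]. *)
pose eps (k : nat) : R := 1 / (2 ^ k.+2)%:R.
have eps0 k : 0 < eps k by rewrite divr_gt0// ltr0n expn_gt0.
have /choice[m hm] : forall k, exists m,
    (\int[mu]_x `|q (tilde_pi (map phi (w' m)) x) - qt x|%:E <= (eps k)%:E)%E.
  by move=> k; have [m hm] := ext _ _ (bphi _ _ bE') _ (eps0 k); exists m; exact: hm.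
pose h k x := q (phi (tilde_pi (w' (m k)) x)).
have mh k : measurable_fun setT (h k) by exact: mqphipi.
have hE k l : (\int[mu]_x `|h k x - h l x|%:E <= (eps k + eps l)%:E)%E.
  rewrite /h (L1_dist_isometry phi_ip)//.
  apply: le_trans (triangle _ _ _ _ mqt _) _ => //.
  by rewrite EFinD leeD.
have epsS k l : (k <= l)%N -> eps l <= eps k.
  move=> kl; rewrite /eps !div1r lef_pV2 ?posrE ?ltr0n ?expn_gt0// ler_nat.
  by rewrite leq_exp2l.
have eps2 k : eps k + eps k = 1 / (2 ^ k.+1)%:R.
  rewrite /eps (expnS 2 k.+1) natrM; field.
  by rewrite pnatr_eq0 expn_eq0.
have [g mg hg] : exists2 g : borel B -> R, measurable_fun setT g &
    {ae mu, forall x, (h ^~ x @ \oo --> g x)%classic}.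
  apply: fast_cauchy_cvg_ae => // k; rewrite Lnorm1.
  apply: le_trans (hE k.+1 k) _; rewrite lee_fin -eps2 lerD2r; exact: epsS.
have gh k : (\int[mu]_x `|g x - h k x|%:E <= (eps k + eps k)%:E)%E.
  apply: (@fatou_limit _ _ _ mu (fun j => h (j + k)%N) g (fun s x => `|s - h k x|)).
  - by move=> j; apply: measurableT_comp => //; exact: measurable_funB.
  - by apply: measurableT_comp => //; exact: measurable_funB.
  - by move=> s x.
  - move=> x s; apply: (@continuous_comp _ _ _ (fun s : R => s - h k x) Num.norm).
      by apply: (@cvgD _ R^o); [exact: cvg_id|exact: cvg_cst].
    exact: norm_continuous.
  - by apply: filterS hg => x hx; rewrite (cvg_shiftn k (h ^~ x)).
  - move=> j; apply: le_trans (hE _ _) _; rewrite lee_fin lerD2r.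
    by apply: epsS; exact: leq_addl.
exists g; split => // E w bE e e0.
have e4 : 0 < e / 4 by rewrite divr_gt0.
have [k hk] : exists k, eps k < e / 4.
  exists (Num.truncn (e / 4)^-1).
  rewrite /eps div1r -[ltRHS]invrK ltf_pV2 ?posrE ?invr_gt0 ?ltr0n ?expn_gt0//.
  apply: lt_le_trans (truncnS_gt _) _; rewrite ler_nat.
  by rewrite (leq_trans (leqnSn _))// ltnW// ltn_expl.
have [n0 hn0] := ext _ _ (bphi _ _ bE) _ e4; exists n0 => n /hn0 hn /=.
apply: le_trans (triangle (fun x => q (phi (tilde_pi (w n) x))) (h k) g _ _ _) _ => //.
apply: (@le_trans _ _ ((e / 4 + eps k)%:E + (eps k + eps k)%:E)%E).
  apply: leeD => //; rewrite /h (L1_dist_isometry phi_ip)//.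
  apply: le_trans (triangle _ _ _ _ mqt _) _ => //.
  by rewrite EFinD leeD.
by rewrite -EFinD lee_fin; lra.
Qed.

End transfer.

End real_extension.

(** * Translated integrals of extensions of real functions *)

Section heat_isometry.
Context {R : realType} {H B : completeNormedModType R}.
Variables (ip : {dot H for idfun}) (iota : {linear H -> B}) (K : R).
Hypothesis ip_norm : forall x, ip x x = `|x| ^+ 2.
Hypothesis iota_bounded : forall x, `|iota x| <= K * `|x|.
Hypothesis iota_dense : dense (range iota).
Hypothesis iota_inj : forall x, iota x = 0 -> x = 0.
Variables (t : R) (t0 : 0 < t) (mu : probability (borel B) R).
Hypothesis mu_gaussian : gaussian_measure ip iota t mu.
Hypothesis H_separable : separable H.
Let RB := measurableTypeR R.

Local Notation ell := (ell ip iota mu).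
Local Notation tilde_pi := (tilde_pi ip iota mu).
Local Notation cm_density := (cm_density ip iota t mu).
Local Notation real_extension := (real_extension ip iota mu).
Local Notation basis_sequence := (basis_sequence ip).

Let mD u s : measurable_fun setT (cm_density u s).
Proof.
exact: (measurable_cm_density ip_norm iota_bounded iota_dense iota_inj t0 mu_gaussian).
Qed.

Let mtilde_pi w : measurable_fun setT (tilde_pi w : borel B -> borel H).
Proof.
exact: (measurable_tilde_pi ip_norm iota_bounded iota_dense iota_inj t0 mu_gaussian).
Qed.

Let cameron_martin u s F := @cameron_martin R H B ip iota K ip_norm iota_bounded
  iota_dense iota_inj t t0 mu mu_gaussian H_separable u s F.

Lemma integral_translation u s (F : borel B -> \bar R) : ip u u = 1 ->
  measurable_fun setT F ->
  (\int[mu]_z F ((iota (s *: u) + z)%R : borel B) =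
   \int[mu]_z (F z * (cm_density u s z)%:E))%E.
Proof.
move=> u1 mF.
have hp := cameron_martin s u1 (measurable_funepos mF) (funepos_ge0 F).
have hn := cameron_martin s u1 (measurable_funeneg mF) (funeneg_ge0 F).
rewrite integralE [RHS]integralE; congr (_ - _)%E.
  apply: (eq_trans _ (eq_trans hp _)); apply: eq_integral => x _; rewrite !funeposE//.
  by rewrite maxe_pMl ?mul0e// lee_fin expR_ge0.
apply: (eq_trans _ (eq_trans hn _)); apply: eq_integral => x _; rewrite !funenegE//.
by rewrite maxe_pMl ?mul0e ?mulNe// lee_fin expR_ge0.
Qed.

(** The square of the density for s is exp(s^2 / t) times the density for 2 s, whose integral is 1
    by the Cameron-Martin formula with F = 1. *)
Lemma cm_density_square_integrable u s : ip u u = 1 ->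
  (\int[mu]_x (cm_density u s x ^+ 2)%:E < +oo)%E.
Proof.
move=> u1.
have DE x : cm_density u s x ^+ 2 = expR (s ^+ 2 / t) * cm_density u (s *+ 2) x.
  rewrite /cm_density -expRM_natl -expRD; congr expR.
  by field; rewrite gt_eqF.
under eq_integral do rewrite DE EFinM.
rewrite ge0_integralZl//; last 2 first.
- exact/measurable_EFinP.
- by move=> x _; rewrite lee_fin expR_ge0.
have := cameron_martin (s *+ 2) u1 (F := cst 1%E) (measurable_cst _) (fun=> lee01).
under [in RHS]eq_integral do rewrite mul1e.
by move=> <-; rewrite integral_cst// mul1e [X in (_ * X)%E]probability_setT mule1 ltry.
Qed.

Lemma limit_translation (q : H -> R) qt C u s E w e : ip u u = 1 ->
  (forall x, `|q x| <= C) -> real_extension q qt -> basis_sequence E w -> 0 < e ->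
  exists n0, forall n, (n0 <= n)%N ->
  `|\int[mu]_x (q (tilde_pi (w n) x) * cm_density u s x) -
    \int[mu]_x (qt (iota (s *: u) + x))| <= e.
Proof.
move=> u1 qC [mq mqt ext] bE e0.
have -> : \int[mu]_x (qt (iota (s *: u) + x)) = \int[mu]_x (qt x * cm_density u s x).
  congr fine; have mF : measurable_fun setT (EFin \o qt : borel B -> \bar R).
    exact/measurable_EFinP.
  exact: (integral_translation (F := EFin \o qt) s u1 mF).
apply: (L1_limit_weight (C := C)) => //.
- by move=> n; apply: measurableT_comp mq _; exact: mtilde_pi.
- by move=> x; exact: expR_ge0.
- exact: cm_density_square_integrable.
- exact: ext bE.
Qed.

Lemma real_heat_isometry (phi phis : {linear H -> H}) (q : H -> R) qt gt C x :
  ~ finite_dimensional H ->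
  (forall x y, ip (phi x) (phi y) = ip x y) -> (forall x, phi (phis x) = x) ->
  (forall x, `|q x| <= C) -> real_extension q qt -> real_extension (q \o phi) gt ->
  \int[mu]_y qt (iota (phi x) + y) = \int[mu]_y gt (iota x + y).
Proof.
move=> H_infinite phi_ip phiphis qC eq eg.
(* For x = 0 any unit vector serves, with s = 0; a nonzero vector exists because the empty family
   does not span H. *)
have [u [s [u1 ->]]] : exists u s, ip u u = 1 /\ x = s *: u.
  have [->|x0] := eqVneq x 0; last first.
    exists (normalize x), `|x|; split; first exact: ip_normalize.
    exact: normalizeK.
  have [y y0] : exists y : H, y != 0.
    apply: contrapT => h; apply: H_infinite; exists [::].
    apply/seteqP; split => // y _.
    have -> : y = 0 by apply/eqP/negPn/negP => y0; apply: h; exists y.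
    exact: span0.
  by exists (normalize y), 0; rewrite scale0r; split => //; exact: ip_normalize.
have pu1 : ip (phi u) (phi u) = 1 by rewrite phi_ip.
rewrite linearZ.
have [E [w bE]] := basis_sequence_exists ip_norm H_separable.
have bE' := basis_sequence_isometry ip_norm phi_ip phiphis bE.
have [mq _ _] := eq.
apply/eqP; rewrite -subr_eq0 -normr_le0; apply/ler_addgt0Pr => e e0; rewrite add0r.
have e2 : 0 < e / 2 by rewrite divr_gt0.
have [n1 h1] := limit_translation s pu1 qC eq bE' e2.
have [n2 h2] := limit_translation s u1 (fun x => qC (phi x)) eg bE e2.
have := h1 _ (leq_maxl n1 n2); have := h2 _ (leq_maxr n1 n2).
(* At this common index the two finite dimensional integrals coincide, and each is within e / 2 of
   its limit. *)
set n := maxn n1 n2.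
have -> : \int[mu]_x ((q \o phi) (tilde_pi (w n) x) * cm_density u s x) =
    \int[mu]_x (q (tilde_pi (map phi (w n)) x) * cm_density (phi u) s x).
  have h := weighted_isometry ip_norm iota_bounded iota_dense iota_inj t0
    mu_gaussian H_separable phi_ip u s (w n) mq.
  by rewrite /Rintegral /comp h.
set a := Rintegral _ _ _; set b := Rintegral _ _ _; set c := Rintegral _ _ _.
move=> h3 h4; have := ler_normD (c - a) (a - b).
rewrite addrA subrK (distrC c a) (distrC c b) => h; lra.
Qed.

End heat_isometry.

(** * Complex functions *)

Section normc.
Context {R : rcfType}.
Implicit Types z : R[i].

Lemma normc_Re_le z : `|complex.Re z| <= Normc.normc z.
Proof.
by case: z => a b; rewrite /Normc.normc -sqrtr_sqr ler_sqrt ?lerDl ?addr_ge0 ?sqr_ge0.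
Qed.

Lemma normc_Im_le z : `|complex.Im z| <= Normc.normc z.
Proof.
by case: z => a b; rewrite /Normc.normc -sqrtr_sqr ler_sqrt ?lerDr ?addr_ge0 ?sqr_ge0.
Qed.

Lemma normc_le z : Normc.normc z <= `|complex.Re z| + `|complex.Im z|.
Proof.
case: z => a b /=; apply: (@le_trans _ _ (Num.sqrt ((`|a| + `|b|) ^+ 2))).
  rewrite ler_sqrt ?sqr_ge0// sqrrD !real_normK ?num_real// lerD2r lerDl.
  by rewrite mulrn_wge0// mulr_ge0.
by rewrite sqrtr_sqr ger0_norm// addr_ge0.
Qed.

Lemma normc_ge0 z : 0 <= Normc.normc z.
Proof. exact: le_trans (normc_Re_le z). Qed.

End normc.

Lemma cvge0P (R : realType) (u : nat -> \bar R) : (forall n, 0 <= u n)%E ->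
  (u n @[n --> \oo] --> 0%E)%classic <->
  forall e : R, 0 < e -> exists n0, forall n, (n0 <= n)%N -> (u n <= e%:E)%E.
Proof.
move=> u0; split=> [h e e0|h].
  have /h[n0 _ hn0] : nbhs 0%E [set y | (y < e%:E)%E].
    by apply: open_ereal_lt'; rewrite lte_fin.
  by exists n0 => n nn0; apply/ltW/hn0.
apply/fine_cvgP; split.
  have [n0 hn0] := h _ ltr01; exists n0 => // n /= nn0.
  by rewrite ge0_fin_numE// (le_lt_trans (hn0 n nn0))// ltry.
apply/cvgrPdist_le => e e0; have [n0 hn0] := h _ e0; exists n0 => // n /= nn0.
rewrite sub0r normrN ger0_norm ?fine_ge0// -lee_fin fineK ?hn0//.
by rewrite ge0_fin_numE// (le_lt_trans (hn0 n nn0))// ltry.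
Qed.

Lemma measurable_normc d (T : measurableType d) (R : realType) (g : T -> R[i]) :
  measurable_funC g -> measurable_fun setT (fun x => Normc.normc (g x)).
Proof.
move=> [mr mi].
rewrite (_ : (fun _ => _) =
    Num.sqrt \o (fun x => Re_fun g x ^+ 2 + Im_fun g x ^+ 2)); last first.
  by apply/funext => x; rewrite /= /Re_fun /Im_fun; case: (g x).
apply: measurableT_comp; first by apply: continuous_measurable_fun => y; exact: sqrt_continuous.
by apply: measurable_funD; exact: measurable_funX.
Qed.

Section heat_isometry_complex.
Context {R : realType} {H B : completeNormedModType R}.
Variables (ip : {dot H for idfun}) (iota : {linear H -> B}) (K : R).
Hypothesis ip_norm : forall x, ip x x = `|x| ^+ 2.
Hypothesis iota_bounded : forall x, `|iota x| <= K * `|x|.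
Hypothesis iota_dense : dense (range iota).
Hypothesis iota_inj : forall x, iota x = 0 -> x = 0.
Variables (t : R) (t0 : 0 < t) (mu : probability (borel B) R).
Hypothesis mu_gaussian : gaussian_measure ip iota t mu.
Hypothesis H_separable : separable H.

Local Notation tilde_pi := (tilde_pi ip iota mu).
Local Notation real_extension := (real_extension ip iota mu).
Local Notation stochastic_extension := (stochastic_extension ip iota mu).
Local Notation tilde := (tilde ip iota mu).

Let mtilde_pi w : measurable_fun setT (tilde_pi w : borel B -> borel H).
Proof.
exact: (measurable_tilde_pi ip_norm iota_bounded iota_dense iota_inj t0 mu_gaussian).
Qed.

(** On a probability space the L^p norm dominates the L^1 norm, and the modulus dominates both
    parts. This removes the exponent, which may differ for f and [f \o phi]. *)
Lemma stochastic_extension_real p f ft : 1 <= p -> stochastic_extension p f ft ->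
  real_extension (Re_fun f) (Re_fun ft) /\ real_extension (Im_fun f) (Im_fun ft).
Proof.
move=> p1 [[mr mi] [[mrt mit] _] ext].
have key (part : R[i] -> R) : (forall z, `|part z| <= Normc.normc z) ->
    (forall z1 z2, part (z1 - z2) = part z1 - part z2) ->
    measurable_fun setT (part \o f : borel H -> R) ->
    measurable_fun setT (part \o ft : borel B -> R) ->
    real_extension (part \o f) (part \o ft).
  move=> part_le partB mp mpt; split => // E w [bE incE dE] e e0.
  have [_ /cvge0P h] := ext E w bE incE dE.
  have [|n0 hn0] := h _ _ e0; first by move=> n; exact: Lnorm_ge0.
  exists n0 => n /hn0; apply: le_trans.
  have mg : measurable_funC (fun x => f (tilde_pi (w n) x) - ft x).
    split; rewrite /Re_fun /Im_fun; under eq_fun do rewrite raddfB.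
      by apply: measurable_funB => //; exact: measurableT_comp mr (mtilde_pi _).
    by apply: measurable_funB => //; exact: measurableT_comp mi (mtilde_pi _).
  have mn := measurable_normc mg.
  rewrite /LnormC; apply: le_trans (Lnorm1_le mu mn p1); rewrite Lnorm1.
  apply: ge0_le_integral => //.
  - apply/measurable_EFinP; apply: measurableT_comp => //; apply: measurable_funB => //.
    exact: measurableT_comp mp (mtilde_pi _).
  - by apply: measurableT_comp => //; exact/measurable_EFinP.
  - move=> x _; rewrite lee_fin /= -partB (le_trans (part_le _))//.
    exact: ler_norm.
split.
  by refine (key (@complex.Re R) (@normc_Re_le R) _ mr mrt) => z1 z2; rewrite raddfB.
by refine (key (@complex.Im R) (@normc_Im_le R) _ mi mit) => z1 z2; rewrite raddfB.
Qed.

Lemma real_extension_bounded q qt C : (forall x, `|q x| <= C) ->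
  real_extension q qt -> {ae mu, forall x, `|qt x| <= C}.
Proof.
move=> qC [mq mqt ext].
have [E [w bE]] := basis_sequence_exists ip_norm H_separable.
apply: (L1_limit_bounded (q := fun n x => q (tilde_pi (w n) x))) => //.
- by move=> n; exact: measurableT_comp mq (mtilde_pi _).
- exact: ext bE.
Qed.

Lemma LnormC1 g : measurable_funC g ->
  LnormC mu 1 g = (\int[mu]_x (Normc.normc (g x))%:E)%E.
Proof.
move=> mg; rewrite /LnormC Lnorm1; apply: eq_integral => x _ /=.
by rewrite ger0_norm// normc_ge0.
Qed.

Lemma LnormC1_le g : measurable_funC g -> (LnormC mu 1 g <=
  \int[mu]_x `|Re_fun g x|%:E + \int[mu]_x `|Im_fun g x|%:E)%E.
Proof.
move=> mg; have [mr mi] := mg; rewrite LnormC1// -ge0_integralD//; last 2 first.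
- by apply/measurable_EFinP; exact: measurableT_comp.
- by apply/measurable_EFinP; exact: measurableT_comp.
apply: ge0_le_integral => //.
- by move=> x _; rewrite lee_fin normc_ge0.
- by apply/measurable_EFinP; exact: measurable_normc.
- by apply: emeasurable_funD; apply/measurable_EFinP; exact: measurableT_comp.
- by move=> x _; rewrite -EFinD lee_fin normc_le.
Qed.

Lemma bounded_in_LpC1 g C : measurable_funC g -> {ae mu, forall x, `|Re_fun g x| <= C} ->
  {ae mu, forall x, `|Im_fun g x| <= C} -> in_LpC mu 1 g.
Proof.
move=> mg rC iC; split => //; apply: le_lt_trans (LnormC1_le mg) _.
have bounded (h : borel B -> R) : measurable_fun setT h ->
    {ae mu, forall x, `|h x| <= C} -> (\int[mu]_x `|h x|%:E < +oo)%E.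
  move=> mh hC; apply: (@le_lt_trans _ _ (\int[mu]_x (`|C|)%:E)%E).
    apply: ae_ge0_le_integral => //.
    - by apply/measurable_EFinP; exact: measurableT_comp.
    - by apply: filterS hC => x hx _; rewrite lee_fin (le_trans hx)// ler_norm.
  by rewrite integral_cst// [X in (_ * X)%E]probability_setT mule1 ltry.
by rewrite lte_add_pinfty//; apply: bounded => //; case: mg.
Qed.

(** Boundedness of f supplies the integrability that [real_extension] leaves out: it passes to a and
    b almost everywhere. *)
Lemma real_extension_stochastic f a b C : (forall x, Normc.normc (f x) <= C) ->
  real_extension (Re_fun f) a -> real_extension (Im_fun f) b ->
  stochastic_extension 1 f (fun x => (a x +i* b x)%C).
Proof.
move=> fC ea eb; have [mr ma exta] := ea; have [mi mb extb] := eb.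
have rC x : `|Re_fun f x| <= C by exact: le_trans (normc_Re_le _) (fC x).
have iC x : `|Im_fun f x| <= C by exact: le_trans (normc_Im_le _) (fC x).
have mfpi w : measurable_funC (f \o tilde_pi w).
  by split; [exact: measurableT_comp mr (mtilde_pi w)|exact: measurableT_comp mi (mtilde_pi w)].
split => //.
  by apply: bounded_in_LpC1 => //; [exact: real_extension_bounded ea|exact: real_extension_bounded eb].
move=> E w bE incE dE; split => [n|].
  by apply: bounded_in_LpC1 => //; apply: aeW => x; [exact: rC|exact: iC].
apply/cvge0P => [n|e e0]; first exact: Lnorm_ge0.
have e2 : 0 < e / 2 by rewrite divr_gt0.
have bs : basis_sequence ip E w by [].
have [n1 h1] := exta E w bs _ e2; have [n2 h2] := extb E w bs _ e2.
exists (maxn n1 n2) => n; rewrite geq_max => /andP[/h1 hr /h2 hi].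
have ReB x : complex.Re (f (tilde_pi (w n) x) - (a x +i* b x)%C) =
    Re_fun f (tilde_pi (w n) x) - a x by rewrite raddfB.
have ImB x : complex.Im (f (tilde_pi (w n) x) - (a x +i* b x)%C) =
    Im_fun f (tilde_pi (w n) x) - b x by rewrite raddfB.
apply: le_trans (LnormC1_le _) _.
  split.
    rewrite /Re_fun; under eq_fun do rewrite ReB.
    by apply: measurable_funB => //; exact: measurableT_comp mr (mtilde_pi _).
  rewrite /Im_fun; under eq_fun do rewrite ImB.
  by apply: measurable_funB => //; exact: measurableT_comp mi (mtilde_pi _).
rewrite (splitr e) EFinD; apply: leeD.
  by under eq_integral do rewrite /Re_fun ReB.
by under eq_integral do rewrite /Im_fun ImB.
Qed.

Definition extendable f := exists ft, exists2 p : R, 1 <= p & stochastic_extension p f ft.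

Section isometry.
Variables phi phis : {linear H -> H}.
Hypothesis phi_ip : forall x y, ip (phi x) (phi y) = ip x y.
Hypothesis phi_continuous : continuous phi.
Hypothesis phiphis : forall x, phi (phis x) = x.

Lemma extendable_isometry f C : (forall x, Normc.normc (f x) <= C) ->
  extendable f -> extendable (f \o phi).
Proof.
move=> fC [ft [p p1 ext]]; have [er ei] := stochastic_extension_real p1 ext.
have transfer q qt (e : real_extension q qt) := real_extension_isometry ip_norm
  iota_bounded iota_dense iota_inj t0 mu_gaussian H_separable phi_ip phi_continuous
  phiphis e.
have [a ea] := transfer _ _ er; have [b eb] := transfer _ _ ei.
exists (fun x => (a x +i* b x)%C), 1 => //.
exact: (@real_extension_stochastic (f \o phi) a b C (fun x => fC (phi x)) ea eb).
Qed.

Lemma integralC_isometry f C x : ~ finite_dimensional H ->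
  (forall x, Normc.normc (f x) <= C) -> extendable f ->
  integralC mu (fun y : borel B => tilde f (iota (phi x) + y)) =
  integralC mu (fun y : borel B => tilde (f \o phi) (iota x + y)).
Proof.
move=> H_infinite fC ef.
(* [tilde] picks its representative by choice, so nothing relates the two picks beyond the fact that
   each is an extension; the argument works for arbitrary ones. *)
have [p p1 ep] : [set ft | exists2 p : R, 1 <= p & stochastic_extension p f ft] (tilde f).
  exact: xgetPex.
have [p' p1' ep'] : [set ft | exists2 p : R, 1 <= p &
    stochastic_extension p (f \o phi) ft] (tilde (f \o phi)).
  by apply: xgetPex; exact: extendable_isometry fC ef.
have [er ei] := stochastic_extension_real p1 ep.
have [er' ei'] := stochastic_extension_real p1' ep'.
have heat q qt gt C' := @real_heat_isometry _ _ _ _ _ _ ip_norm iota_bounded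
  iota_dense iota_inj _ t0 _ mu_gaussian H_separable _ _ q qt gt C' x H_infinite
  phi_ip phiphis.
congr (_ +i* _)%C.
  exact: (heat (Re_fun f) _ _ C (fun y => le_trans (normc_Re_le _) (fC y)) er er').
exact: (heat (Im_fun f) _ _ C (fun y => le_trans (normc_Im_le _) (fC y)) ei ei').
Qed.

End isometry.

End heat_isometry_complex.

Theorem proposition5p16 (R : realType) (H B : completeNormedModType R)
    (ip : {dot H for idfun}) (ip_norm : forall x, ip x x = `|x| ^+ 2)
    (H_separable : separable H) (H_infinite : ~ finite_dimensional H)
    (N : H -> R) (N_measurable : measurable_norm ip N)
    (iota : {linear H -> B}) (B_completion : is_completion iota N)
    (mu : R -> probability (borel B) R)
    (mu_gaussian : forall h, 0 < h -> gaussian_measure ip iota h (mu h))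
    (phi phis : {linear H -> H}) (phi_continuous : continuous phi)
    (phis_adjoint : adjoint ip phi phis)
    (phisphi : phis \o phi = id) (phiphis : phi \o phis = id)
    (A : {linear H -> H}) (A_selfadjoint : selfadjoint ip A)
    (A_nonnegative : nonnegative ip A) (A_trace_class : trace_class ip A)
    (f : H -> R[i]) (f_symbol : symbol_class ip A f) :
  forall t : R, 0 <= t ->
    heat ip iota mu t f \o phi = heat ip iota mu t (f \o phi).
Proof.
move=> t; rewrite le_eqVlt => /predU1P[<-|t0]; first by rewrite /heat eqxx.
rewrite /heat gt_eqF//; apply/funext => x /=.
have [iotaN iota_dense] := B_completion.
have [_ _ N_inj _] := N_measurable.
have iota_inj y : iota y = 0 -> y = 0.
  by move=> y0; apply: N_inj; rewrite -iotaN y0 normr0.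
have [K NK] := measurable_norm_bound ip_norm N_measurable.
have iota_bounded y : `|iota y| <= K * `|y| by rewrite iotaN.
have phisK y : phis (phi y) = y by exact: (congr1 (fun g => g y) phisphi).
have phiK y : phi (phis y) = y by exact: (congr1 (fun g => g y) phiphis).
have phi_ip y z : ip (phi y) (phi z) = ip y z by rewrite phis_adjoint phisK.
have phis_ip y z : ip (phis y) (phis z) = ip y z by rewrite -phi_ip !phiK.
(* Continuity of the inverse is what allows extensions to be carried back from [f \o phi] to f. *)
have phis_continuous : continuous phis.
  move=> y; apply/cvgrPdist_lt => e e0; near=> z.
  have -> : `|phis y - phis z| = `|y - z|.
    by apply/eqP; rewrite -linearB -(@eqrXn2 _ 2)// -!ip_norm phis_ip.
  by near: z; exact: cvgr_dist_lt.
have [_ [_ [C _ [fC _]]]] := f_symbol.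
have muG := mu_gaussian _ t0.
have transfer := @extendable_isometry _ _ _ _ _ _ ip_norm iota_bounded iota_dense
  iota_inj _ t0 _ muG H_separable.
(* [tilde] is defined by choice with default 0. Extendability passes both ways between f and
   [f \o phi], so either both sides use true extensions or both use the default. *)
have [ef|nef] := pselect (extendable ip iota (mu t) f).
  exact: (integralC_isometry ip_norm iota_bounded iota_dense iota_inj t0 muG
    H_separable phi_ip phi_continuous phiK x H_infinite fC ef).
have nef' : ~ extendable ip iota (mu t) (f \o phi).
  move=> e; apply: nef; have -> : f = (f \o phi) \o phis.
    by apply/funext => y /=; rewrite phiK.
  exact: (transfer _ _ phis_ip phis_continuous phisK _ C (fun y => fC (phi y)) e).
have tilde0 g : ~ extendable ip iota (mu t) g -> tilde ip iota (mu t) g = cst 0.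
  by move=> ng; apply: xgetPN => ft eft; apply: ng; exists ft.
by rewrite !tilde0.
Unshelve. all: by end_near.
Qed.
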